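(* Let $G$ be a compact, simple, simply-connected Lie group and let $Q\to X$ be a principal $G$-bundle over a manifold $X$. Then the rigid Chern--Simons bundle 2-gerbe $CS(Q)$ on $X$ is a rigidification of the Chern--Simons bundle 2-gerbe $\mathcal{C}(Q)$ of $Q$; that is, the bundle 2-gerbe $w(CS(Q))$ associated to $CS(Q)$ is isomorphic, as a bundle 2-gerbe over $X$ and in the strict sense of isomorphism recalled in the context, to $\mathcal{C}(Q)$.
   Context: **Conventions.** Manifolds are smooth Fréchet manifolds. For a surjective submersion $Y\to X$, $Y^{[k]}$ is the $k$-fold fibre product over $X$ and $d_i\colon Y^{[k]}\to Y^{[k-1]}$ omits the $(i+1)$-th factor. On a semisimplicial manifold with face maps $d_i$, for a principal $U(1)$-bundle $E$ put $\delta E=d_0^*E\otimes d_1^*E^*\otimes d_2^*E\otimes\cdots$, and $\delta\omega=\sum(-1)^i d_i^*\omega$ for forms; sections $s$ induce sections $\delta(s)$; $\delta^2E$ is canonically trivial, with canonical section written $1$. A section of $\delta E=d_0^*E\otimes d_1^*E^*\otimes d_2^*E$ is the same as an isomorphism $d_0^*E\otimes d_2^*E\to d_1^*E$. A bundle gerbe $(E,Y)$ on $X$ is a surjective submersion $Y\to X$, a $U(1)$-bundle $E\to Y^{[2]}$ and a section $m$ of $\delta E\to Y^{[3]}$ (multiplication) with $\delta(m)=1$. **Rigid bundle 2-gerbes.** A rigid bundle 2-gerbe on $X$ consists of: (1) a surjective submersion $Y\to X$; (2) a 3-truncated semisimplicial manifold $Z_\bullet$ and a semisimplicial map $\pi\colon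 Z_\bullet\to Y^{[\bullet+1]}$ that is a surjective submersion in each degree ($n\le 3$); write $Z_n^{[k]}$ for the $k$-fold fibre product of $Z_n$ over $Y^{[n+1]}$, $\delta_h$ for $\delta$ with respect to the (horizontal) maps $Z_n^{[k]}\to Z_{n-1}^{[k]}$ and $\delta_v$ for $\delta$ with respect to the (vertical) maps $Z_n^{[k]}\to Z_n^{[k-1]}$; (3) a $U(1)$-bundle $E\to Z_1^{[2]}$ and a section $m$ of $\delta_vE$ making $(E,Z_1)$ a bundle gerbe on $Y^{[2]}$; (4) a section $M$ of $\delta_hE\to Z_2^{[2]}$; (5) such that (a) $\delta_v(M)=\delta_h(m)$ under the canonical isomorphism $\delta_v\delta_hE\simeq\delta_h\delta_vE$, and (b) $\delta_h(M)=1$. **Bigroupoid of bundle gerbes.** A morphism $(\varphi,f)\colon(E,Y)\to(F,Z)$ of bundle gerbes on $X$ is a map $f\colon Y\to Z$ over $X$ and an isomorphism $\varphi\colon E\simeq(f^{[2]})^*F$ respecting multiplication; it is an isomorphism if $f$ is a diffeomorphism. A stable isomorphism $(L,\tau)\colon(E,Y)\rightsquigarrow(F,Z)$ is a $U(1)$-bundle $L\to Y\times_XZ$ and a multiplication-preserving isomorphism $\tau\colon\delta(L)\simeq \mathrm{pr}^*E^*\otimes\mathrm{pr}^*F$ on $(Y\times_XZ)^{[2]}$; a 2-arrow $(L,\tau)\Rightarrow(L',\tau')$ is an isomorphism $L\simeq L'$ compatible with $\tau,\tau'$. The composite of $(L,\tau)$ and $(K,\kappa)\colon(F,Z)\rightsquigarrow(H,W)$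 is obtained by descending $L\otimes K$ from $Y\times_XZ\times_XW$ to $Y\times_XW$ using the descent data given by $\tau,\kappa$. This is a bigroupoid (Stevenson). A morphism $(\varphi,f)$ induces a stable isomorphism $\Sigma(\varphi,f)$ with $L=(f\times\mathrm{id})^*F$ on $Y\times_XZ$ and $\tau$ built from $\varphi$ and the multiplication of $F$; $\Sigma$ is a pseudofunctor. Each $(L,\tau)$ has adjoint inverse $(\sigma^*L^*,\sigma^*\tau^* )$, with $\sigma$ the swap $Z\times_XY\to Y\times_XZ$. **Bundle 2-gerbes.** A bundle 2-gerbe on $X$ is: a surjective submersion $Y\to X$; a bundle gerbe $\mathcal{E}$ on $Y^{[2]}$; a stable isomorphism $\overline m\colon\mathcal{E}_{12}\otimes\mathcal{E}_{01}\rightsquigarrow\mathcal{E}_{02}$ on $Y^{[3]}$ (subscripts denote pullback along the corresponding projection; $\mathcal{E}_{12}=d_0^*\mathcal E$, etc.); a 2-arrow (associator) $\tilde\alpha\colon\overline m_{013}\circ(\overline m_{123}\otimes1)\Rightarrow\overline m_{023}\circ(1\otimes\overline m_{012})$ on $Y^{[4]}$; such that on $Y^{[5]}$ the two 2-arrows between the stable isomorphisms $\mathcal{E}_{34}\otimes\mathcal{E}_{23}\otimes\mathcal{E}_{12}\otimes\mathcal{E}_{01}\rightsquigarrow\mathcal{E}_{04}$, one pasted from $\tilde\alpha_{0124}$, the interchange isomorphism and $\tilde\alpha_{0234}$, the other from $\tilde\alpha_{1234}\otimes\mathrm{id}$, $\tilde\alpha_{0134}$ and $\mathrm{id}\otimes\tilde\alpha_{0123}$,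 are equal. An isomorphism of bundle 2-gerbes over $X$ is a diffeomorphism $Y_1\simeq Y_2$ over $X$ of the submersions and, relative to it, an isomorphism of the bundle gerbes on $Y_i^{[2]}$, compatible on the nose with the stable isomorphisms $\overline m$ and identifying the associators. **Associated bundle 2-gerbe.** Let $\mathcal{G}$ be a rigid bundle 2-gerbe on $X$, consisting of a surjective submersion $Y\to X$, a 3-truncated semisimplicial manifold $Z_\bullet$ with degreewise surjective submersion $\pi\colon Z_\bullet\to Y^{[\bullet+1]}$, a $U(1)$-bundle $E\to Z_1^{[2]}$ with a section $m$ of $\delta_vE$ making $(E,Z_1)$ a bundle gerbe on $Y^{[2]}$, and a section $M$ of $\delta_hE\to Z_2^{[2]}$ with $\delta_v(M)=\delta_h(m)$ and $\delta_h(M)=1$. Then $w(\mathcal{G})$ has submersion $Y\to X$ and bundle gerbe $\mathcal{E}=(E,Z_1)$. Let $\mathcal{E}_{012}$ be the bundle gerbe $(d_0^*E\otimes d_2^*E,Z_2)$ on $Y^{[3]}$. There is a morphism $\mathcal{E}_{012}\to\mathcal{E}_{12}\otimes\mathcal{E}_{01}$ covering $(d_0,d_2)\colon Z_2\to d_0^*Z_1\times_{Y^{[3]}}d_2^*Z_1$, and a morphism $\mathcal{E}_{012}\to\mathcal{E}_{02}$ covering $d_1$ and given by the isomorphism $M'\colon d_0^*E\otimes d_2^*E\to d_1^*E$ corresponding to $M$. Then $\overline m$ is the adjoint inverse of $\Sigma$ of the first followed by $\Sigma$ of the second. Let $\mathcal{E}_{0123}$ be the bundle gerbe on $Y^{[4]}$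 with submersion $Z_3$ and $U(1)$-bundle the pullback of that of $\mathcal{E}_{23}\otimes\mathcal{E}_{12}\otimes\mathcal{E}_{01}$. The analogous maps give four commuting squares of bundle gerbe morphisms, arranged $3\times3$ with rows $\mathcal{E}_{23}\otimes\mathcal{E}_{12}\otimes\mathcal{E}_{01}\leftarrow\mathcal{E}_{123}\otimes\mathcal{E}_{01}\to\mathcal{E}_{13}\otimes\mathcal{E}_{01}$; $\ \mathcal{E}_{23}\otimes\mathcal{E}_{012}\leftarrow\mathcal{E}_{0123}\to\mathcal{E}_{013}$; $\ \mathcal{E}_{23}\otimes\mathcal{E}_{02}\leftarrow\mathcal{E}_{023}\to\mathcal{E}_{03}$, the middle row mapping vertically to both the top and the bottom row. The associator is the pasting of the lower right square with the mates of the other three squares, taken with respect to the adjoint inverses of (the stable isomorphisms of) the left-pointing and upward-pointing arrows. **Loop group data.** $\langle-,-\rangle$ is the basic inner product on $\mathfrak g$ (coroots of long roots have length squared $2$) divided by $4\pi$. $PG=\{p\in C^\infty([0,2\pi],G): p(0)=1\}$, $\Omega G=\ker(\mathrm{ev}_{2\pi}\colon PG\to G)$, $\theta$ is the coordinate on $[0,2\pi]$, $\partial=\partial/\partial\theta$, $\Theta$ is the left Maurer--Cartan form, $\phi_p=p^{-1}\partial p$, $\widehat\phi_p=\partial p\,p^{-1}$. Differential forms are evaluated in the Kobayashi--Nomizu convention ($\alpha\wedge\beta(X,Y)=\frac12(\alpha(X)\beta(Y)-\alpha(Y)\beta(X))$, and $d\alpha(X,Y)=\frac12(X\alpha(Y)-Y\alpha(X)-\alpha([X,Y]))$);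 $\mathrm{Lie}(U(1))=i\mathbb R$ is identified with $\mathbb R$ by division by $i$. $\widehat{\Omega G}\to\Omega G$ is the level 1 central extension by $U(1)$, with connection $\mu$ whose curvature is $R_\gamma=\int_0^{2\pi}\mathrm d\theta\,\langle\Theta_\gamma,\partial\Theta_\gamma\rangle$ and with $\mathrm{pr}_1^*\mu+\mathrm{pr}_2^*\mu-\mathrm{mult}^*\mu$ on $\widehat{\Omega G}^2$ the pullback of $\nu_{(\gamma,\eta)}=2\int_0^{2\pi}\mathrm d\theta\,\langle\Theta_\gamma,\widehat\phi_\eta\rangle$. Let $P\Omega G$ be the smooth paths $f\colon[0,2\pi]\to\Omega G$ with $f(0)=1$, and let $q\colon P\Omega G\times U(1)\to\widehat{\Omega G}$ send $(f,z)$ to $z$ times the endpoint of the $\mu$-horizontal lift of $f$ starting at $1$. The action $\widehat{\mathrm{Ad}}\colon PG\times\widehat{\Omega G}\to\widehat{\Omega G}$ is determined by $\widehat{\mathrm{Ad}}_p(q(f,z))=q\big(t\mapsto\mathrm{Ad}_pf(t),\ z\exp(2i\int_0^{2\pi}\int_0^{2\pi}\langle f(t)^{-1}\partial_tf(t),\phi_p\rangle\,\mathrm d\theta\,\mathrm dt)\big)$; it makes $\widehat{\Omega G}\to PG$ a crossed module. **The rigid bundle 2-gerbe $CS(Q)$.** $Y=Q\to X$; $Q^{[n+1]}\simeq Q\times G^n$ via $(y,g_1,\dots,g_n)\mapsto(y,yg_1,yg_1g_2,\dots)$; $Z_n=Q\times PG^n$ with $\pi=\mathrm{id}\times\mathrm{ev}_{2\pi}^n$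 and face maps $d_0(y,p_1,\dots,p_n)=(y\,p_1(2\pi),p_2,\dots,p_n)$, $d_i$ replaces $p_i,p_{i+1}$ by $p_ip_{i+1}$ ($0<i<n$), $d_n$ omits $p_n$. $Z_1^{[2]}\simeq Q\times PG\times\Omega G$ via $(y,p,\gamma)\leftrightarrow((y,p),(y,p\gamma))$, and $Z_2^{[2]}\simeq Q\times(PG\times\Omega G)^2$ via $(y,p,\gamma,q,\eta)\leftrightarrow((y,p,q),(y,p\gamma,q\eta))$, with horizontal maps $d_0=(y\,p(2\pi),q,\eta)$, $d_1=(y,pq,\mathrm{Ad}_{q^{-1}}(\gamma)\eta)$, $d_2=(y,p,\gamma)$. $E=Q\times PG\times\widehat{\Omega G}$; $m$ is given by $\hat\eta\otimes\hat\gamma\mapsto\hat\gamma\hat\eta$ (for $\hat\gamma\in E_{(y,p,\gamma)}$, $\hat\eta\in E_{(y,p\gamma,\eta)}$); $M$ corresponds to the isomorphism $M'\colon d_0^*E\otimes d_2^*E\to d_1^*E$, $\hat\eta\otimes\hat\gamma\mapsto\widehat{\mathrm{Ad}}_{q^{-1}}(\hat\gamma)\hat\eta$ over $(y,p,\gamma,q,\eta)$. **The Chern--Simons bundle 2-gerbe $\mathcal C(Q)$** (Carey--Johnson--Murray--Stevenson--Wang). The basic gerbe on $G$ is the bundle gerbe with submersion $\mathrm{ev}_{2\pi}\colon PG\to G$ and $U(1)$-bundle $PG\times\widehat{\Omega G}\to PG\times\Omega G\simeq PG^{[2]}$, with multiplication from $\widehat{\Omega G}$. It carries a strict multiplicative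 structure over the nerve $NG_\bullet$: a bundle gerbe morphism $d_0^*\otimes d_2^*\to d_1^*$ over $G\times G$ covering pointwise multiplication $PG\times PG\to PG$ and given on $U(1)$-bundles by $(\hat\gamma,\hat\eta)\mapsto\widehat{\mathrm{Ad}}_{q^{-1}}(\hat\gamma)\hat\eta$, which is strictly associative. $\mathcal C(Q)$ is the pullback of this along the simplicial map $Q^{[\bullet+1]}\to NG_\bullet$: submersion $Q\to X$, bundle gerbe on $Q^{[2]}$ the pullback of the basic gerbe, $\overline m=\Sigma$ of the pulled-back morphism, associator the identity 2-arrow. *)

(* Defs.v *)
From HB Require Import structures.
From mathcomp Require Import all_boot all_order all_algebra.
From mathcomp Require Import all_classical all_reals all_analysis.
From mathcomp Require Import complex.

Set Implicit Arguments.
Unset Strict Implicit.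
Unset Printing Implicit Defensive.

Import Order.TTheory GRing.Theory Num.Theory.
Import numFieldNormedType.Exports.

Local Open Scope classical_set_scope.
Local Open Scope ring_scope.

(* Overview of the encodings.
   - Fréchet manifolds are given by atlases, with the smooth calculus of Bertram,
     Glöckner and Neeb, which on locally convex spaces agrees with that of
     Michal-Bastiani and Hamilton and also applies to closed intervals.
   - Objects built from manifolds (path groups, fibre products, tensor products,
     descended bundles) are treated as spaces with smooth plots, a plot being
     parametrized by a subset with dense interior of a locally convex space.
     The inverses of charts are plots, so the plots determine the smooth
     structure of a Fréchet manifold, and the maps preserving plots are the
     smooth maps.  No further manifold structure is needed on these objects.
   - An isomorphism of U(1)-bundles out of a tensor product is given by the
     corresponding multi-equivariant map or by the graph of that map.
   - Bundle gerbes, stable isomorphisms and (rigid) bundle 2-gerbes are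
     represented by their underlying data.  Their laws (local triviality,
     associativity, coherence) are properties of these data; they enter neither
     the construction of the associated bundle 2-gerbe nor the notion of
     isomorphism, so they are neither assumed nor asserted. *)

(** * Smooth calculus in locally convex spaces *)

Section Calculus.
Variable R : realType.

Definition increments (V : tvsType R) (U : set V) : set (V * V * R^o) :=
  [set x | U x.1.1 /\ U (x.1.1 + x.2 *: x.1.2)].

Definition is_slope (V W : tvsType R) (U : set V) (f : V -> W)
    (g : V * V * R^o -> W) : Prop :=
  {within increments U, continuous g} /\
  forall x, increments U x -> f (x.1.1 + x.2 *: x.1.2) - f x.1.1 = x.2 *: g x.

Fixpoint Ck (k : nat) (V W : tvsType R) (U : set V) (f : V -> W) : Prop :=
  {within U, continuous f} /\
  match k with
  | 0 => True
  | k'.+1 => exists2 g, is_slope U f g & @Ck k' (V * V * R^o)%type W (increments U) g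
  end.

Definition smooth_on (V W : tvsType R) (U : set V) (f : V -> W) : Prop :=
  forall u, U u -> exists2 N, open N /\ N u & forall k, Ck k (U `&` N) f.

(* The differential of f at x in the direction v; where U has dense interior and
   W is Hausdorff the slope is unique, also at boundary points of U. *)
Definition pd (V W : tvsType R) (U : set V) (f : V -> W) (x v : V) : W :=
  xget 0 [set w | exists2 g, is_slope U f g & w = g (x, v, 0)].

Definition domain (V : tvsType R) (U : set V) : Prop := U `<=` closure U°.

(* The uniform structure carried by a tvsType need not be the translation
   invariant one, so Cauchy filters are spelled out. *)
Definition is_frechet (V : tvsType R) : Prop :=
  [/\ hausdorff_space V,
      exists B : nat -> set V, (forall n, nbhs (0 : V) (B n)) /\
        forall A, nbhs (0 : V) A -> exists n, B n `<=` A
    & forall F : set_system V, ProperFilter F ->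
        (forall U, nbhs (0 : V) U ->
           exists2 A, F A & forall x y, A x -> A y -> U (x - y)) ->
        exists l : V, F --> l].

Record frechet := Frechet { fr_sort :> tvsType R; fr_axiom : is_frechet fr_sort }.

(** * Fréchet manifolds *)

Record chart (M : topologicalType) := Chart {
  ch_model : frechet;
  ch_dom : set M;
  ch_map : M -> ch_model;
  ch_inv : ch_model -> M }.
Arguments ch_map {M} c _.
Arguments ch_inv {M} c _.

Definition is_chart (M : topologicalType) (c : chart M) : Prop :=
  [/\ open (ch_dom c), open (ch_map c @` ch_dom c),
      forall m, ch_dom c m -> ch_inv c (ch_map c m) = m,
      {within ch_dom c, continuous (ch_map c)}
    & {within ch_map c @` ch_dom c, continuous (ch_inv c)}].

Record fmanifold := FManifold {
  fm_top :> topologicalType;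
  fm_atlas : chart fm_top -> Prop;
  fm_hausdorff : hausdorff_space fm_top;
  fm_chart : forall c, fm_atlas c -> is_chart c;
  fm_cover : forall m, exists2 c, fm_atlas c & ch_dom c m;
  fm_compatible : forall c c', fm_atlas c -> fm_atlas c' ->
        smooth_on (ch_map c @` (ch_dom c `&` ch_dom c')) (ch_map c' \o ch_inv c) }.

(** * Spaces with plots *)

(* The points of a space are the elements of sp_mem; the type sp_sort only
   provides an ambient type, so that maps between spaces are total functions. *)
Record space := Space {
  sp_sort :> Type;
  sp_mem : set sp_sort;
  sp_plot : forall V : tvsType R, set V -> (V -> sp_sort) -> Prop }.

Definition smooth_map (A B : space) (f : A -> B) : Prop :=
  (forall a, sp_mem a -> sp_mem (f a)) /\
  forall (V : tvsType R) (U : set V) (p : V -> A),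
    sp_plot U p -> sp_plot U (f \o p).

Definition space_of (M : fmanifold) : space :=
  @Space M setT (fun V U p =>
    [/\ domain U, {within U, continuous p}
      & forall c, fm_atlas c ->
          smooth_on (U `&` p @^-1` ch_dom c) (ch_map c \o p)]).

Definition prod_space (A B : space) : space :=
  @Space (A * B)%type [set x | sp_mem x.1 /\ sp_mem x.2]
    (fun V U p => sp_plot U (fst \o p) /\ sp_plot U (snd \o p)).

Definition sub_space (A : space) (P : set A) : space :=
  @Space A [set x | sp_mem x /\ P x]
    (fun V U p => sp_plot U p /\ forall u, U u -> P (p u)).

Definition fibre2 (Y : space) (X : Type) (pi : Y -> X) : space :=
  @sub_space (prod_space Y Y) [set y | pi y.1 = pi y.2].

Definition fibre3 (Y : space) (X : Type) (pi : Y -> X) : space :=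
  @sub_space (prod_space (fibre2 pi) Y) [set y | pi y.1.2 = pi y.2].

Definition fibre4 (Y : space) (X : Type) (pi : Y -> X) : space :=
  @sub_space (prod_space (fibre3 pi) Y) [set y | pi y.1.2 = pi y.2].

Definition circle : set R[i] :=
  [set z | complex.Re z ^+ 2 + complex.Im z ^+ 2 = 1].

Definition circle_space : space :=
  @Space R[i] circle (fun V U p =>
    [/\ domain U, forall u, U u -> circle (p u),
        @smooth_on V R^o U (fun u => complex.Re (p u))
      & @smooth_on V R^o U (fun u => complex.Im (p u))]).

Definition expi (t : R) : R[i] := (cos t +i* sin t)%C.

End Calculus.

Arguments ch_map {R M} c _.
Arguments ch_inv {R M} c _.
Arguments circle {R}.

(** * Lie groups and principal bundles *)

Section Lie.
Variable R : realType.

(* The model space of the distinguished chart lie_chart serves as the tangent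
   space at the identity, that is, as the Lie algebra. *)
Record lie_group := LieGroup {
  lie_manifold :> fmanifold R;
  lie_one : lie_manifold;
  lie_mul : lie_manifold -> lie_manifold -> lie_manifold;
  lie_inv : lie_manifold -> lie_manifold;
  lie_chart : chart R lie_manifold;
  lie_mulA : associative lie_mul;
  lie_mul1g : left_id lie_one lie_mul;
  lie_mulVg : left_inverse lie_one lie_inv lie_mul;
  lie_mul_smooth :
    @smooth_map R (prod_space (space_of lie_manifold) (space_of lie_manifold))
      (space_of lie_manifold) (fun x => lie_mul x.1 x.2);
  lie_inv_smooth :
    @smooth_map R (space_of lie_manifold) (space_of lie_manifold) lie_inv;
  lie_chart_atlas : fm_atlas lie_chart;
  lie_chart_one : ch_dom lie_chart lie_one }.

Section LieAlgebra.
Variable G : lie_group.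
Local Notation "x ** y" := (lie_mul x y) (at level 40, left associativity).

Definition lie_alg : tvsType R := ch_model (lie_chart G).
Local Notation phi := (ch_map (lie_chart G)).
Local Notation psi := (ch_inv (lie_chart G)).
Local Notation dom := (ch_dom (lie_chart G)).

Definition lie_conj (g h : G) : G := g ** h ** lie_inv g.

Definition lie_Ad (g : G) (x : lie_alg) : lie_alg :=
  pd [set u | (phi @` dom) u /\ dom (lie_conj g (psi u))]
     (fun u => phi (lie_conj g (psi u)) : lie_alg) (phi (lie_one G)) x.

Definition lie_bracket (x y : lie_alg) : lie_alg :=
  pd (phi @` dom) (fun u => lie_Ad (psi u) y) (phi (lie_one G)) x.

(* The left and right logarithmic derivatives g^-1 dg and dg g^-1 of g at x
   in the direction v. *)
Definition lmc (V : tvsType R) (U : set V) (g : V -> G) (x v : V) : lie_alg :=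
  pd [set x' | U x' /\ dom (lie_inv (g x) ** g x')]
     (fun x' => phi (lie_inv (g x) ** g x') : lie_alg) x v.

Definition rmc (V : tvsType R) (U : set V) (g : V -> G) (x v : V) : lie_alg :=
  pd [set x' | U x' /\ dom (g x' ** lie_inv (g x))]
     (fun x' => phi (g x' ** lie_inv (g x)) : lie_alg) x v.

Definition finite_dimensional : Prop :=
  exists (n : nat) (b : 'I_n -> lie_alg),
    forall v, exists c : 'I_n -> R, v = \sum_i c i *: b i.

Definition lie_ideal (J : set lie_alg) : Prop :=
  [/\ J 0, forall a x y, J x -> J y -> J (a *: x + y)
    & forall x y, J y -> J (lie_bracket x y)].

(* Simplicity of a connected Lie group is that of its Lie algebra. *)
Definition simple_lie : Prop :=
  (exists x y, lie_bracket x y <> 0) /\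
  forall J, lie_ideal J -> J = [set 0] \/ J = setT.

Definition simply_connected : Prop :=
  (forall x y : G, exists f : R -> G,
     [/\ {within `[0, 1], continuous f}, f 0 = x & f 1 = y]) /\
  forall f : R -> G, {within `[0, 1], continuous f} -> f 0 = f 1 ->
    exists F : R * R -> G,
      [/\ {within `[0, 1] `*` `[0, 1], continuous F},
          forall t, F (0, t) = f t, forall t, F (1, t) = f 0
        & forall s, F (s, 0) = f 0 /\ F (s, 1) = f 0].

Definition compact_simple_simply_connected : Prop :=
  [/\ finite_dimensional, compact [set: G], simple_lie & simply_connected].

(** ** The basic inner product *)

Definition abelian_subalgebra (t : set lie_alg) : Prop :=
  [/\ t 0, forall a x y, t x -> t y -> t (a *: x + y)
    & forall x y, t x -> t y -> lie_bracket x y = 0].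

Definition cartan_subalgebra (t : set lie_alg) : Prop :=
  abelian_subalgebra t /\
  forall t', abelian_subalgebra t' -> t `<=` t' -> t' `<=` t.

(* The complex root is i a; the root vectors are x - i y and its conjugate. *)
Definition is_root (t : set lie_alg) (a : lie_alg -> R) : Prop :=
  (exists2 h, t h & a h != 0) /\
  exists x y : lie_alg, x <> 0 /\ y <> 0 /\
    forall h, t h -> lie_bracket h x = a h *: y /\ lie_bracket h y = - a h *: x.

Section InnerProduct.
Variable ip : lie_alg -> lie_alg -> R.

Definition root_vector (t : set lie_alg) (a : lie_alg -> R) (ta : lie_alg) : Prop :=
  [/\ is_root t a, t ta & forall h, t h -> a h = ip ta h].

Definition coroot (ta : lie_alg) : lie_alg := (2 / ip ta ta) *: ta.

Definition long_root (t : set lie_alg) (ta : lie_alg) : Prop :=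
  forall b tb, root_vector t b tb -> ip tb tb <= ip ta ta.

Definition basic_inner_product : Prop :=
  [/\ forall x y, ip x y = ip y x,
      forall a x y z, ip (a *: x + y) z = a * ip x z + ip y z,
      forall x, x <> 0 -> 0 < ip x x,
      forall g x y, ip (lie_Ad g x) (lie_Ad g y) = ip x y
    & forall t a ta, cartan_subalgebra t -> root_vector t a ta ->
        long_root t ta -> ip (coroot ta) (coroot ta) = 2].
End InnerProduct.

(** ** Paths and loops in G *)

Definition I2pi : set R := `[0, 2 * pi]%classic.

Definition integral (f : R -> R) : R :=
  (\int[lebesgue_measure]_(t in I2pi) f t)%R.

(* Paths are only defined on [0, 2 pi]; they are represented by their extension
   with value 1 outside of this interval. *)
Definition is_path (p : R -> G) : Prop :=
  [/\ @sp_plot R (space_of G) R^o I2pi p, p 0 = lie_one G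
    & forall t, ~ I2pi t -> p t = lie_one G].

(* The smooth structure on the path group: families of paths are smooth as maps
   into G on the product with [0, 2 pi]. *)
Definition PG : space R :=
  @Space R (R -> G) is_path (fun V U p =>
    (forall u, U u -> is_path (p u)) /\
    @sp_plot R (space_of G) (V * R^o)%type (U `*` (I2pi : set R^o))
      (fun x => p x.1 x.2)).

Definition OmegaG : space R := @sub_space R PG [set p | p (2 * pi) = lie_one G].

Definition path_mul (p q : R -> G) : R -> G := fun t => p t ** q t.
Definition path_inv (p : R -> G) : R -> G := fun t => lie_inv (p t).

(* p^-1 dp/dtheta and dp/dtheta p^-1 *)
Definition lphi (p : R -> G) (t : R) : lie_alg := @lmc R^o I2pi p t 1.
Definition rphi (p : R -> G) (t : R) : lie_alg := @rmc R^o I2pi p t 1.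

(* The value of the Maurer-Cartan form on the variation at x, in the direction v,
   of a family of paths, as a function of theta. *)
Definition Theta (V : tvsType R) (U : set V) (g : V -> R -> G) (x v : V) (t : R) :
    lie_alg :=
  @lmc (V * R^o)%type (U `*` (I2pi : set R^o)) (fun y => g y.1 y.2) (x, t) (v, 0).

Definition dtheta (f : R -> lie_alg) (t : R) : lie_alg := @pd R R^o lie_alg I2pi f t 1.

Section LoopForms.
Variable B : lie_alg -> lie_alg -> R.

Definition pairing (x y : lie_alg) : R := B x y / (4 * pi).

Definition loop_curvature (V : tvsType R) (U : set V) (g : V -> R -> G) (x v w : V) : R :=
  2^-1 * integral (fun t =>
    pairing (Theta U g x v t) (dtheta (Theta U g x w) t)
    - pairing (Theta U g x w t) (dtheta (Theta U g x v) t)).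

Definition loop_nu (V : tvsType R) (U : set V) (g h : V -> R -> G) (x v : V) : R :=
  2 * integral (fun t => pairing (Theta U g x v t) (rphi (h x) t)).

(* The phase in the formula for the lifted adjoint action; f is a path in the
   loop group, f t being the loop at time t. *)
Definition Ad_phase (f : R -> R -> G) (p : R -> G) : R :=
  2 * integral (fun t => integral (fun s =>
        pairing (@lmc R^o I2pi (fun t' => f t' s) t 1) (lphi p s))).
End LoopForms.
End LieAlgebra.

(** ** Principal bundles *)

Record principal_bundle (G : lie_group) (X : fmanifold R) := PrincipalBundle {
  pb_total :> fmanifold R;
  pb_proj : pb_total -> X;
  pb_act : pb_total -> G -> pb_total;
  pb_proj_smooth : @smooth_map R (space_of pb_total) (space_of X) pb_proj;
  pb_act_smooth :
    @smooth_map R (prod_space (space_of pb_total) (space_of G))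
      (space_of pb_total) (fun x => pb_act x.1 x.2);
  pb_act1 : forall y, pb_act y (lie_one G) = y;
  pb_actM : forall y g h, pb_act y (lie_mul g h) = pb_act (pb_act y g) h;
  pb_proj_act : forall y g, pb_proj (pb_act y g) = pb_proj y;
  pb_trivial : forall x : X, exists (N : set X) (f : X * G -> pb_total)
      (f' : pb_total -> X * G),
    [/\ open N /\ N x,
        @smooth_map R (@sub_space R (prod_space (space_of X) (space_of G))
                         [set z | N z.1])
          (@sub_space R (space_of pb_total) (pb_proj @^-1` N)) f,
        @smooth_map R (@sub_space R (space_of pb_total) (pb_proj @^-1` N))
          (@sub_space R (prod_space (space_of X) (space_of G)) [set z | N z.1]) f',
        forall z, N z.1 -> f' (f z) = z /\ pb_proj (f z) = z.1
                           /\ forall h, pb_act (f z) h = f (z.1, lie_mul z.2 h)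
      & forall y, N (pb_proj y) -> f (f' y) = y] }.

Definition pb_div (G : lie_group) (X : fmanifold R) (Q : principal_bundle G X)
    (y y' : Q) : G :=
  xget (lie_one G) [set g | y' = pb_act y g].

(** ** Connections *)

(* Differential 1-forms, through their pullbacks along plots. *)
Definition form1 (S : space R) : Type :=
  forall V : tvsType R, set V -> (V -> S) -> V -> V -> R.

Definition is_form1 (S : space R) (w : form1 S) : Prop :=
  forall (V : tvsType R) (U : set V) (p : V -> S), sp_plot U p ->
  [/\ @smooth_on R (V * V)%type R^o (U `*` setT) (fun x => w V U p x.1 x.2),
      forall u a v v', U u -> w V U p u (a *: v + v') = a * w V U p u v + w V U p u v',
      forall p', (forall u, U u -> p u = p' u) ->
        forall u v, U u -> w V U p' u v = w V U p u v
    & forall (V' : tvsType R) (U' : set V') (h : V' -> V), domain U' ->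
        smooth_on U' h -> (forall u, U' u -> U (h u)) ->
        forall u v, U' u -> w V' U' (p \o h) u v = w V U p (h u) (pd U' h u v)].

(** ** The level 1 central extension of the loop group, with its connection and
    the lifted adjoint action *)

Record level1_extension (G : lie_group) (B : lie_alg G -> lie_alg G -> R) :=
Level1Extension {
  le_group :> lie_group;
  le_proj : le_group -> R -> G;
  le_incl : R[i] -> le_group;
  le_mu : form1 (space_of le_group);
  le_Ad : (R -> G) -> le_group -> le_group;

  le_proj_smooth : @smooth_map R (space_of le_group) (OmegaG G) le_proj;
  le_projM : forall x y,
    le_proj (lie_mul x y) = path_mul (le_proj x) (le_proj y);
  le_inclM : forall z w, circle z -> circle w ->
    le_incl (z * w) = lie_mul (le_incl z) (le_incl w);
  le_incl_smooth : @smooth_map R (circle_space R) (space_of le_group) le_incl;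
  le_incl_central : forall z x, circle z ->
    lie_mul (le_incl z) x = lie_mul x (le_incl z);
  le_exact : forall x, le_proj x = (fun=> lie_one G) <->
    exists2 z, circle z & le_incl z = x;
  le_incl_embedding : forall (V : tvsType R) (U : set V) (z : V -> R[i]),
    (forall u, U u -> circle (z u)) ->
    @sp_plot R (space_of le_group) V U (le_incl \o z) ->
    @sp_plot R (circle_space R) V U z;
  le_incl_inj : forall z w, circle z -> circle w ->
    le_incl z = le_incl w -> z = w;
  (* local triviality: the projection has local sections *)
  le_sections : forall (V : tvsType R) (U : set V) (g : V -> R -> G),
    @sp_plot R (OmegaG G) V U g -> forall u, U u ->
    exists (N : set V) (x : V -> le_group), [/\ open N /\ N u,
      @sp_plot R (space_of le_group) V (U `&` N) x
      & forall u', U u' -> N u' -> le_proj (x u') = g u'];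

  le_mu_form : is_form1 le_mu;
  le_mu_invariant : forall (V : tvsType R) (U : set V) (x : V -> le_group) z u v,
    @sp_plot R (space_of le_group) V U x -> circle z -> U u ->
    le_mu U (fun u => lie_mul (x u) (le_incl z)) u v = le_mu U x u v;
  le_mu_vertical : forall x t,
    @le_mu R^o setT (fun t => lie_mul x (le_incl (expi t))) t 1 = 1;
  (* d mu (v, w) = (v mu(w) - w mu(v)) / 2 for constant vector fields v, w *)
  le_mu_curvature : forall (V : tvsType R) (U : set V) (x : V -> le_group) u v w,
    @sp_plot R (space_of le_group) V U x -> U u ->
    2^-1 * (@pd R V R^o U (fun u => le_mu U x u w) u v
            - @pd R V R^o U (fun u => le_mu U x u v) u w)
    = loop_curvature B U (le_proj \o x) u v w;
  le_mu_nu : forall (V : tvsType R) (U : set V) (x y : V -> le_group) u v,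
    @sp_plot R (space_of le_group) V U x -> @sp_plot R (space_of le_group) V U y ->
    U u ->
    le_mu U x u v + le_mu U y u v - le_mu U (fun u => lie_mul (x u) (y u)) u v
    = loop_nu B U (le_proj \o x) (le_proj \o y) u v;

  le_Ad_smooth :
    @smooth_map R (prod_space (PG G) (space_of le_group)) (space_of le_group)
      (fun x => le_Ad x.1 x.2);
  le_Ad1 : forall x, le_Ad (fun=> lie_one G) x = x;
  le_AdM : forall p q x, sp_mem (p : PG G) -> sp_mem (q : PG G) ->
    le_Ad (path_mul p q) x = le_Ad p (le_Ad q x);
  le_Ad_mul : forall p x y, sp_mem (p : PG G) ->
    le_Ad p (lie_mul x y) = lie_mul (le_Ad p x) (le_Ad p y);
  le_Ad_incl : forall p z, sp_mem (p : PG G) -> circle z ->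
    le_Ad p (le_incl z) = le_incl z;
  le_Ad_proj : forall p x, sp_mem (p : PG G) ->
    le_proj (le_Ad p x) = path_mul (path_mul p (le_proj x)) (path_inv p);
  le_Ad_peiffer : forall x y,
    le_Ad (le_proj x) y = lie_mul (lie_mul x y) (lie_inv x);
  (* x and x' are the mu-horizontal lifts of f and Ad_p f starting at 1 *)
  le_Ad_formula : forall p (f : R -> R -> G) (x x' : R -> le_group) z,
    let horizontal_lift (g : R -> R -> G) (y : R -> le_group) :=
      [/\ @sp_plot R (space_of le_group) R^o (@I2pi) y, y 0 = lie_one le_group,
          forall t, I2pi t -> le_proj (y t) = g t
        & forall t, I2pi t -> @le_mu R^o I2pi y t 1 = 0] in
    let Adf := fun t => path_mul (path_mul p (f t)) (path_inv p) in
    sp_mem (p : PG G) -> @sp_plot R (OmegaG G) R^o I2pi f ->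
    f 0 = (fun=> lie_one G) -> horizontal_lift f x -> horizontal_lift Adf x' ->
    circle z ->
    le_Ad p (lie_mul (x (2 * pi)) (le_incl z))
    = lie_mul (x' (2 * pi)) (le_incl (z * expi (Ad_phase B f p))) }.

End Lie.

(** * Bundle gerbes *)

Section Gerbes.
Variable R : realType.

(** ** Families of spaces *)

(* A space over a base with underlying type I, given by its fibres and by the
   plots of its total space: fa_plot U b y says that the pairs (b u, y u) form a
   plot, provided that b is a plot of the base.  Pullback along a map of bases is
   mere reindexing, hence strictly functorial and strictly compatible with the
   constructions below. *)
Record family (I : Type) := Family {
  fa_sort : Type;
  fa_mem : I -> set fa_sort;
  fa_plot : forall V : tvsType R, set V -> (V -> I) -> (V -> fa_sort) -> Prop }.

Arguments fa_mem {I} _ _.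
Arguments fa_plot {I} _ {V} _ _ _.

Definition family_of (I : Type) (A : space R) (pi : A -> I) : family I :=
  @Family I A (fun i => [set a | sp_mem a /\ pi a = i])
    (fun V U b a => sp_plot U a /\ forall u, U u -> pi (a u) = b u).

Definition pull_family (I J : Type) (f : J -> I) (A : family I) : family J :=
  @Family J (fa_sort A) (fun j => fa_mem A (f j))
    (fun V U b a => fa_plot A U (f \o b) a).

Definition prod_family (I : Type) (A B : family I) : family I :=
  @Family I (fa_sort A * fa_sort B)%type
    (fun i => [set x | fa_mem A i x.1 /\ fa_mem B i x.2])
    (fun V U b x => fa_plot A U b (fst \o x) /\ fa_plot B U b (snd \o x)).

Definition sub_family (I : Type) (A : family I) (P : set (fa_sort A)) : family I :=
  @Family I (fa_sort A) (fun i => fa_mem A i `&` P)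
    (fun V U b a => fa_plot A U b a /\ forall u, U u -> P (a u)).

(* The quotient of A with quotient map c: plots lift locally along c. *)
Definition quotient_family (I : Type) (A : family I) (T : Type)
    (c : I -> fa_sort A -> T) : family I :=
  @Family I T (fun i => c i @` fa_mem A i)
    (fun V U b x => forall u, U u -> exists (N : set V) (a : V -> fa_sort A),
       [/\ open N /\ N u, fa_plot A (U `&` N) b a
         & forall u', U u' -> N u' -> c (b u') (a u') = x u']).

(* r is the graph of a fibrewise bijection from A to B, covering a map h on the
   base B0, which is smooth and has a smooth inverse. *)
Definition is_iso_graph (B0 : space R) (J : Type) (h : B0 -> J) (A : family B0)
    (B : family J) (r : B0 -> fa_sort A -> fa_sort B -> Prop) : Prop :=
  [/\ forall i a, sp_mem i -> fa_mem A i a ->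
        exists! b, fa_mem B (h i) b /\ r i a b,
      forall i b, sp_mem i -> fa_mem B (h i) b ->
        exists! a, fa_mem A i a /\ r i a b
    & forall (V : tvsType R) (U : set V) (i : V -> B0) a b, sp_plot U i ->
        (forall u, U u -> [/\ fa_mem A (i u) (a u), fa_mem B (h (i u)) (b u)
                             & r (i u) (a u) (b u)]) ->
        (fa_plot A U i a <-> fa_plot B U (h \o i) b)].

(** ** U(1)-bundles *)

(* A U(1)-bundle over a space over the base, whose points have type P. *)
Record bundle (I P : Type) := Bundle {
  bu_family :> family I;
  bu_proj : fa_sort bu_family -> P;
  bu_act : fa_sort bu_family -> R[i] -> fa_sort bu_family }.

Definition pull_bundle (I J P : Type) (f : J -> I) (L : bundle I P) : bundle J P :=
  @Bundle J P (pull_family f L) (@bu_proj I P L) (@bu_act I P L).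

Definition rename_bundle (I P Q : Type) (g : P -> Q) (L : bundle I P) : bundle I Q :=
  @Bundle I Q L (g \o @bu_proj I P L) (@bu_act I P L).

Definition dual_bundle (I P : Type) (L : bundle I P) : bundle I P :=
  @Bundle I P L (@bu_proj I P L) (fun l z => bu_act l (conjc z)).

(* The external tensor product over the fibre product of the bases: pairs
   modulo (l, k) ~ (l z, k z^-1). *)
Definition tensor_orbit (I P Q : Type) (L : bundle I P) (K : bundle I Q)
    (l : fa_sort L) (k : fa_sort K) : set (fa_sort L * fa_sort K) :=
  [set x | exists2 z, circle z & x = (bu_act l z, bu_act k (conjc z))].

Definition tensor_elt (I P Q : Type) (L : bundle I P) (K : bundle I Q)
    (l : fa_sort L) (k : fa_sort K) : (P * Q) * set (fa_sort L * fa_sort K) :=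
  ((bu_proj l, bu_proj k), tensor_orbit l k).

Definition tensor_bundle (I P Q : Type) (L : bundle I P) (K : bundle I Q) :
    bundle I (P * Q) :=
  @Bundle I (P * Q)%type
    (@quotient_family I (prod_family L K) _ (fun i x => tensor_elt x.1 x.2))
    fst (fun x z => (x.1, [set (bu_act y.1 z, y.2) | y in x.2])).

Arguments bu_proj {I P b} _.
Arguments bu_act {I P b} _ _.

(** ** Bundle gerbes and their morphisms *)

(* A bundle gerbe over a base with underlying type I: ge_fam is the submersion,
   ge_bundle the U(1)-bundle over its fibre square, and ge_mul e' e the product
   of e' over (y2, y3) and e over (y1, y2), that is, the isomorphism
   d_0^* E (x) d_2^* E -> d_1^* E. *)
Record gerbe (I : Type) := Gerbe {
  ge_fam : family I;
  ge_bundle : bundle I (fa_sort ge_fam * fa_sort ge_fam);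
  ge_mul : fa_sort ge_bundle -> fa_sort ge_bundle -> fa_sort ge_bundle }.

Definition pts (I : Type) (A : gerbe I) : Type := fa_sort (ge_fam A).
Definition elts (I : Type) (A : gerbe I) : Type := fa_sort (ge_bundle A).
Definition src (I : Type) (A : gerbe I) (e : elts A) : pts A := (bu_proj e).1.
Definition tgt (I : Type) (A : gerbe I) (e : elts A) : pts A := (bu_proj e).2.

Definition is_unit (I : Type) (A : gerbe I) (i : I) (e : elts A) : Prop :=
  [/\ fa_mem (ge_bundle A) i e, src e = tgt e & ge_mul e e = e].

Definition pull_gerbe (I J : Type) (f : J -> I) (A : gerbe I) : gerbe J :=
  @Gerbe J (pull_family f (ge_fam A)) (pull_bundle f (ge_bundle A)) (@ge_mul I A).

Definition middle_swap (A B C D : Type) (x : (A * B) * (C * D)) : (A * C) * (B * D) :=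
  ((x.1.1, x.2.1), (x.1.2, x.2.2)).

Definition tensor_gerbe (I : Type) (A B : gerbe I) : gerbe I :=
  @Gerbe I (prod_family (ge_fam A) (ge_fam B))
    (rename_bundle (@middle_swap _ _ _ _) (tensor_bundle (ge_bundle A) (ge_bundle B)))
    (fun x y =>
       (((y.1.1.1, x.1.1.2), (y.1.2.1, x.1.2.2)),
        [set z | exists a b, [/\ x.2 a, y.2 b
                               & z = (ge_mul a.1 b.1, ge_mul a.2 b.2)]])).

(* The gerbe with submersion Z and bundle the pullback of that of A along f. *)
Definition induced_gerbe (I : Type) (A : gerbe I) (Z : family I)
    (f : fa_sort Z -> pts A) : gerbe I :=
  @Gerbe I Z
    (@Bundle I (fa_sort Z * fa_sort Z)%type
       (@sub_family I (prod_family (prod_family Z Z) (ge_bundle A))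
          [set x | bu_proj x.2 = (f x.1.1, f x.1.2)])
       fst (fun x z => (x.1, bu_act x.2 z)))
    (fun x y => ((y.1.1, x.1.2), ge_mul x.2 y.2)).

(* A morphism of bundle gerbes over a common base, the isomorphism of
   U(1)-bundles being given by its graph. *)
Record gerbe_map (I : Type) (A B : gerbe I) := GerbeMap {
  gm_fun : pts A -> pts B;
  gm_graph : elts A -> elts B -> Prop }.

Definition id_map (I : Type) (A : gerbe I) : gerbe_map A A :=
  @GerbeMap I A A id (fun e e' => e = e').

Definition comp_map (I : Type) (A B C : gerbe I) (f : gerbe_map A B)
    (g : gerbe_map B C) : gerbe_map A C :=
  @GerbeMap I A C (gm_fun g \o gm_fun f)
    (fun e e'' => exists2 e', gm_graph f e e' & gm_graph g e' e'').

Definition pull_map (I J : Type) (h : J -> I) (A B : gerbe I) (f : gerbe_map A B) :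
    gerbe_map (pull_gerbe h A) (pull_gerbe h B) :=
  @GerbeMap J (pull_gerbe h A) (pull_gerbe h B) (gm_fun f) (@gm_graph I A B f).

Definition tensor_map (I : Type) (A B C D : gerbe I) (f : gerbe_map A B)
    (g : gerbe_map C D) : gerbe_map (tensor_gerbe A C) (tensor_gerbe B D) :=
  @GerbeMap I (tensor_gerbe A C) (tensor_gerbe B D)
    (fun y => (gm_fun f y.1, gm_fun g y.2))
    (fun e e' =>
       [/\ e'.1 = ((gm_fun f e.1.1.1, gm_fun f e.1.1.2),
                   (gm_fun g e.1.2.1, gm_fun g e.1.2.2))
         & e'.2 = [set b | exists a, [/\ e.2 a, gm_graph f a.1 b.1
                                        & gm_graph g a.2 b.2]]]).

Definition tens (I : Type) (A B : gerbe I) (a : elts A) (b : elts B) :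
    elts (tensor_gerbe A B) :=
  @tensor_elt I _ _ (ge_bundle A) (ge_bundle B) a b.

Definition tensor_assoc (I : Type) (A B C : gerbe I) :
    gerbe_map (tensor_gerbe (tensor_gerbe A B) C) (tensor_gerbe A (tensor_gerbe B C)) :=
  @GerbeMap I (tensor_gerbe (tensor_gerbe A B) C) (tensor_gerbe A (tensor_gerbe B C))
    (fun y => (y.1.1, (y.1.2, y.2)))
    (fun e e' => exists (ab : elts (tensor_gerbe A B)) (a : elts A) (b : elts B)
       (c : elts C), [/\ e.2 (ab, c), ab.2 (a, b)
       & e' = @tens I A (tensor_gerbe B C) a (tens b c)]).

Definition tensor_assoc_inv (I : Type) (A B C : gerbe I) :
    gerbe_map (tensor_gerbe A (tensor_gerbe B C)) (tensor_gerbe (tensor_gerbe A B) C) :=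
  @GerbeMap I (tensor_gerbe A (tensor_gerbe B C)) (tensor_gerbe (tensor_gerbe A B) C)
    (fun y => ((y.1, y.2.1), y.2.2))
    (fun e e' => exists (a : elts A) (bc : elts (tensor_gerbe B C)) (b : elts B)
       (c : elts C), [/\ e.2 (a, bc), bc.2 (b, c)
       & e' = @tens I (tensor_gerbe A B) C (tens a b) c]).

(** ** Stable isomorphisms *)

(* st_bundle is the U(1)-bundle L over the fibre product of the two submersions;
   st_graph i l1 l2 e f says that tau maps l2 (x) l1^* to e^* (x) f. *)
Record stable (I : Type) (A B : gerbe I) := Stable {
  st_bundle : bundle I (pts A * pts B);
  st_graph : I -> fa_sort st_bundle -> fa_sort st_bundle -> elts A -> elts B -> Prop }.

Definition st_elts (I : Type) (A B : gerbe I) (s : stable A B) : Type :=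
  fa_sort (st_bundle s).

Definition st_mem (I : Type) (A B : gerbe I) (s : stable A B) (i : I) :
    set (st_elts s) := fa_mem (st_bundle s) i.

Definition tau (I : Type) (A B : gerbe I) (s : stable A B) (i : I)
    (l1 l2 : st_elts s) (e : elts A) (f : elts B) : Prop :=
  [/\ [/\ st_mem i l1, st_mem i l2, fa_mem (ge_bundle A) i e
         & fa_mem (ge_bundle B) i f],
      bu_proj l1 = (src e, src f), bu_proj l2 = (tgt e, tgt f)
    & st_graph i l1 l2 e f].
Arguments tau {I A B} s i l1 l2 e f.

Definition pull_stable (I J : Type) (h : J -> I) (A B : gerbe I) (s : stable A B) :
    stable (pull_gerbe h A) (pull_gerbe h B) :=
  @Stable J (pull_gerbe h A) (pull_gerbe h B) (pull_bundle h (st_bundle s))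
    (fun j => @st_graph I A B s (h j)).

Definition adjoint_inverse (I : Type) (A B : gerbe I) (s : stable A B) : stable B A :=
  @Stable I B A (rename_bundle (fun x => (x.2, x.1)) (dual_bundle (st_bundle s)))
    (fun i l1 l2 f e => @st_graph I A B s i l1 l2 e f).

(* The stable isomorphism induced by a morphism f: its elements are the pairs
   (y, b) with b over (f y, z), and tau (b2 (x) b1^* ) = e^* (x) b holds when
   b b1 = b2 f(e). *)
Definition Sigma (I : Type) (A B : gerbe I) (f : gerbe_map A B) : stable A B :=
  @Stable I A B
    (@Bundle I (pts A * pts B)%type
       (@sub_family I (prod_family (ge_fam A) (ge_bundle B))
          [set x | src x.2 = gm_fun f x.1])
       (fun x => (x.1, tgt x.2)) (fun x z => (x.1, bu_act x.2 z)))
    (fun i l1 l2 e b => exists e', [/\ fa_mem (ge_bundle B) i e', gm_graph f e e'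
       & ge_mul b l1.2 = ge_mul l2.2 e']).

Definition id_stable (I : Type) (A : gerbe I) : stable A A := Sigma (id_map A).

(* The composite, first s and then t.  The descent data identifies the elements
   l (x) k and l' (x) k' over (y, z, w) and (y, z', w). *)
Section Composite.
Variables (I : Type) (A B C : gerbe I) (s : stable A B) (t : stable B C).

Definition matching : family I :=
  @sub_family I (prod_family (st_bundle s) (st_bundle t))
    [set x | (bu_proj x.1).2 = (bu_proj x.2).1].

Definition descent_class (i : I) (x : st_elts s * st_elts t) :
    (pts A * pts C) * set (st_elts s * st_elts t) :=
  (((bu_proj x.1).1, (bu_proj x.2).2),
   [set x' | exists e f h, [/\ is_unit i e, is_unit i h,
                              tau _ i x.1 x'.1 e f & tau _ i x.2 x'.2 f h]]).

Definition compose : stable A C :=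
  @Stable I A C
    (@Bundle I (pts A * pts C)%type
       (@quotient_family I matching _ descent_class)
       fst (fun x z => (x.1, [set (bu_act y.1 z, y.2) | y in x.2])))
    (fun i x x' e h => exists y y' f,
       [/\ x.2 y, x'.2 y', tau _ i y.1 y'.1 e f & tau _ i y.2 y'.2 f h]).
End Composite.

Definition tensor_stable (I : Type) (A B C D : gerbe I) (s : stable A B)
    (t : stable C D) : stable (tensor_gerbe A C) (tensor_gerbe B D) :=
  @Stable I (tensor_gerbe A C) (tensor_gerbe B D)
    (rename_bundle (@middle_swap _ _ _ _) (tensor_bundle (st_bundle s) (st_bundle t)))
    (fun i x x' e f => exists y y' a b,
       [/\ x.2 y /\ x'.2 y', e.2 a /\ f.2 b, tau _ i y.1 y'.1 a.1 b.1
         & tau _ i y.2 y'.2 a.2 b.2]).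

(* The pullback of a stable isomorphism along a morphism into its source. *)
Definition precompose (I : Type) (A A' B : gerbe I) (f : gerbe_map A A')
    (s : stable A' B) : stable A B :=
  @Stable I A B
    (@Bundle I (pts A * pts B)%type
       (@sub_family I (prod_family (ge_fam A) (st_bundle s))
          [set x | (bu_proj x.2).1 = gm_fun f x.1])
       (fun x => (x.1, (bu_proj x.2).2)) (fun x z => (x.1, bu_act x.2 z)))
    (fun i l1 l2 e b => exists2 e', gm_graph f e e' & tau _ i l1.2 l2.2 e' b).

(* Pairs of relations acting on elements of tensor products and composites *)
Definition pair_rel (P P' S S' T T' : Type) (r : S -> S' -> Prop) (r' : T -> T' -> Prop)
    (x : P * set (S * T)) (x' : P' * set (S' * T')) : Prop :=
  exists y y', [/\ x.2 y, x'.2 y', r y.1 y'.1 & r' y.2 y'.2].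

(* The composite g o f^* of a span *)
Definition span_stable (I : Type) (A B C : gerbe I) (f : gerbe_map B A)
    (g : gerbe_map B C) : stable A C :=
  compose (adjoint_inverse (Sigma f)) (Sigma g).

(** ** 2-arrows, given by the graphs of isomorphisms of U(1)-bundles *)

Definition two_arrow (I : Type) (A B A' B' : gerbe I) (s : stable A B)
    (s' : stable A' B') : Type := I -> st_elts s -> st_elts s' -> Prop.

Section TwoArrows.
Variable I : Type.

Definition vid (A B : gerbe I) (s : stable A B) : two_arrow s s := fun i l l' => l = l'.
#[global] Arguments vid {A B} s i l l'.

Definition vcomp (A B : gerbe I) (s t u : stable A B) (a : two_arrow s t)
    (b : two_arrow t u) : two_arrow s u :=
  fun i l l'' => exists l', [/\ st_mem i l', a i l l' & b i l' l''].
#[global] Arguments vcomp {A B s t u} a b i l l''.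

Definition vinv (A B : gerbe I) (s t : stable A B) (a : two_arrow s t) :
    two_arrow t s := fun i l l' => a i l' l.
#[global] Arguments vinv {A B s t} a i l l'.

Definition hcomp (A B C : gerbe I) (s s' : stable A B) (t t' : stable B C)
    (a : two_arrow s s') (b : two_arrow t t') :
    two_arrow (compose s t) (compose s' t') :=
  fun i => pair_rel (a i) (b i).
#[global] Arguments hcomp {A B C s s' t t'} a b i x x'.

Definition whisker_l (A B C : gerbe I) (s : stable A B) (t t' : stable B C)
    (b : two_arrow t t') : two_arrow (compose s t) (compose s t') :=
  hcomp (vid s) b.
#[global] Arguments whisker_l {A B C} s {t t'} b i.

Definition whisker_r (A B C : gerbe I) (s s' : stable A B) (t : stable B C)
    (a : two_arrow s s') : two_arrow (compose s t) (compose s' t) :=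
  hcomp a (vid t).
#[global] Arguments whisker_r {A B C s s'} t a i.

Definition htensor (A B C D : gerbe I) (s s' : stable A B) (t t' : stable C D)
    (a : two_arrow s s') (b : two_arrow t t') :
    two_arrow (tensor_stable s t) (tensor_stable s' t') :=
  fun i => pair_rel (a i) (b i).
#[global] Arguments htensor {A B C D s s' t t'} a b i x x'.

Definition hadjoint (A B : gerbe I) (s s' : stable A B) (a : two_arrow s s') :
    two_arrow (adjoint_inverse s) (adjoint_inverse s') := a.
#[global] Arguments hadjoint {A B s s'} a.

Definition hprecompose (A A' B : gerbe I) (f : gerbe_map A A') (s s' : stable A' B)
    (a : two_arrow s s') : two_arrow (precompose f s) (precompose f s') :=
  fun i x x' => x.1 = x'.1 /\ a i x.2 x'.2.
#[global] Arguments hprecompose {A A' B} f {s s'} a i x x'.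

(* (l (x) k) (x) n |-> l (x) (k (x) n) *)
Definition vassoc (A B C D : gerbe I) (s : stable A B) (t : stable B C)
    (u : stable C D) :
    two_arrow (compose (compose s t) u) (compose s (compose t u)) :=
  fun i x x' => exists (lk : st_elts (compose s t)) (kn : st_elts (compose t u)) l k n,
    [/\ x.2 (lk, n), lk.2 (l, k), x'.2 (l, kn) & kn.2 (k, n)].
#[global] Arguments vassoc {A B C D} s t u i x x'.

(* Over (y, y', z), an element e (x) l of the composite with the identity
   corresponds to the l' over (y, z) with tau (l (x) l'^* ) = e^* (x) 1. *)
Definition unit_l (A B : gerbe I) (s : stable A B) :
    two_arrow (compose (id_stable A) s) s :=
  fun i x l' => exists y f, [/\ x.2 y, is_unit i f & tau _ i l' y.2 y.1.2 f].
#[global] Arguments unit_l {A B} s i x l'.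

Definition unit_r (A B : gerbe I) (s : stable A B) :
    two_arrow (compose s (id_stable B)) s :=
  fun i x l' => exists y e, [/\ x.2 y, is_unit i e & tau _ i y.1 l' e y.2.2].
#[global] Arguments unit_r {A B} s i x l'.

(* Unit and counit of the adjunction of s and its adjoint inverse *)
Definition adj_unit (A B : gerbe I) (s : stable A B) :
    two_arrow (id_stable A) (compose s (adjoint_inverse s)) :=
  fun i e x => exists (y : st_elts s * st_elts s) f,
    [/\ x.2 y, is_unit i f & tau _ i y.1 y.2 e.2 f].
#[global] Arguments adj_unit {A B} s i e x.

Definition adj_counit (A B : gerbe I) (s : stable A B) :
    two_arrow (compose (adjoint_inverse s) s) (id_stable B) :=
  fun i x f => exists (y : st_elts s * st_elts s) e,
    [/\ x.2 y, is_unit i e & tau _ i y.1 y.2 e f.2].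
#[global] Arguments adj_counit {A B} s i x f.

(* The mate of a square a : t o r <= q o p with respect to p and t. *)
Definition mate (A B C D : gerbe I) (p : stable A B) (q : stable B D)
    (r : stable A C) (t : stable C D) (a : two_arrow (compose p q) (compose r t)) :
    two_arrow (compose q (adjoint_inverse t)) (compose (adjoint_inverse p) r) :=
  let p' := adjoint_inverse p in
  let t' := adjoint_inverse t in
  vcomp (vinv (unit_l (compose q t')))
  (vcomp (whisker_r (compose q t') (vinv (adj_counit p)))
  (vcomp (vassoc p' p (compose q t'))
  (whisker_l p'
    (vcomp (vinv (vassoc p q t'))
    (vcomp (whisker_r t' a)
    (vcomp (vassoc r t t')
    (vcomp (whisker_l r (vinv (adj_unit t)))
    (unit_r r)))))))).
#[global] Arguments mate {A B C D p q r t} a.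

(** ** Structural 2-arrows *)

Definition Sigma_comp (A B C : gerbe I) (f : gerbe_map A B) (g : gerbe_map B C) :
    two_arrow (compose (Sigma f) (Sigma g)) (Sigma (comp_map f g)) :=
  fun i x l => exists y c, [/\ x.2 y, fa_mem (ge_bundle C) i c,
    gm_graph g y.1.2 c & l = (y.1.1, ge_mul y.2.2 c)].
#[global] Arguments Sigma_comp {A B C} f g i x l.

Definition Sigma_tensor (A B C D : gerbe I) (f : gerbe_map A B) (g : gerbe_map C D) :
    two_arrow (tensor_stable (Sigma f) (Sigma g)) (Sigma (tensor_map f g)) :=
  fun i x l => exists2 y, x.2 y & l = ((y.1.1, y.2.1), tens y.1.2 y.2.2).
#[global] Arguments Sigma_tensor {A B C D} f g i x l.

(* A commuting square of morphisms, q after p equal to t after r *)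
Definition Sigma_square (A B C D : gerbe I) (p : gerbe_map A B) (q : gerbe_map B D)
    (r : gerbe_map A C) (t : gerbe_map C D) :
    two_arrow (compose (Sigma p) (Sigma q)) (compose (Sigma r) (Sigma t)) :=
  fun i x x' => exists l : pts A * elts D,
    [/\ @st_mem I A D (Sigma (comp_map p q)) i l,
        @Sigma_comp A B D p q i x l & @Sigma_comp A C D r t i x' l].
#[global] Arguments Sigma_square {A B C D} p q r t i x x'.

Definition interchange (A B C A' B' C' : gerbe I) (s : stable A B) (t : stable B C)
    (s' : stable A' B') (t' : stable B' C') :
    two_arrow (tensor_stable (compose s t) (compose s' t'))
      (compose (tensor_stable s s') (tensor_stable t t')) :=
  fun i x x' => exists (a : st_elts (compose s t)) (a' : st_elts (compose s' t'))
    (b : st_elts (tensor_stable s s')) (b' : st_elts (tensor_stable t t')) l l' k k',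
    [/\ x.2 (a, a'), a.2 (l, k) /\ a'.2 (l', k'), x'.2 (b, b')
      & b.2 (l, l') /\ b'.2 (k, k')].
#[global] Arguments interchange {A B C A' B' C'} s t s' t' i x x'.

Definition adjoint_tensor (A B C D : gerbe I) (s : stable A B) (t : stable C D) :
    two_arrow (tensor_stable (adjoint_inverse s) (adjoint_inverse t))
      (adjoint_inverse (tensor_stable s t)) :=
  fun i x x' => x.2 = x'.2.
#[global] Arguments adjoint_tensor {A B C D} s t i x x'.

Definition precompose_comp (A A' B C : gerbe I) (f : gerbe_map A A')
    (s : stable A' B) (t : stable B C) :
    two_arrow (precompose f (compose s t)) (compose (precompose f s) t) :=
  fun i x x' => exists l k, x.2.2 (l, k) /\ x'.2 ((x.1, l), k).
#[global] Arguments precompose_comp {A A' B C} f s t i x x'.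

Definition precompose_Sigma (A A' B : gerbe I) (f : gerbe_map A A')
    (g : gerbe_map A' B) :
    two_arrow (precompose f (Sigma g)) (Sigma (comp_map f g)) :=
  fun i x l => l = (x.1, x.2.2).
#[global] Arguments precompose_Sigma {A A' B} f g i x l.

(* For an isomorphism f with inverse f' *)
Definition precompose_adjoint (A A' B : gerbe I) (f : gerbe_map A A')
    (f' : gerbe_map A' A) (g : gerbe_map B A') :
    two_arrow (precompose f (adjoint_inverse (Sigma g)))
      (adjoint_inverse (Sigma (comp_map g f'))) :=
  fun i x l => x.2.1 = l.1 /\ gm_graph f' x.2.2 l.2.
#[global] Arguments precompose_adjoint {A A' B} f f' g i x l.

Definition id_adjoint_id (A : gerbe I) :
    two_arrow (id_stable A) (compose (adjoint_inverse (id_stable A)) (id_stable A)) :=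
  vinv (adj_counit (id_stable A)).
#[global] Arguments id_adjoint_id : clear implicits.

(* (g o f^* ) (x) 1 and (g (x) 1) o (f (x) 1)^*, and similarly on the other side *)
Definition span_tensor_id (A B C D : gerbe I) (f : gerbe_map B A) (g : gerbe_map B C) :
    two_arrow
      (tensor_stable (span_stable f g) (id_stable D))
      (span_stable (tensor_map f (id_map D)) (tensor_map g (id_map D))) :=
  vcomp (htensor (vid _) (id_adjoint_id D))
  (vcomp (interchange _ _ _ _)
  (hcomp (vcomp (adjoint_tensor _ _) (hadjoint (Sigma_tensor f (id_map D))))
         (Sigma_tensor g (id_map D)))).
#[global] Arguments span_tensor_id {A B C} D f g i l l'.

Definition span_id_tensor (A B C D : gerbe I) (f : gerbe_map B A) (g : gerbe_map B C) :
    two_arrow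
      (tensor_stable (id_stable D) (span_stable f g))
      (span_stable (tensor_map (id_map D) f) (tensor_map (id_map D) g)) :=
  vcomp (htensor (id_adjoint_id D) (vid _))
  (vcomp (interchange _ _ _ _)
  (hcomp (vcomp (adjoint_tensor _ _) (hadjoint (Sigma_tensor (id_map D) f)))
         (Sigma_tensor (id_map D) g))).
#[global] Arguments span_id_tensor {A B C} D f g i l l'.
End TwoArrows.

Definition pull_Sigma (I J : Type) (h : J -> I) (A B : gerbe I) (f : gerbe_map A B) :
    two_arrow (pull_stable h (Sigma f)) (Sigma (pull_map h f)) :=
  fun i l l' => l = l'.
Arguments pull_Sigma {I J} h {A B} f i l l'.

Definition pull_span (I J : Type) (h : J -> I) (A B C : gerbe I) (f : gerbe_map B A)
    (g : gerbe_map B C) :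
    two_arrow (pull_stable h (span_stable f g))
      (span_stable (pull_map h f) (pull_map h g)) :=
  fun i l l' => l = l'.
Arguments pull_span {I J} h {A B C} f g i l l'.

(** ** The pasting of a 3 x 3 diagram of morphisms

      A <-a1- B -a2-> C
      ^u1     ^u2     ^u3
      D <-b1- O -b2-> F
      |v1     |v2     |v3
      v       v       v
      H <-c1- K -c2-> J                                                       *)

Section Pasting.
Variables (I : Type) (A B C D O F H K J : gerbe I).
Variables (a1 : gerbe_map B A) (a2 : gerbe_map B C).
Variables (b1 : gerbe_map O D) (b2 : gerbe_map O F).
Variables (c1 : gerbe_map K H) (c2 : gerbe_map K J).
Variables (u1 : gerbe_map D A) (u2 : gerbe_map O B) (u3 : gerbe_map F C).
Variables (v1 : gerbe_map D H) (v2 : gerbe_map O K) (v3 : gerbe_map F J).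
Local Notation S f := (Sigma f).
Local Notation S' f := (adjoint_inverse (Sigma f)).

Definition upper_right :
    two_arrow (compose (S a2) (S' u3)) (compose (S' u2) (S b2)) :=
  mate (Sigma_square u2 a2 b2 u3).

Definition lower_left :
    two_arrow (compose (S' b1) (S v2)) (compose (S v1) (S' c1)) :=
  vinv (mate (Sigma_square b1 v1 v2 c1)).

Definition upper_left :
    two_arrow (compose (S' a1) (S' u2)) (compose (S' u1) (S' b1)) :=
  vinv (mate (mate (Sigma_square u2 a1 b1 u1))).

Definition lower_right :
    two_arrow (compose (S b2) (S v3)) (compose (S v2) (S c2)) :=
  Sigma_square b2 v3 v2 c2.

Definition pasting :
    two_arrow (compose (span_stable a1 a2) (span_stable u3 v3))
              (compose (span_stable u1 v1) (span_stable c1 c2)) :=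
  let right : two_arrow (compose (S a2) (compose (S' u3) (S v3)))
                        (compose (S' u2) (compose (S v2) (S c2))) :=
    vcomp (vinv (vassoc (S a2) (S' u3) (S v3)))
    (vcomp (whisker_r (S v3) upper_right)
    (vcomp (vassoc (S' u2) (S b2) (S v3))
    (whisker_l (S' u2) lower_right))) in
  let left : two_arrow (compose (S' b1) (compose (S v2) (S c2)))
                       (compose (S v1) (compose (S' c1) (S c2))) :=
    vcomp (vinv (vassoc (S' b1) (S v2) (S c2)))
    (vcomp (whisker_r (S c2) lower_left)
    (vassoc (S v1) (S' c1) (S c2))) in
  vcomp (vassoc (S' a1) (S a2) (compose (S' u3) (S v3)))
  (vcomp (whisker_l (S' a1) right)
  (vcomp (vinv (vassoc (S' a1) (S' u2) (compose (S v2) (S c2))))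
  (vcomp (whisker_r (compose (S v2) (S c2)) upper_left)
  (vcomp (vassoc (S' u1) (S' b1) (compose (S v2) (S c2)))
  (vcomp (whisker_l (S' u1) left)
  (vinv (vassoc (S' u1) (S v1) (compose (S' c1) (S c2))))))))).
End Pasting.
#[global] Arguments pasting {I A B C D O F H K J} a1 a2 b1 b2 c1 c2 u1 u2 u3 v1 v2 v3 i _ _.

(** * Bundle 2-gerbes *)

(* Projections between fibre powers; as usual the subscripts are the indices
   of the components that are kept. *)
Section Projections.
Variable Y : Type.
Definition e01 (y : Y * Y * Y) : Y * Y := (y.1.1, y.1.2).
Definition e12 (y : Y * Y * Y) : Y * Y := (y.1.2, y.2).
Definition e02 (y : Y * Y * Y) : Y * Y := (y.1.1, y.2).
Definition f012 (y : Y * Y * Y * Y) : Y * Y * Y := (y.1.1.1, y.1.1.2, y.1.2).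
Definition f123 (y : Y * Y * Y * Y) : Y * Y * Y := (y.1.1.2, y.1.2, y.2).
Definition f013 (y : Y * Y * Y * Y) : Y * Y * Y := (y.1.1.1, y.1.1.2, y.2).
Definition f023 (y : Y * Y * Y * Y) : Y * Y * Y := (y.1.1.1, y.1.2, y.2).
Definition g01 (y : Y * Y * Y * Y) : Y * Y := (y.1.1.1, y.1.1.2).
Definition g12 (y : Y * Y * Y * Y) : Y * Y := (y.1.1.2, y.1.2).
Definition g23 (y : Y * Y * Y * Y) : Y * Y := (y.1.2, y.2).
Definition g02 (y : Y * Y * Y * Y) : Y * Y := (y.1.1.1, y.1.2).
Definition g13 (y : Y * Y * Y * Y) : Y * Y := (y.1.1.2, y.2).
Definition g03 (y : Y * Y * Y * Y) : Y * Y := (y.1.1.1, y.2).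
End Projections.
#[global] Arguments e01 {Y} y.
#[global] Arguments e12 {Y} y.
#[global] Arguments e02 {Y} y.
#[global] Arguments f012 {Y} y.
#[global] Arguments f123 {Y} y.
#[global] Arguments f013 {Y} y.
#[global] Arguments f023 {Y} y.
#[global] Arguments g01 {Y} y.
#[global] Arguments g12 {Y} y.
#[global] Arguments g23 {Y} y.
#[global] Arguments g02 {Y} y.
#[global] Arguments g13 {Y} y.
#[global] Arguments g03 {Y} y.

Section Associators.
Variables (Y : Type) (E : gerbe (Y * Y)).

Definition product12_01 : gerbe (Y * Y * Y) :=
  tensor_gerbe (pull_gerbe e12 E) (pull_gerbe e01 E).

Variable m : stable product12_01 (pull_gerbe e02 E).
Local Notation E_ p := (pull_gerbe p E).

Definition assoc_source :
    stable (tensor_gerbe (tensor_gerbe (E_ g23) (E_ g12)) (E_ g01)) (E_ g03) :=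
  compose
    (tensor_stable
       (pull_stable f123 m : stable (tensor_gerbe (E_ g23) (E_ g12)) (E_ g13))
       (id_stable (E_ g01)))
    (pull_stable f013 m : stable (tensor_gerbe (E_ g13) (E_ g01)) (E_ g03)).

Definition assoc_target :
    stable (tensor_gerbe (tensor_gerbe (E_ g23) (E_ g12)) (E_ g01)) (E_ g03) :=
  compose
    (precompose (tensor_assoc (E_ g23) (E_ g12) (E_ g01))
       (tensor_stable (id_stable (E_ g23))
          (pull_stable f012 m : stable (tensor_gerbe (E_ g12) (E_ g01)) (E_ g02))))
    (pull_stable f023 m : stable (tensor_gerbe (E_ g23) (E_ g02)) (E_ g03)).
End Associators.

Record bundle_2_gerbe (X : fmanifold R) := Bundle2Gerbe {
  tg_sub : space R;
  tg_proj : tg_sub -> X;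
  tg_gerbe : gerbe (tg_sub * tg_sub);
  tg_mul : stable (product12_01 tg_gerbe) (pull_gerbe e02 tg_gerbe);
  tg_assoc : two_arrow (assoc_source tg_mul) (assoc_target tg_mul) }.

(** ** Isomorphisms of bundle 2-gerbes *)

Definition is_gerbe_iso (B0 : space R) (J : Type) (h : B0 -> J) (A : gerbe B0)
    (A' : gerbe J) (rY : B0 -> pts A -> pts A' -> Prop)
    (rE : B0 -> elts A -> elts A' -> Prop) : Prop :=
  let related i e e' := [/\ fa_mem (ge_bundle A) i e, fa_mem (ge_bundle A') (h i) e'
                           & rE i e e'] in
  [/\ @is_iso_graph B0 J h (ge_fam A) (ge_fam A') rY,
      @is_iso_graph B0 J h (ge_bundle A) (ge_bundle A') rE,
      forall i e e', sp_mem i -> related i e e' ->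
        rY i (src e) (src e') /\ rY i (tgt e) (tgt e'),
      forall i e e' z, sp_mem i -> related i e e' -> circle z ->
        rE i (bu_act e z) (bu_act e' z)
    & forall i e1 e2 e1' e2', sp_mem i -> related i e1 e1' -> related i e2 e2' ->
        tgt e1 = src e2 -> rE i (ge_mul e2 e1) (ge_mul e2' e1')].

Section Isomorphisms.
Variables (X : fmanifold R) (G1 G2 : bundle_2_gerbe X).
Local Notation Y1 := (tg_sub G1).
Local Notation Y2 := (tg_sub G2).
Local Notation A1 := (tg_gerbe G1).
Local Notation A2 := (tg_gerbe G2).
Variable h : Y1 -> Y2.

Definition map2 (y : Y1 * Y1) : Y2 * Y2 := (h y.1, h y.2).
Definition map3 (y : Y1 * Y1 * Y1) : Y2 * Y2 * Y2 := (map2 y.1, h y.2).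
Definition map4 (y : Y1 * Y1 * Y1 * Y1) : Y2 * Y2 * Y2 * Y2 := (map3 y.1, h y.2).

Definition is_diffeo_over : Prop :=
  exists h' : Y2 -> Y1,
    [/\ smooth_map h, smooth_map h',
        forall y, sp_mem y -> h' (h y) = y /\ tg_proj (h y) = tg_proj y
      & forall y, sp_mem y -> h (h' y) = y].

Variables (rY : Y1 * Y1 -> pts A1 -> pts A2 -> Prop)
          (rE : Y1 * Y1 -> elts A1 -> elts A2 -> Prop)
          (rL : Y1 * Y1 * Y1 -> st_elts (tg_mul G1) -> st_elts (tg_mul G2) -> Prop).

(* rL is the graph of an isomorphism between the U(1)-bundles of the
   multiplications, covering rY and compatible with the isomorphisms tau. *)
Definition respects_mul : Prop :=
  let related i l l' := [/\ st_mem i l, st_mem (map3 i) l' & rL i l l'] in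
  [/\ @is_iso_graph (fibre3 (@tg_proj X G1)) _ map3 (st_bundle (tg_mul G1))
        (st_bundle (tg_mul G2)) rL,
      forall i l l', sp_mem (i : fibre3 (@tg_proj X G1)) -> related i l l' ->
        [/\ rY (e12 i) (bu_proj l).1.1 (bu_proj l').1.1,
            rY (e01 i) (bu_proj l).1.2 (bu_proj l').1.2
          & rY (e02 i) (bu_proj l).2 (bu_proj l').2],
      forall i l l' z, sp_mem (i : fibre3 (@tg_proj X G1)) -> related i l l' ->
        circle z -> rL i (bu_act l z) (bu_act l' z)
    & forall i l1 l2 e f l1' l2' e' f', sp_mem (i : fibre3 (@tg_proj X G1)) ->
        related i l1 l1' -> related i l2 l2' ->
        fa_mem (ge_bundle (product12_01 A2)) (map3 i) e' ->
        fa_mem (ge_bundle (pull_gerbe e02 A2)) (map3 i) f' ->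
        pair_rel (rE (e12 i)) (rE (e01 i)) e e' -> rE (e02 i) f f' ->
        tau (tg_mul G1) i l1 l2 e f -> tau (tg_mul G2) (map3 i) l1' l2' e' f'].

(* The induced isomorphisms between the U(1)-bundles of the source and of the
   target of the associators *)
Definition rel_id (i : Y1 * Y1) (l : pts A1 * elts A1) (l' : pts A2 * elts A2) : Prop :=
  rY i l.1 l'.1 /\ rE i l.2 l'.2.

Definition rel_source (i : Y1 * Y1 * Y1 * Y1)
    (x : st_elts (assoc_source (tg_mul G1))) (x' : st_elts (assoc_source (tg_mul G2))) :
    Prop :=
  pair_rel (pair_rel (rL (f123 i)) (rel_id (g01 i))) (rL (f013 i)) x x'.

Definition rel_target (i : Y1 * Y1 * Y1 * Y1)
    (x : st_elts (assoc_target (tg_mul G1))) (x' : st_elts (assoc_target (tg_mul G2))) :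
    Prop :=
  pair_rel
    (fun (l : (pts A1 * pts A1 * pts A1) * _) (l' : (pts A2 * pts A2 * pts A2) * _) =>
       [/\ rY (g23 i) l.1.1.1 l'.1.1.1, rY (g12 i) l.1.1.2 l'.1.1.2,
           rY (g01 i) l.1.2 l'.1.2
         & pair_rel (rel_id (g23 i)) (rL (f012 i)) l.2 l'.2])
    (rL (f023 i)) x x'.

Definition respects_assoc : Prop :=
  forall i x1 x2 x1' x2', sp_mem (i : fibre4 (@tg_proj X G1)) ->
    st_mem i x1 -> st_mem i x2 -> st_mem (map4 i) x1' -> st_mem (map4 i) x2' ->
    rel_source i x1 x1' -> rel_target i x2 x2' ->
    (tg_assoc i x1 x2 <-> tg_assoc (map4 i) x1' x2').
End Isomorphisms.

(* An isomorphism of all the data: of the submersions, of the bundle gerbes, and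
   of the stable isomorphisms, that is, of their U(1)-bundles together with tau,
   intertwining the associators.  The U(1)-bundles of composites are obtained by
   descent, so they are compared by an isomorphism of bundles. *)
Definition isomorphic_2_gerbes (X : fmanifold R) (G1 G2 : bundle_2_gerbe X) : Prop :=
  exists h : tg_sub G1 -> tg_sub G2, exists rY rE rL,
    [/\ is_diffeo_over h,
        @is_gerbe_iso (fibre2 (@tg_proj X G1)) _ (map2 h) (tg_gerbe G1) (tg_gerbe G2)
          rY rE,
        respects_mul h rY rE rL
      & respects_assoc h rY rE rL].

(** * Rigid bundle 2-gerbes *)

(* rb_face_n_i is the face map d_i on Z_n.  An element of E is over a pair of
   points of Z_1, rb_mul e' e is the product of e' over (z2, z3) and e over
   (z1, z2), and rb_M (w, w') is the isomorphism d_0^* E (x) d_2^* E -> d_1^* E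
   over (w, w') corresponding to the section M. *)
Record rigid_bundle_2_gerbe (X : fmanifold R) := RigidBundle2Gerbe {
  rb_sub : space R;
  rb_proj : rb_sub -> X;
  rb_Z0 : space R;
  rb_Z1 : space R;
  rb_Z2 : space R;
  rb_Z3 : space R;
  rb_proj0 : rb_Z0 -> rb_sub;
  rb_proj1 : rb_Z1 -> rb_sub * rb_sub;
  rb_proj2 : rb_Z2 -> rb_sub * rb_sub * rb_sub;
  rb_proj3 : rb_Z3 -> rb_sub * rb_sub * rb_sub * rb_sub;
  rb_face_1_0 : rb_Z1 -> rb_Z0;
  rb_face_1_1 : rb_Z1 -> rb_Z0;
  rb_face_2_0 : rb_Z2 -> rb_Z1;
  rb_face_2_1 : rb_Z2 -> rb_Z1;
  rb_face_2_2 : rb_Z2 -> rb_Z1;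
  rb_face_3_0 : rb_Z3 -> rb_Z2;
  rb_face_3_1 : rb_Z3 -> rb_Z2;
  rb_face_3_2 : rb_Z3 -> rb_Z2;
  rb_face_3_3 : rb_Z3 -> rb_Z2;
  rb_E : space R;
  rb_E_proj : rb_E -> rb_Z1 * rb_Z1;
  rb_E_act : rb_E -> R[i] -> rb_E;
  rb_mul : rb_E -> rb_E -> rb_E;
  rb_M : rb_Z2 * rb_Z2 -> rb_E -> rb_E -> rb_E }.

(** ** The associated bundle 2-gerbe *)

Section Associated.
Variables (X : fmanifold R) (G : rigid_bundle_2_gerbe X).
Local Notation Y := (rb_sub G).
Local Notation Z1 := (rb_Z1 G).
Local Notation Z2 := (rb_Z2 G).
Local Notation Z3 := (rb_Z3 G).
Local Notation d20 := (@rb_face_2_0 X G).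
Local Notation d21 := (@rb_face_2_1 X G).
Local Notation d22 := (@rb_face_2_2 X G).
Local Notation d30 := (@rb_face_3_0 X G).
Local Notation d31 := (@rb_face_3_1 X G).
Local Notation d32 := (@rb_face_3_2 X G).
Local Notation d33 := (@rb_face_3_3 X G).

Definition w_gerbe : gerbe (Y * Y) :=
  @Gerbe (Y * Y)%type (family_of (@rb_proj1 X G))
    (@Bundle (Y * Y)%type (Z1 * Z1)%type
       (family_of (fun e : rb_E G => rb_proj1 (rb_E_proj e).1))
       (@rb_E_proj X G) (@rb_E_act X G))
    (@rb_mul X G).

Definition w_gerbe012 : gerbe (Y * Y * Y) :=
  @induced_gerbe (Y * Y * Y)%type (product12_01 w_gerbe) (family_of (@rb_proj2 X G))
    (fun w => (d20 w, d22 w)).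

Definition w_span : gerbe_map w_gerbe012 (product12_01 w_gerbe) :=
  @GerbeMap _ w_gerbe012 (product12_01 w_gerbe)
    (fun w : Z2 => (d20 w, d22 w)) (fun x y => y = x.2).

Definition w_M : gerbe_map w_gerbe012 (pull_gerbe e02 w_gerbe) :=
  @GerbeMap _ w_gerbe012 (pull_gerbe e02 w_gerbe) d21
    (fun x e => exists a b, x.2.2 (a, b) /\ e = rb_M x.1 a b).

Definition w_mul : stable (product12_01 w_gerbe) (pull_gerbe e02 w_gerbe) :=
  span_stable w_span w_M.

Local Notation E_ p := (pull_gerbe p w_gerbe).
Local Notation T_ p := (pull_gerbe p w_gerbe012).

Definition w_E123_E01 := tensor_gerbe (T_ f123) (E_ g01).
Definition w_E23_E012 := tensor_gerbe (E_ g23) (T_ f012).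
Definition w_E23_E12_E01 := tensor_gerbe (tensor_gerbe (E_ g23) (E_ g12)) (E_ g01).

Definition w_gerbe0123 : gerbe (Y * Y * Y * Y) :=
  @induced_gerbe (Y * Y * Y * Y)%type w_E23_E12_E01 (family_of (@rb_proj3 X G))
    (fun z => ((d20 (d30 z), d20 (d33 z)), d22 (d33 z))).

(* The outer maps of the 3 x 3 diagram *)
Definition w_span123 :
    gerbe_map (T_ f123) (tensor_gerbe (E_ g23) (E_ g12)) := pull_map f123 w_span.
Definition w_span012 :
    gerbe_map (T_ f012) (tensor_gerbe (E_ g12) (E_ g01)) := pull_map f012 w_span.
Definition w_span013 :
    gerbe_map (T_ f013) (tensor_gerbe (E_ g13) (E_ g01)) := pull_map f013 w_span.
Definition w_span023 :
    gerbe_map (T_ f023) (tensor_gerbe (E_ g23) (E_ g02)) := pull_map f023 w_span.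
Definition w_M123 : gerbe_map (T_ f123) (E_ g13) := pull_map f123 w_M.
Definition w_M012 : gerbe_map (T_ f012) (E_ g02) := pull_map f012 w_M.
Definition w_M013 : gerbe_map (T_ f013) (E_ g03) := pull_map f013 w_M.
Definition w_M023 : gerbe_map (T_ f023) (E_ g03) := pull_map f023 w_M.

(* The maps out of the centre.  An element of the bundle of w_gerbe0123 consists
   of a pair (z, z') and of the class of (a (x) b) (x) c with a, b and c over the
   edges 23, 12 and 01. *)
Definition w_to_123_01 : gerbe_map w_gerbe0123 w_E123_E01 :=
  @GerbeMap _ w_gerbe0123 w_E123_E01 (fun z : Z3 => (d30 z, d22 (d33 z)))
    (fun x y => exists (ab : elts (tensor_gerbe (E_ g23) (E_ g12))) (c : elts (E_ g01)),
       x.2.2 (ab, c) /\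
       y = @tens _ (T_ f123) (E_ g01) ((d30 x.1.1, d30 x.1.2), ab) c).

Definition w_to_23_012 : gerbe_map w_gerbe0123 w_E23_E012 :=
  @GerbeMap _ w_gerbe0123 w_E23_E012 (fun z : Z3 => (d20 (d30 z), d33 z))
    (fun x y => exists (ab : elts (tensor_gerbe (E_ g23) (E_ g12)))
       (a : elts (E_ g23)) (b : elts (E_ g12)) (c : elts (E_ g01)),
       [/\ x.2.2 (ab, c), ab.2 (a, b)
         & y = @tens _ (E_ g23) (T_ f012) a
                 ((d33 x.1.1, d33 x.1.2), @tens _ (E_ g12) (E_ g01) b c)]).

Definition w_to_013 : gerbe_map w_gerbe0123 (T_ f013) :=
  @GerbeMap _ w_gerbe0123 (T_ f013) d32
    (fun x y => exists (ab : elts (tensor_gerbe (E_ g23) (E_ g12)))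
       (a : elts (E_ g23)) (b : elts (E_ g12)) (c : elts (E_ g01)),
       [/\ x.2.2 (ab, c), ab.2 (a, b)
         & y = ((d32 x.1.1, d32 x.1.2),
                @tens _ (E_ g13) (E_ g01) (rb_M (d30 x.1.1, d30 x.1.2) a b) c)]).

Definition w_to_023 : gerbe_map w_gerbe0123 (T_ f023) :=
  @GerbeMap _ w_gerbe0123 (T_ f023) d31
    (fun x y => exists (ab : elts (tensor_gerbe (E_ g23) (E_ g12)))
       (a : elts (E_ g23)) (b : elts (E_ g12)) (c : elts (E_ g01)),
       [/\ x.2.2 (ab, c), ab.2 (a, b)
         & y = ((d31 x.1.1, d31 x.1.2),
                @tens _ (E_ g23) (E_ g02) a (rb_M (d33 x.1.1, d33 x.1.2) b c))]).

Definition w_pasting :=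
  pasting
    (tensor_map w_span123 (id_map (E_ g01))) (tensor_map w_M123 (id_map (E_ g01)))
    w_to_23_012 w_to_013
    w_span023 w_M023
    (comp_map (tensor_map (id_map (E_ g23)) w_span012) (tensor_assoc_inv _ _ _))
    w_to_123_01 w_span013
    (tensor_map (id_map (E_ g23)) w_M012) w_to_023 w_M013.

Definition w_assoc_source :
    two_arrow (assoc_source w_mul)
      (compose (span_stable (tensor_map w_span123 (id_map (E_ g01)))
                            (tensor_map w_M123 (id_map (E_ g01))))
               (span_stable w_span013 w_M013)) :=
  vcomp
    (hcomp (htensor (pull_span f123 w_span w_M) (vid (id_stable (E_ g01))))
           (pull_span f013 w_span w_M))
    (whisker_r (span_stable w_span013 w_M013)
       (span_tensor_id (E_ g01) w_span123 w_M123)).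

Definition w_assoc_target :
    two_arrow (assoc_target w_mul)
      (compose
         (span_stable
            (comp_map (tensor_map (id_map (E_ g23)) w_span012) (tensor_assoc_inv _ _ _))
            (tensor_map (id_map (E_ g23)) w_M012))
         (span_stable w_span023 w_M023)) :=
  let a := tensor_assoc (E_ g23) (E_ g12) (E_ g01) in
  let f := tensor_map (id_map (E_ g23)) w_span012 in
  let g := tensor_map (id_map (E_ g23)) w_M012 in
  vcomp
    (hcomp (hprecompose a
              (htensor (vid (id_stable (E_ g23))) (pull_span f012 w_span w_M)))
           (pull_span f023 w_span w_M))
    (whisker_r (span_stable w_span023 w_M023)
       (vcomp (hprecompose a (span_id_tensor (E_ g23) w_span012 w_M012))
       (vcomp (precompose_comp a (adjoint_inverse (Sigma f)) (Sigma g))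
       (whisker_r (Sigma g) (precompose_adjoint a (tensor_assoc_inv _ _ _) f))))).

Definition w_assoc : two_arrow (assoc_source w_mul) (assoc_target w_mul) :=
  vcomp w_assoc_source (vcomp w_pasting (vinv w_assoc_target)).

Definition w : bundle_2_gerbe X :=
  @Bundle2Gerbe X Y (@rb_proj X G) w_gerbe w_mul w_assoc.
End Associated.

Definition is_rigidification (X : fmanifold R) (G : rigid_bundle_2_gerbe X)
    (B : bundle_2_gerbe X) : Prop :=
  isomorphic_2_gerbes (w G) B.

(** * The Chern-Simons bundle 2-gerbes *)

Section ChernSimons.
Variables (G : lie_group R) (X : fmanifold R) (Q : principal_bundle G X).
Variables (B : lie_alg G -> lie_alg G -> R) (L : level1_extension B).
Local Notation paths := (PG G).
Local Notation Qs := (space_of Q).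
Local Notation Ls := (space_of L).

(* Points of Z_n are written ((y, p_1), ..., p_n). *)
Definition CS : rigid_bundle_2_gerbe X :=
  let ev (y : Q) (p : R -> G) : Q := pb_act y (p (2 * pi)) in
  @RigidBundle2Gerbe X Qs (@pb_proj R G X Q)
    Qs
    (prod_space Qs paths)
    (prod_space (prod_space Qs paths) paths)
    (prod_space (prod_space (prod_space Qs paths) paths) paths)
    id
    (fun x => (x.1, ev x.1 x.2))
    (fun x => let: (y, p, q) := x in (y, ev y p, ev (ev y p) q))
    (fun x => let: (y, p, q, r) := x in
       (y, ev y p, ev (ev y p) q, ev (ev (ev y p) q) r))
    (fun x => ev x.1 x.2)
    (fun x => x.1)
    (fun x => let: (y, p, q) := x in (ev y p, q))
    (fun x => let: (y, p, q) := x in (y, path_mul p q))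
    (fun x => let: (y, p, q) := x in (y, p))
    (fun x => let: (y, p, q, r) := x in (ev y p, q, r))
    (fun x => let: (y, p, q, r) := x in (y, path_mul p q, r))
    (fun x => let: (y, p, q, r) := x in (y, p, path_mul q r))
    (fun x => let: (y, p, q, r) := x in (y, p, q))
    (prod_space (prod_space Qs paths) Ls)
    (fun e => let: (y, p, c) := e in ((y, p), (y, path_mul p (le_proj c))))
    (fun e z => (e.1, lie_mul e.2 (le_incl L z)))
    (fun e' e => (e.1, lie_mul e.2 e'.2))
    (fun ww' e' e => let: (y, p, q) := ww'.1 in
       (y, path_mul p q, lie_mul (le_Ad (path_inv q) e.2) e'.2)).

(* The basic gerbe on G *)
Definition basic_gerbe : gerbe G :=
  @Gerbe G (family_of (fun p : paths => p (2 * pi)))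
    (@Bundle G (paths * paths)%type
       (family_of (fun e : prod_space paths Ls => e.1 (2 * pi)))
       (fun e => (e.1, path_mul e.1 (le_proj e.2)))
       (fun e z => (e.1, lie_mul e.2 (le_incl L z))))
    (fun e' e => (e.1, lie_mul e.2 e'.2)).

(* Face maps G x G -> G of the nerve of G, and the multiplicative structure *)
Definition nerve_d0 (g : G * G) : G := g.2.
Definition nerve_d1 (g : G * G) : G := lie_mul g.1 g.2.
Definition nerve_d2 (g : G * G) : G := g.1.

Definition basic_product : gerbe (G * G) :=
  tensor_gerbe (pull_gerbe nerve_d0 basic_gerbe) (pull_gerbe nerve_d2 basic_gerbe).

Definition basic_mul : gerbe_map basic_product (pull_gerbe nerve_d1 basic_gerbe) :=
  @GerbeMap _ basic_product (pull_gerbe nerve_d1 basic_gerbe)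
    (fun x : (R -> G) * (R -> G) => path_mul x.2 x.1)
    (fun x e => exists b a : (R -> G) * L,
       [/\ x.2 (b, a)
         & e = (path_mul a.1 b.1, lie_mul (le_Ad (path_inv b.1) a.2) b.2)]).

(* The components in degrees 1 and 2 of the simplicial map to the nerve of G *)
Definition to_nerve1 (y : Q * Q) : G := pb_div y.1 y.2.
Definition to_nerve2 (y : Q * Q * Q) : G * G := (to_nerve1 (e01 y), to_nerve1 (e12 y)).

Definition C_gerbe : gerbe (Q * Q) := pull_gerbe to_nerve1 basic_gerbe.

(* The target of the pullback of basic_mul is the pullback along e02 because
   nerve_d1 (to_nerve2 y) = to_nerve1 (e02 y) on the fibre product. *)
Definition C_map : gerbe_map (product12_01 C_gerbe) (pull_gerbe e02 C_gerbe) :=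
  let f := pull_map to_nerve2 basic_mul in
  @GerbeMap _ (product12_01 C_gerbe) (pull_gerbe e02 C_gerbe)
    (gm_fun f) (@gm_graph _ _ _ f).

Local Notation E_ p := (pull_gerbe p C_gerbe).
Definition C_map123 : gerbe_map (tensor_gerbe (E_ g23) (E_ g12)) (E_ g13) :=
  pull_map f123 C_map.
Definition C_map012 : gerbe_map (tensor_gerbe (E_ g12) (E_ g01)) (E_ g02) :=
  pull_map f012 C_map.
Definition C_map013 : gerbe_map (tensor_gerbe (E_ g13) (E_ g01)) (E_ g03) :=
  pull_map f013 C_map.
Definition C_map023 : gerbe_map (tensor_gerbe (E_ g23) (E_ g02)) (E_ g03) :=
  pull_map f023 C_map.

(* Both sides of the associator are canonically Sigma of a morphism of bundle
   gerbes; the two morphisms agree, and the associator is the identity. *)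
Definition C_map_source :
    gerbe_map (tensor_gerbe (tensor_gerbe (E_ g23) (E_ g12)) (E_ g01)) (E_ g03) :=
  comp_map (tensor_map C_map123 (id_map (E_ g01))) C_map013.

Definition C_map_target :
    gerbe_map (tensor_gerbe (tensor_gerbe (E_ g23) (E_ g12)) (E_ g01)) (E_ g03) :=
  comp_map
    (comp_map (tensor_assoc (E_ g23) (E_ g12) (E_ g01))
              (tensor_map (id_map (E_ g23)) C_map012))
    C_map023.

Definition C_assoc_source :
    two_arrow (assoc_source (Sigma C_map)) (Sigma C_map_source) :=
  vcomp (hcomp (htensor (pull_Sigma f123 C_map) (vid (id_stable (E_ g01))))
               (pull_Sigma f013 C_map))
  (vcomp (whisker_r (Sigma C_map013) (Sigma_tensor C_map123 (id_map (E_ g01))))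
         (Sigma_comp (tensor_map C_map123 (id_map (E_ g01))) C_map013)).

Definition C_assoc_target :
    two_arrow (assoc_target (Sigma C_map)) (Sigma C_map_target) :=
  let a := tensor_assoc (E_ g23) (E_ g12) (E_ g01) in
  let g := tensor_map (id_map (E_ g23)) C_map012 in
  vcomp (hcomp (hprecompose a
                  (htensor (vid (id_stable (E_ g23))) (pull_Sigma f012 C_map)))
               (pull_Sigma f023 C_map))
  (vcomp (whisker_r (Sigma C_map023)
            (vcomp (hprecompose a (Sigma_tensor (id_map (E_ g23)) C_map012))
                   (precompose_Sigma a g)))
         (Sigma_comp (comp_map a g) C_map023)).

Definition C_assoc : two_arrow (assoc_source (Sigma C_map)) (assoc_target (Sigma C_map)) :=
  let identity : two_arrow (Sigma C_map_source) (Sigma C_map_target) :=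
    fun i (l l' : pts (tensor_gerbe (tensor_gerbe (E_ g23) (E_ g12)) (E_ g01))
                  * elts (E_ g03)) => l = l' in
  vcomp C_assoc_source (vcomp identity (vinv C_assoc_target)).

Definition chern_simons_2_gerbe : bundle_2_gerbe X :=
  @Bundle2Gerbe X Qs (@pb_proj R G X Q) C_gerbe (Sigma C_map) C_assoc.
End ChernSimons.

End Gerbes.

(* Main.v *)
Require Import Defs.
From mathcomp Require Import all_boot all_order all_algebra.
From mathcomp Require Import all_classical all_reals all_analysis.
From mathcomp Require Import complex.
From mathcomp Require Import ring.

(** The diffeomorphism of submersions is the identity of Q. Over a pair of points of
    Q in the same fibre, the points of both bundle gerbes are the paths in G from 1 to
    the element g that carries the first point to the second, and the elements of
    both U(1)-bundles are pairs of a path and an element of the central extension L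
    of the loop group. Forgetting the point of Q is an isomorphism of bundle gerbes.
    What has to be compared is the multiplication, which is a composite descended
    along a span for w(CS(Q)) and is induced by a morphism for C(Q), and the
    associator, which is a pasting of mates for the former and an identity for the
    latter.

    The comparison rests on one observation: everything over a fixed base point is a
    groupoid, torsor or natural transformation with values in the crossed module
    L -> PG. A grading of a bundle gerbe assigns a path to each point and an element
    of L to each element of the U(1)-bundle, functorially and faithfully enough that
    an element is determined by its ends and its lift (graded_gerbe). A stable
    isomorphism then becomes a natural transformation: an element is determined by
    its ends and by its value in L, and tau is the commutativity of the naturality
    square (graded_stable). Composition multiplies values, the adjoint inverse inverts
    them, and the tensor product combines them by the horizontal product twist of the
    2-group. The Peiffer identity is the interchange law for twist (twist_mul), and
    the adjoint action gives its associativity (twist_assoc).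

    A 2-arrow is called graded when it relates exactly the elements with the same
    ends and the same value. Units, counits, associators, interchange and the squares
    induced by commuting morphisms are graded, and graded 2-arrows are closed under
    vertical and horizontal composition, tensor products and mates. Hence each
    associator is graded: that of w(CS(Q)) because the four squares of its diagram
    commute on points by the simplicial identities (graded_pasting, graded_w_assoc),
    and that of C(Q) because its multiplication is strictly associative
    (graded_strict_assoc).

    For both multiplications the value is a coordinate on the fibres with values in the
    same group, so equality of values is an isomorphism of U(1)-bundles that is
    compatible with tau (rel_mul). It is smooth because the values of local lifts are
    computed by smooth operations of L. It matches the associators because each of
    them is the identity on values (graded_arrows_agree). *)

Set Implicit Arguments.
Unset Strict Implicit.
Unset Printing Implicit Defensive.

Import Order.TTheory GRing.Theory Num.Theory.
Import numFieldNormedType.Exports.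

Local Open Scope classical_set_scope.
Local Open Scope ring_scope.

(** * Group identities *)

Section GroupIdentities.
Variables (R : realType) (H : lie_group R).
Local Notation "x ** y" := (@lie_mul R H x y) (at level 40, left associativity).
Local Notation inv := (@lie_inv R H).
Local Notation e := (lie_one H).

Lemma lie_mulKg x y : inv x ** (x ** y) = y.
Proof. by rewrite lie_mulA lie_mulVg lie_mul1g. Qed.

Lemma lie_mulgI x y z : x ** y = x ** z -> y = z.
Proof. by move=> /(congr1 (fun t => inv x ** t)); rewrite !lie_mulKg. Qed.

Lemma lie_mulg1 x : x ** e = x.
Proof. by apply: (@lie_mulgI (inv x)); rewrite lie_mulKg lie_mulVg. Qed.

Lemma lie_mulgV x : x ** inv x = e.
Proof. by apply: (@lie_mulgI (inv x)); rewrite lie_mulKg lie_mulg1. Qed.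

Lemma lie_mulVKg x y : x ** (inv x ** y) = y.
Proof. by rewrite lie_mulA lie_mulgV lie_mul1g. Qed.

Lemma lie_invK x : inv (inv x) = x.
Proof. by apply: (@lie_mulgI (inv x)); rewrite lie_mulgV lie_mulVg. Qed.

Lemma lie_invM x y : inv (x ** y) = inv y ** inv x.
Proof.
by apply: (@lie_mulgI (x ** y)); rewrite lie_mulgV -lie_mulA lie_mulVKg lie_mulgV.
Qed.

Lemma lie_inv1 : inv e = e.
Proof. by rewrite -[LHS]lie_mul1g lie_mulgV. Qed.

Lemma lie_invI x y : inv x = inv y -> x = y.
Proof. by move=> /(congr1 (@lie_inv R H)); rewrite !lie_invK. Qed.

Lemma lie_mulIg x y z : y ** x = z ** x -> y = z.
Proof.
by move=> /(congr1 (fun t => t ** inv x)); rewrite -!lie_mulA lie_mulgV !lie_mulg1.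
Qed.

Local Notation "p **p q" := (@path_mul R H p q) (at level 40, left associativity).
Local Notation pinv := (@path_inv R H).
Local Notation ep := (fun=> lie_one H).

Implicit Types p q r : R -> H.

Lemma path_mulA p q r : p **p (q **p r) = p **p q **p r.
Proof. by apply: funext => t; rewrite /path_mul lie_mulA. Qed.

Lemma path_mulVg p : pinv p **p p = ep.
Proof. by apply: funext => t; rewrite /path_mul lie_mulVg. Qed.

Lemma path_mulgV p : p **p pinv p = ep.
Proof. by apply: funext => t; rewrite /path_mul lie_mulgV. Qed.

Lemma path_mul1g p : ep **p p = p.
Proof. by apply: funext => t; rewrite /path_mul lie_mul1g. Qed.

Lemma path_mulg1 p : p **p ep = p.
Proof. by apply: funext => t; rewrite /path_mul lie_mulg1. Qed.

Lemma path_mulKg p q : pinv p **p (p **p q) = q.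
Proof. by rewrite path_mulA path_mulVg path_mul1g. Qed.

Lemma path_mulVKg p q : p **p (pinv p **p q) = q.
Proof. by rewrite path_mulA path_mulgV path_mul1g. Qed.

Lemma path_invK p : pinv (pinv p) = p.
Proof. by apply: funext => t; rewrite /path_inv lie_invK. Qed.

Lemma path_invM p q : pinv (p **p q) = pinv q **p pinv p.
Proof. by apply: funext => t; rewrite /path_mul /path_inv lie_invM. Qed.
End GroupIdentities.

(** * Plots form a sheaf *)

Section Plots.
Variable R : realType.

Lemma Ck_ext k (V W : tvsType R) (U : set V) (f g : V -> W) :
  (forall u, U u -> f u = g u) -> Ck k U f -> Ck k U g.
Proof.
case: k => [|k] fg /= [cf dk]; split => //.
- by apply: subspace_eq_continuous cf => u; rewrite inE; apply: fg.
- by apply: subspace_eq_continuous cf => u; rewrite inE; apply: fg.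
- case: dk => s [cs sE] hs; exists s => //; split => // x [x1 x2].
  by rewrite -!fg //; apply: sE.
Qed.

Lemma Ck_sub k (V W : tvsType R) (U U' : set V) (f : V -> W) :
  U' `<=` U -> Ck k U f -> Ck k U' f.
Proof.
elim: k V W U U' f => [|k IH] V W U U' f UU /= [cf dk]; split => //.
- exact: continuous_subspaceW cf.
- exact: continuous_subspaceW cf.
- have incr : increments U' `<=` increments U by move=> x [? ?]; split; apply: UU.
  case: dk => s [cs sE] hs; exists s; last exact: IH hs.
  by split=> [|x /incr]; [exact: continuous_subspaceW cs | exact: sE].
Qed.

Lemma smooth_on_ext (V W : tvsType R) (U : set V) (f g : V -> W) :
  (forall u, U u -> f u = g u) -> smooth_on U f -> smooth_on U g.
Proof.
move=> fg sf u /sf [N oN hN]; exists N => // k; apply: Ck_ext (hN k) => v [Uv _].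
exact: fg.
Qed.

Lemma smooth_on_sub (V W : tvsType R) (U U' : set V) (f : V -> W) :
  U' `<=` U -> smooth_on U f -> smooth_on U' f.
Proof.
move=> UU sf u /UU /sf [N oN hN]; exists N => // k.
by apply: Ck_sub (hN k) => v [/UU].
Qed.

Lemma smooth_on_local (V W : tvsType R) (U : set V) (f : V -> W) :
  (forall u, U u -> exists2 N, open N /\ N u & smooth_on (U `&` N) f) ->
  smooth_on U f.
Proof.
move=> loc u Uu; have [N [oN Nu] /(_ u (conj Uu Nu)) [N' [oN' N'u] hN']] := loc u Uu.
exists (N `&` N'); first by split; [exact: openI | split].
by move=> k; rewrite setIA.
Qed.

Section LinearReparametrization.

Lemma within_continuous_comp (S T W : topologicalType) (l : S -> T) (U : set T)
    (f : T -> W) :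
  continuous l -> {within U, continuous f} -> {within l @^-1` U, continuous (f \o l)}.
Proof.
move=> cl /subspace_continuousP cf; apply/subspace_continuousP => x Ux A.
by move=> /(cf _ Ux) /cl.
Qed.

(** A linear map carries increments to increments, so composing the difference
    quotient of f with l x l x id gives a difference quotient of the composite, and
    regularity follows by induction on k. *)
Lemma Ck_linear k (V V' W : tvsType R) (l : V -> V') (U : set V') (f : V' -> W) :
  continuous l -> (forall u v, l (u + v) = l u + l v) ->
  (forall a v, l (a *: v) = a *: l v) ->
  Ck k U f -> Ck k (l @^-1` U) (f \o l).
Proof.
elim: k V V' W l U f => [|k IH] V V' W l U f cl lD lZ /= [cf dk]; split => //;
  try exact: within_continuous_comp.
case: dk => g [cg gE] hg.
pose l3 (x : V * V * R^o) : V' * V' * R^o := (l x.1.1, l x.1.2, x.2).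
have pairC (S T T' : topologicalType) (h : S -> T) (h' : S -> T') :
    continuous h -> continuous h' -> continuous (fun x => (h x, h' x)).
  by move=> ch ch' x; exact: cvg_pair (ch x) (ch' x).
have compC (S T T' : topologicalType) (h : S -> T) (h' : T -> T') :
    continuous h -> continuous h' -> continuous (h' \o h).
  by move=> ch ch' x; exact: continuous_comp (ch x) (ch' (h x)).
have fstC (S T : topologicalType) : continuous (@fst S T) by move=> x; exact: cvg_fst.
have sndC (S T : topologicalType) : continuous (@snd S T) by move=> x; exact: cvg_snd.
have c1 : continuous (fun x : V * V * R^o => l x.1.1).
  exact: (compC _ _ _ (fst \o fst) l (compC _ _ _ fst fst (fstC _ _) (fstC _ _)) cl).
have c2 : continuous (fun x : V * V * R^o => l x.1.2).
  exact: (compC _ _ _ (snd \o fst) l (compC _ _ _ fst snd (fstC _ _) (sndC _ _)) cl).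
have cl3 : continuous l3 := pairC _ _ _ _ _ (pairC _ _ _ _ _ c1 c2) (sndC _ _).
have incr : increments (l @^-1` U) = l3 @^-1` increments U.
  by apply/seteqP; split=> -[[a b] t]; rewrite /increments /= lD lZ.
exists (g \o l3); last first.
  by rewrite incr; apply: IH => //= [[[a b] t] [[a' b'] t']|a [[v w] t]]; rewrite /l3 /= ?lD ?lZ.
split; rewrite incr; first exact: within_continuous_comp.
by move=> [[a b] t] h; rewrite -(gE _ h) /= lD lZ.
Qed.

Lemma plot_linear (M : fmanifold R) (V V' : tvsType R) (l : V -> V') (U : set V')
    (p : V' -> M) :
  continuous l -> (forall u v, l (u + v) = l u + l v) ->
  (forall a v, l (a *: v) = a *: l v) -> domain (l @^-1` U) ->
  @sp_plot R (space_of M) V' U p -> @sp_plot R (space_of M) V (l @^-1` U) (p \o l).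
Proof.
move=> cl lD lZ dl [dU cp sp]; split=> // [|c hc]; first exact: within_continuous_comp.
move=> u /(sp c hc) [N [oN Nu] CN]; exists (l @^-1` N).
  by split=> //; apply: open_comp => // x _; exact: cl.
by move=> k; apply: (Ck_linear cl lD lZ (CN k)).
Qed.
End LinearReparametrization.

Lemma domain_cylinder (V W : tvsType R) (U : set W) :
  domain U -> domain (snd @^-1` U : set (V * W)).
Proof.
move=> dU [v w] /= Uw A [[A1 A2] /= [nA1 nA2] sA].
have [w' [Uw' A2w']] := dU w Uw A2 nA2; exists (v, w'); split; last first.
  by apply: sA; split=> //=; exact: nbhs_singleton nA1.
by exists (setT, U) => [|[a b] [_ Ub]] //; split=> //; exact: filterT.
Qed.

Lemma domain_restrict (V : tvsType R) (U N : set V) :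
  domain U -> open N -> domain (U `&` N).
Proof.
move=> dU oN u [Uu Nu] W Wu.
have /(dU u Uu) [v [Uv [Wv Nv]]] : nbhs u (W `&` N).
  by apply: filterI => //; apply: open_nbhs_nbhs.
exists v; split => //; rewrite /interior /=.
by apply: filterI => //; apply: open_nbhs_nbhs.
Qed.

Lemma domain_local (V : tvsType R) (U : set V) :
  (forall u, U u -> exists2 N, open N /\ N u & domain (U `&` N)) -> domain U.
Proof.
move=> loc u Uu; have [N [_ Nu] /(_ u (conj Uu Nu))] := loc u Uu.
by apply: closureS; apply: interiorS; exact: subIsetl.
Qed.

(** Plots of tensor products and composites are defined by local lifts. These
    properties let such lifts be evaluated, altered off the parameter set, shrunk
    and glued. *)
Record sheaf_of_plots (S : Defs.space R) : Prop := SheafOfPlots {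
  plot_mem : forall (V : tvsType R) (U : set V) (p : V -> S) u,
    sp_plot U p -> U u -> sp_mem (p u);
  plot_ext : forall (V : tvsType R) (U : set V) (p q : V -> S),
    (forall u, U u -> p u = q u) -> sp_plot U p -> sp_plot U q;
  plot_restrict : forall (V : tvsType R) (U N : set V) (p : V -> S),
    open N -> sp_plot U p -> sp_plot (U `&` N) p;
  plot_local : forall (V : tvsType R) (U : set V) (p : V -> S),
    (forall u, U u -> exists2 N, open N /\ N u & sp_plot (U `&` N) p) ->
    sp_plot U p }.

Lemma manifold_sheaf (M : fmanifold R) : sheaf_of_plots (space_of M).
Proof.
split=> //=.
- move=> V U p q pq [dU cp sp]; split => // [|c hc].
    by apply: subspace_eq_continuous cp => u; rewrite inE; apply: pq.
  apply: (@smooth_on_ext _ _ _ (ch_map c \o p)).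
    by move=> u [Uu _]; rewrite /= pq.
  by apply: smooth_on_sub (sp c hc) => u [Uu]; rewrite /= pq.
- move=> V U N p oN [dU cp sp]; split=> [||c hc].
  + exact: domain_restrict.
  + by apply: continuous_subspaceW cp; exact: subIsetl.
  + by apply: smooth_on_sub (sp c hc) => u [[]].
- move=> V U p loc; split=> [||c hc].
  + by apply: domain_local => u /loc [N hN [dU _ _]]; exists N.
  + apply/subspace_continuousP => u Uu.
    have [N [oN Nu] [_ /subspace_continuousP cp _]] := loc u Uu.
    move=> W /(cp u (conj Uu Nu)) cW.
    by apply: filterS2 (open_nbhs_nbhs (conj oN Nu)) cW => v Nv + Uv; apply.
  + apply: smooth_on_local => u [Uu _]; have [N hN [_ _ sp]] := loc u Uu.
    by exists N => //; apply: smooth_on_sub (sp c hc) => v [[]].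
Qed.

Lemma prod_sheaf (S T : Defs.space R) :
  sheaf_of_plots S -> sheaf_of_plots T -> sheaf_of_plots (prod_space S T).
Proof.
move=> [Sm Se Sr Sl] [Tm Te Tr Tl]; split=> /=.
- by move=> V U p u [p1 p2] Uu; split; [exact: Sm p1 Uu | exact: Tm p2 Uu].
- move=> V U p q pq [p1 p2]; split; [apply: Se p1|apply: Te p2];
    by move=> u Uu /=; rewrite pq.
- by move=> V U N p oN [p1 p2]; split; [apply: Sr|apply: Tr].
- by move=> V U p loc; split; [apply: Sl|apply: Tl] => u /loc [N hN [? ?]]; exists N.
Qed.

Lemma open_cylinder (V W : tvsType R) (N : set V) :
  open N -> open (N `*` (setT : set W)).
Proof.
move=> oN; have -> : N `*` (setT : set W) = fst @^-1` N.
  by apply/seteqP; split=> -[v w] //= [].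
by apply: open_comp oN => -[v w] _; exact: cvg_fst.
Qed.

(** A plot of paths is a plot of G on the product of U with the interval, and
    locality in U is locality on that product along cylinders. *)
Lemma path_sheaf (G : lie_group R) : sheaf_of_plots (PG G).
Proof.
have [_ Ge Gr Gl] := manifold_sheaf G; split=> /=.
- by move=> V U p u [pp _]; apply: pp.
- move=> V U p q pq [pp sp]; split=> [u Uu|]; first by rewrite -pq //; apply: pp.
  by apply: Ge sp => -[u t] [/= Uu _]; rewrite pq.
- move=> V U N p oN [pp sp]; split=> [u [Uu _]|]; first exact: pp.
  have -> : (U `&` N) `*` (@I2pi R : set R^o) =
    (U `*` (@I2pi R : set R^o)) `&` (N `*` (setT : set R^o)).
    by apply/seteqP; split=> -[u t] /=; tauto.
  by apply: Gr => //; exact: open_cylinder.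
- move=> V U p loc; split=> [u Uu|].
    by have [N [_ Nu] [pp _]] := loc u Uu; apply: pp.
  apply: Gl => -[u t] [/= Uu It]; have [N [oN Nu] [_ sp]] := loc u Uu.
  exists (N `*` (setT : set R^o)).
    by split=> //; exact: open_cylinder.
  have -> : (U `*` (@I2pi R : set R^o)) `&` (N `*` (setT : set R^o)) =
    (U `&` N) `*` (@I2pi R : set R^o); last exact: sp.
  by apply/seteqP; split=> -[v s] /=; tauto.
Qed.

Section Manifold.
Variables (M : fmanifold R) (V : tvsType R) (U : set V).

Lemma plot_cst (m : M) : domain U -> @sp_plot R (space_of M) V U (fun=> m).
Proof.
move=> dU; split => //; first by apply: continuous_subspaceT => ?; exact: cvg_cst.
move=> c hc; set f := (X in smooth_on _ X).
have fE : f = cst (ch_map c m) by [].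
rewrite fE; move: (ch_map c m) => w; apply: (@smooth_on_sub _ _ setT) => //.
move=> u _; exists setT; first by split => //; exact: openT.
move=> k; rewrite setIT.
suff cstC (W : tvsType R) (w' : W) (V' : tvsType R) : Ck k setT (cst w' : V' -> W).
  exact: cstC.
elim: k W w' V' => [|k IH] W w' V' /=; split => //;
  try by apply: continuous_subspaceT => ?; exact: cvg_cst.
exists (cst 0); last by apply: Ck_sub (IH W 0 _).
split; first by apply: continuous_subspaceT => ?; exact: cvg_cst.
by move=> x _; rewrite /cst subrr scaler0.
Qed.

Lemma plot_domain (p : V -> M) : @sp_plot R (space_of M) V U p -> domain U.
Proof. by case. Qed.
End Manifold.

Section LiePlots.
Variables (H : lie_group R) (V : tvsType R) (U : set V).
Local Notation plot := (@sp_plot R (space_of H) V U).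

Lemma plot_mul (x y : V -> H) :
  plot x -> plot y -> plot (fun u => lie_mul (x u) (y u)).
Proof.
move=> px py; have [_ h] := @lie_mul_smooth R H.
exact: (h V U (fun u => (x u, y u))).
Qed.

Lemma plot_inv (x : V -> H) : plot x -> plot (fun u => lie_inv (x u)).
Proof. by have [_ h] := @lie_inv_smooth R H; apply: h. Qed.
End LiePlots.

Section PathPlots.
Variables (G : lie_group R).

Lemma is_path_mul (p q : R -> G) : is_path p -> is_path q -> is_path (path_mul p q).
Proof.
move=> [p1 p2 p3] [q1 q2 q3]; split; first exact: plot_mul.
- by rewrite /path_mul p2 q2 lie_mul1g.
- by move=> t It; rewrite /path_mul p3 // q3 // lie_mul1g.
Qed.

Lemma is_path_inv (p : R -> G) : is_path p -> is_path (path_inv p).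
Proof.
move=> [p1 p2 p3]; split; first exact: plot_inv.
- by rewrite /path_inv p2 lie_inv1.
- by move=> t It; rewrite /path_inv p3 // lie_inv1.
Qed.

Lemma plot_constant_path (p : R -> G) :
  is_path p -> @sp_plot R (PG G) R^o setT (fun=> p).
Proof.
move=> pp; split=> //; have [pl _ _] := pp; have [dI _ _] := pl.
have -> : setT `*` (@I2pi R : set R^o) = snd @^-1` (@I2pi R : set R^o) :> set (R^o * R^o).
  by apply/seteqP; split=> [[a b] []|].
by apply: plot_linear pl => //; [move=> x; exact: cvg_snd|exact: domain_cylinder].
Qed.

Variables (V : tvsType R) (U : set V).

Lemma plot_path_mul (p q : V -> R -> G) : @sp_plot R (PG G) V U p ->
  @sp_plot R (PG G) V U q -> @sp_plot R (PG G) V U (fun u => path_mul (p u) (q u)).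
Proof.
move=> [p1 p2] [q1 q2]; split; first by move=> u Uu; apply: is_path_mul; auto.
exact: (plot_mul p2 q2).
Qed.

Lemma plot_path_inv (p : V -> R -> G) : @sp_plot R (PG G) V U p ->
  @sp_plot R (PG G) V U (fun u => path_inv (p u)).
Proof.
move=> [p1 p2]; split; first by move=> u Uu; apply: is_path_inv; auto.
exact: (plot_inv p2).
Qed.
End PathPlots.
End Plots.

(** * Division in a principal bundle *)

Section Division.
Variables (R : realType) (G : lie_group R) (X : fmanifold R).
Variable Q : principal_bundle G X.

(** A local trivialization turns the action into multiplication in G. *)
Lemma pb_act_free (y : Q) (g h : G) : pb_act y g = pb_act y h -> g = h.
Proof.
have [N [f [f' [[_ Ny] _ [f'm _] ff' f'f]]]] := pb_trivial Q (pb_proj y).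
have Nfy : N (f' y).1 by have [] := f'm y (conj I Ny).
have [_ [_ fact]] := ff' _ Nfy; have fy := f'f y Ny.
rewrite -{1 2}fy !fact => /(congr1 f').
have [-> _] := ff' ((f' y).1, lie_mul (f' y).2 g) Nfy.
have [-> _] := ff' ((f' y).1, lie_mul (f' y).2 h) Nfy.
by move=> [] /lie_mulgI.
Qed.

Lemma pb_act_transitive (y y' : Q) : pb_proj y = pb_proj y' ->
  exists g, y' = pb_act y g.
Proof.
move=> yy'.
have [N [f [f' [[_ Ny] _ [f'm _] ff' f'f]]]] := pb_trivial Q (pb_proj y).
have Ny' : N (pb_proj y') by rewrite -yy'.
have [Nfy Nfy'] : N (f' y).1 /\ N (f' y').1.
  by split; [have [] := f'm y (conj I Ny) | have [] := f'm y' (conj I Ny')].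
have [_ [py fact]] := ff' _ Nfy; have [_ [py' _]] := ff' _ Nfy'.
exists (lie_mul (lie_inv (f' y).2) (f' y').2).
rewrite -{1}(f'f y Ny) fact lie_mulVKg -{1}(f'f y' Ny'); congr f.
by rewrite [LHS]surjective_pairing -py -py' !f'f // yy'.
Qed.

Lemma pb_div_act (y : Q) g : pb_div y (pb_act y g) = g.
Proof.
apply: (@pb_act_free y); symmetry.
exact: (@xgetPex _ (lie_one G) [set k | pb_act y g = pb_act y k] (ex_intro _ g erefl)).
Qed.

Lemma pb_actK (y y' : Q) : pb_proj y = pb_proj y' -> pb_act y (pb_div y y') = y'.
Proof. by move=> /pb_act_transitive [g ->]; rewrite pb_div_act. Qed.
End Division.

(** * The crossed module of the central extension *)

Section Circle.
Variable R : realType.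
Implicit Types z w : R[i].

Lemma circle_conj z : circle z -> circle (conjc z).
Proof. by case: z => a b; rewrite /circle /= sqrrN. Qed.

Lemma circle_mul z w : circle z -> circle w -> circle (z * w).
Proof.
case: z w => [a b] [c d]; rewrite /circle /= => h1 h2.
rewrite -[RHS](mulr1 1) -{1}h1 -h2; ring.
Qed.

Lemma circle1 : circle (1 : R[i]).
Proof. by rewrite /circle /= expr1n expr0n addr0. Qed.

Lemma circle_mulV z : circle z -> z * conjc z = 1.
Proof.
case: z => a b; rewrite /circle /= => h; apply/eqP; rewrite eq_complex /=.
by apply/andP; split; apply/eqP; [rewrite -h; ring | ring].
Qed.

Lemma circle_Vmul z : circle z -> conjc z * z = 1.
Proof. by move=> cz; rewrite mulrC circle_mulV. Qed.
End Circle.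

Section CrossedModule.
Variables (R : realType) (G : lie_group R) (B : lie_alg G -> lie_alg G -> R).
Variable L : level1_extension B.
Local Notation "x ** y" := (@lie_mul R L x y) (at level 40, left associativity).
Local Notation inv := (@lie_inv R L).
Local Notation "p **p q" := (@path_mul R G p q) (at level 40, left associativity).
Local Notation pinv := (@path_inv R G).
Implicit Types (x y : L) (p q k : R -> G).

Lemma le_proj1 : le_proj (lie_one L) = (fun=> lie_one G).
Proof.
have := le_projM (lie_one L) (lie_one L); rewrite lie_mul1g.
by move/(congr1 (path_mul (pinv (le_proj (lie_one L))))); rewrite path_mulKg path_mulVg.
Qed.

Lemma le_projV x : le_proj (inv x) = pinv (le_proj x).
Proof.
have := le_projM x (inv x); rewrite lie_mulgV le_proj1.
by move/(congr1 (path_mul (pinv (le_proj x)))); rewrite path_mulKg path_mulg1.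
Qed.

Lemma le_proj_loop x : is_path (le_proj x) /\ le_proj x (2 * pi) = lie_one G.
Proof. by have [h _] := @le_proj_smooth R G B L; apply: h. Qed.

Lemma le_incl1 : le_incl L 1 = lie_one L.
Proof.
have := le_inclM L (@circle1 R) (@circle1 R); rewrite mulr1 => h.
by apply: (@lie_mulgI R L (le_incl L 1)); rewrite -h lie_mulg1.
Qed.

Lemma le_incl_conj z : circle z -> le_incl L (conjc z) = inv (le_incl L z).
Proof.
move=> cz; apply: (@lie_mulgI R L (le_incl L z)).
by rewrite -le_inclM ?circle_mulV ?le_incl1 ?lie_mulgV //; exact: circle_conj.
Qed.

Lemma le_proj_incl z : circle z -> le_proj (le_incl L z) = (fun=> lie_one G).
Proof. by move=> cz; apply/le_exact; exists z. Qed.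

Lemma le_proj_eq x y : le_proj x = le_proj y ->
  exists2 z, circle z & y = x ** le_incl L z.
Proof.
move=> xy; have : le_proj (inv x ** y) = (fun=> lie_one G).
  by rewrite le_projM le_projV xy path_mulVg.
by move=> /le_exact [z cz zE]; exists z => //; rewrite zE lie_mulVKg.
Qed.

(** A single loop is a constant plot, to which local sections apply. *)
Lemma le_proj_surj p : is_path p -> p (2 * pi) = lie_one G ->
  exists x : L, le_proj x = p.
Proof.
move=> pp p2; have pl : @sp_plot R (OmegaG G) R^o setT (fun=> p).
  by split=> //; exact: plot_constant_path.
have [N [x [[_ N0] _ xE]]] := @le_sections R G B L R^o setT (fun=> p) pl 0 I.
by exists (x 0); apply: xE.
Qed.

(** The horizontal product of the strict 2-group of the crossed module, for an arrow
    x with source k and an arrow y. It is the formula for the multiplicative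
    structure of the basic gerbe, and all tensor products below are governed by it.
    *)
Definition twist k x y : L := le_Ad (pinv k) y ** x.

Lemma twist_proj k x y : is_path k ->
  le_proj (twist k x y) = pinv k **p le_proj y **p k **p le_proj x.
Proof.
move=> pk; rewrite /twist le_projM le_Ad_proj ?path_invK //; exact: is_path_inv.
Qed.

(** The interchange law. It amounts to the Peiffer identity, which moves x past the
    twisted y'. *)
Lemma twist_mul k k' x x' y y' : is_path k -> is_path k' ->
  le_proj x = pinv k **p k' ->
  twist k (x ** x') (y ** y') = twist k x y ** twist k' x' y'.
Proof.
move=> pk pk' px; have pik := is_path_inv pk; have pik' := is_path_inv pk'.
rewrite /twist le_Ad_mul // -!lie_mulA; congr (_ ** _); rewrite !lie_mulA.
congr (_ ** _); have := le_Ad_peiffer x (le_Ad (pinv k') y').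
rewrite px -le_AdM //; last exact: is_path_mul.
by rewrite -path_mulA path_mulgV path_mulg1 => ->; rewrite -!lie_mulA lie_mulVg lie_mulg1.
Qed.

(** The adjoint action is an action by automorphisms. *)
Lemma twist_assoc k l x y z : is_path k -> is_path l ->
  twist k x (twist l y z) = twist (l **p k) (twist k x y) z.
Proof.
move=> pk pl; have pik := is_path_inv pk; have pil := is_path_inv pl.
by rewrite /twist le_Ad_mul // path_invM le_AdM // lie_mulA.
Qed.

Lemma twist1 k : is_path k -> twist k (lie_one L) (lie_one L) = lie_one L.
Proof.
by move=> pk; rewrite /twist lie_mulg1 -le_incl1 le_Ad_incl; [|exact: is_path_inv|exact: circle1].
Qed.

Lemma twist_inv k k' x y : is_path k -> is_path k' -> le_proj x = pinv k **p k' ->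
  inv (twist k x y) = twist k' (inv x) (inv y).
Proof.
move=> pk pk' px; apply: (@lie_mulgI R L (twist k x y)).
by rewrite -twist_mul // !lie_mulgV twist1.
Qed.

Lemma twist_incl_l k x y z : circle z ->
  twist k (x ** le_incl L z) y = twist k x y ** le_incl L z.
Proof. by move=> cz; rewrite /twist lie_mulA. Qed.

Lemma twist_incl_r k x y z : is_path k -> circle z ->
  twist k x (y ** le_incl L z) = twist k x y ** le_incl L z.
Proof.
move=> pk cz; have pik := is_path_inv pk.
by rewrite /twist le_Ad_mul // le_Ad_incl // -!lie_mulA le_incl_central.
Qed.

(** The class of a pair is encoded as the set of its representatives; a function
    that is constant on classes is read off from any of them. *)
Definition rep_val (T : Type) (S : set T) (v : T -> L) : L :=
  xget (lie_one L) (v @` S).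

Lemma rep_valE (T : Type) (S : set T) (v : T -> L) t :
  S t -> (forall t', S t' -> v t' = v t) -> rep_val S v = v t.
Proof.
move=> St vS; rewrite /rep_val; case: xgetP => [y _ [t' St' <-]|/(_ (v t))].
  exact: vS.
by case; exists t.
Qed.
End CrossedModule.

(** * Graded U(1)-bundles *)

#[local] Arguments fa_mem {R I} f i _.

Section GradedBundles.
Variables (R : realType) (G : lie_group R) (B : lie_alg G -> lie_alg G -> R).
Variable L : level1_extension B.
Local Notation "x ** y" := (@lie_mul R L x y) (at level 40, left associativity).
Local Notation inv := (@lie_inv R L).
Local Notation "p **p q" := (@path_mul R G p q) (at level 40, left associativity).
Local Notation pinv := (@path_inv R G).

(** A grading identifies the fibre of a bundle over a point p with the
    U(1)-torsor of the elements of the central extension over the loop kappa p,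
    where p ranges over the set D of points above the base point i. *)
Record graded_bundle (I P : Type) (i : I) (M : bundle R I P) (D : set P)
    (kappa : P -> R -> G) (phi : fa_sort M -> L) : Prop := GradedBundle {
  gb_proj : forall l, fa_mem M i l ->
    D (bu_proj l) /\ le_proj (phi l) = kappa (bu_proj l);
  gb_inhabited : forall p, D p -> exists2 l, fa_mem M i l & bu_proj l = p;
  gb_inj : forall l l', fa_mem M i l -> fa_mem M i l' ->
    bu_proj l = bu_proj l' -> phi l = phi l' -> l = l';
  gb_act : forall l z, fa_mem M i l -> circle z ->
    [/\ fa_mem M i (bu_act l z), bu_proj (bu_act l z) = bu_proj l
      & phi (bu_act l z) = phi l ** le_incl L z] }.

Section Theory.
Variables (I P : Type) (i : I) (M : bundle R I P) (D : set P).
Variables (kappa : P -> R -> G) (phi : fa_sort M -> L).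
Hypothesis gM : graded_bundle i D kappa phi.

(** Elements of the extension over the same loop differ by the circle, which acts on
    the fibre. *)
Lemma gb_full p x : D p -> le_proj x = kappa p ->
  exists l, [/\ fa_mem M i l, bu_proj l = p & phi l = x].
Proof.
move=> Dp px; have [l ml pl] := gb_inhabited gM Dp.
have [z cz ->] : exists2 z, circle z & x = phi l ** le_incl L z.
  by apply: le_proj_eq; rewrite px; case: (gb_proj gM ml) => _ ->; rewrite pl.
by have [? ? ?] := gb_act gM ml cz; exists (bu_act l z); split=> //; rewrite -pl.
Qed.

Lemma gb_torsor l l' : fa_mem M i l -> fa_mem M i l' -> bu_proj l = bu_proj l' ->
  exists2 z, circle z & l' = bu_act l z.
Proof.
move=> ml ml' pp; have [_ h] := gb_proj gM ml; have [_ h'] := gb_proj gM ml'.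
have [|z cz zE] := @le_proj_eq _ _ _ _ (phi l) (phi l'); first by rewrite h h' pp.
exists z => //; have [? ? ?] := gb_act gM ml cz.
by apply: (gb_inj gM) => //; congruence.
Qed.

Lemma gb_actA l z w : fa_mem M i l -> circle z -> circle w ->
  bu_act (bu_act l z) w = bu_act l (z * w).
Proof.
move=> ml cz cw; have [m1 p1 v1] := gb_act gM ml cz.
have [m2 p2 v2] := gb_act gM m1 cw.
have [m3 p3 v3] := gb_act gM ml (circle_mul cz cw).
apply: (gb_inj gM) => //; first by congruence.
by rewrite v2 v3 v1 le_inclM // lie_mulA.
Qed.

Lemma gb_act1 l : fa_mem M i l -> bu_act l 1 = l.
Proof.
move=> ml; have [m1 p1 v1] := gb_act gM ml (@circle1 R).
by apply: (gb_inj gM) => //; rewrite v1 le_incl1 lie_mulg1.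
Qed.
End Theory.

Lemma graded_rename (I P Q : Type) (i : I) (M : bundle R I P) (D : set P)
    (kappa : P -> R -> G) (phi : fa_sort M -> L) (g : P -> Q) (D' : set Q)
    (kappa' : Q -> R -> G) :
  injective g -> D' = g @` D -> (forall p, D p -> kappa' (g p) = kappa p) ->
  graded_bundle i D kappa phi ->
  @graded_bundle I Q i (rename_bundle g M) D' kappa' phi.
Proof.
move=> gi -> kk [h1 h2 h3 h4]; split=> /=.
- by move=> l /h1 [Dp ->]; split; [exists (bu_proj l) | rewrite kk].
- by move=> _ [p Dp <-]; have [l ml pl] := h2 p Dp; exists l => //=; rewrite pl.
- by move=> l l' ml ml' /= /gi pp; apply: h3.
- by move=> l z ml cz; have [? /= -> ?] := h4 l z ml cz.
Qed.

Lemma graded_dual (I P : Type) (i : I) (M : bundle R I P) (D : set P)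
    (kappa : P -> R -> G) (phi : fa_sort M -> L) :
  graded_bundle i D kappa phi ->
  @graded_bundle I P i (dual_bundle M) D (fun p => pinv (kappa p))
    (fun l => inv (phi l)).
Proof.
move=> gM; split=> /=.
- by move=> l /(gb_proj gM) [Dp h]; rewrite le_projV h.
- exact: gb_inhabited gM.
- by move=> l l' ml ml' pp /lie_invI; apply: (gb_inj gM).
- move=> l z ml cz; have [m p ->] := gb_act gM ml (circle_conj cz); split => //.
  by rewrite le_incl_conj // lie_invM lie_invK le_incl_central.
Qed.

Lemma graded_pull (I J P : Type) (f : J -> I) (j : J) (M : bundle R I P) (D : set P)
    (kappa : P -> R -> G) (phi : fa_sort M -> L) :
  graded_bundle (f j) D kappa phi ->
  @graded_bundle J P j (pull_bundle f M) D kappa phi.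
Proof. by case. Qed.

(** ** Tensor products *)

Section Tensor.
Variables (I P Q : Type) (i : I) (M : bundle R I P) (N : bundle R I Q).
Variables (D : set P) (D' : set Q) (kappa : P -> R -> G) (kappa' : Q -> R -> G).
Variables (phi : fa_sort M -> L) (psi : fa_sort N -> L) (rho : P -> R -> G).
Hypothesis gM : graded_bundle i D kappa phi.
Hypothesis gN : graded_bundle i D' kappa' psi.
Hypothesis rho_path : forall p, D p -> is_path (rho p).

(** The value of a tensor. In the applications rho is the path of the source of the
    first factor, which makes values multiply by the interchange law. *)
Definition pair_val (y : fa_sort M * fa_sort N) : L :=
  twist (rho (bu_proj y.1)) (phi y.1) (psi y.2).

Definition tensor_val (x : (P * Q) * set (fa_sort M * fa_sort N)) : L :=
  rep_val x.2 pair_val.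

Lemma pair_val_act l k z w : fa_mem M i l -> fa_mem N i k -> circle z -> circle w ->
  pair_val (bu_act l z, bu_act k w) = pair_val (l, k) ** le_incl L (z * w).
Proof.
move=> ml mk cz cw; have [_ pz vz] := gb_act gM ml cz.
have [_ pw vw] := gb_act gN mk cw; have [Dl _] := gb_proj gM ml.
have pr := rho_path Dl.
by rewrite /pair_val /= pz vz vw twist_incl_r // twist_incl_l // le_inclM // lie_mulA.
Qed.

(** Two pairs over the same points differ by two scalars. Equality of the values
    says that these are inverse to each other, because the circle embeds in the
    extension and acts centrally. *)
Lemma tensor_orbitP l k y : fa_mem M i l -> fa_mem N i k ->
  tensor_orbit l k y <->
  [/\ fa_mem M i y.1, fa_mem N i y.2, (bu_proj l, bu_proj k) = (bu_proj y.1, bu_proj y.2)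
    & pair_val y = pair_val (l, k)].
Proof.
move=> ml mk; split=> [[z cz ->] /=|].
  have [m1 p1 _] := gb_act gM ml cz.
  have [m2 p2 _] := gb_act gN mk (circle_conj cz).
  split=> //; first by rewrite p1 p2.
  rewrite pair_val_act //; last exact: circle_conj.
  by rewrite circle_mulV // le_incl1 lie_mulg1.
case: y => l' k' /= [ml' mk' [pl pk]].
have [z cz ->] := gb_torsor gM ml ml' pl.
have [w cw ->] := gb_torsor gN mk mk' pk.
rewrite pair_val_act // -[RHS]lie_mulg1 => /lie_mulgI.
rewrite -le_incl1 => /(le_incl_inj (circle_mul cz cw) (@circle1 R)) zw.
exists z => //; congr (_, bu_act k _).
by rewrite -[LHS]mul1r -(circle_Vmul cz) -mulrA zw mulr1.
Qed.

Lemma tensor_mem l k : fa_mem M i l -> fa_mem N i k ->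
  fa_mem (tensor_bundle M N) i (tensor_elt l k).
Proof. by move=> ml mk; exists (l, k). Qed.

Lemma tensor_elim x : fa_mem (tensor_bundle M N) i x ->
  exists l k, [/\ fa_mem M i l, fa_mem N i k & x = tensor_elt l k].
Proof. by move=> [[l k] [/= ml mk] <-]; exists l, k. Qed.

Lemma tensor_act l k z : fa_mem M i l -> circle z ->
  @bu_act _ _ _ (tensor_bundle M N) (tensor_elt l k) z = tensor_elt (bu_act l z) k.
Proof.
move=> ml cz; have [m1 p1 v1] := gb_act gM ml cz.
rewrite /tensor_elt /= p1; congr pair; apply/seteqP; split=> y.
  move=> [y' [w cw ->] <-] /=; exists w => //.
  by rewrite !(gb_actA gM) // mulrC.
move=> [w cw ->] /=; exists (bu_act l w, bu_act k (conjc w)); first by exists w.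
by rewrite /= !(gb_actA gM) // mulrC.
Qed.

Lemma tensor_val_elt l k : fa_mem M i l -> fa_mem N i k ->
  tensor_val (tensor_elt l k) = pair_val (l, k).
Proof.
move=> ml mk; apply: rep_valE; last by move=> y /(tensor_orbitP _ ml mk) [].
by apply/tensor_orbitP.
Qed.

Lemma tensor_memP x : fa_mem (tensor_bundle M N) i x ->
  (exists y, x.2 y) /\ forall y, x.2 y <->
  [/\ fa_mem M i y.1, fa_mem N i y.2, x.1 = (bu_proj y.1, bu_proj y.2)
    & pair_val y = tensor_val x].
Proof.
move=> [[l k] [/= ml mk] <-]; rewrite tensor_val_elt //; split.
  by exists (l, k); apply/tensor_orbitP.
by move=> y; exact: tensor_orbitP.
Qed.

Lemma graded_tensor :
  graded_bundle (M := tensor_bundle M N) i [set p | D p.1 /\ D' p.2]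
    (fun p => pinv (rho p.1) **p kappa' p.2 **p rho p.1 **p kappa p.1) tensor_val.
Proof.
split.
- move=> _ [[l k] [/= ml mk] <-]; rewrite tensor_val_elt //=.
  have [Dl pl] := gb_proj gM ml; have [Dk pk] := gb_proj gN mk; split=> //.
  by rewrite /pair_val twist_proj /= ?pl ?pk //; apply: rho_path.
- move=> [p q] [/= /(gb_inhabited gM) [l ml <-] /(gb_inhabited gN) [k mk <-]].
  by exists (tensor_elt l k) => //; exact: tensor_mem.
- move=> x x' mx mx' /= pp vv; have [_ hx] := tensor_memP mx.
  have [_ hx'] := tensor_memP mx'; rewrite [x]surjective_pairing [x']surjective_pairing.
  rewrite pp; congr pair; apply/seteqP; split=> y.
    by move/hx => [? ? py vy]; apply/hx'; split; congruence.
  by move/hx' => [? ? py vy]; apply/hx; split; congruence.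
- move=> x z /tensor_elim [l [k [ml mk ->]]] cz; have [m1 p1 v1] := gb_act gM ml cz.
  rewrite tensor_act //; split; [exact: tensor_mem | by rewrite /= p1|].
  rewrite !tensor_val_elt // -{1}(gb_act1 gN mk).
  by rewrite pair_val_act ?mulr1 //; exact: circle1.
Qed.
End Tensor.
End GradedBundles.

(** * Graded bundle gerbes *)

Section GradedGerbes.
Variables (R : realType) (G : lie_group R) (B : lie_alg G -> lie_alg G -> R).
Variable L : level1_extension B.
Local Notation "x ** y" := (@lie_mul R L x y) (at level 40, left associativity).
Local Notation inv := (@lie_inv R L).
Local Notation "p **p q" := (@path_mul R G p q) (at level 40, left associativity).
Local Notation pinv := (@path_inv R G).

(** A functor from the groupoid of a bundle gerbe to the crossed module: a path
    for each point and an element of the central extension for each element of the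
    U(1)-bundle. *)
Record grading (I : Type) (A : gerbe R I) := Grading {
  gr_path : pts A -> R -> G;
  gr_lift : elts A -> L }.

Definition difference (P P' : Type) (K : P -> R -> G) (K' : P' -> R -> G)
    (x : P * P') : R -> G := pinv (K x.1) **p K' x.2.

Definition pt (I : Type) (A : gerbe R I) (i : I) : set (pts A) := fa_mem (ge_fam A) i.
Definition el (I : Type) (A : gerbe R I) (i : I) : set (elts A) := fa_mem (ge_bundle A) i.

Record graded_gerbe (I : Type) (i : I) (A : gerbe R I) (g : grading A) : Prop :=
GradedGerbe {
  gg_inhabited : exists a : pts A, pt i a;
  gg_path : forall a : pts A, pt i a -> is_path (gr_path g a);
  gg_bundle : graded_bundle (M := ge_bundle A) i
    [set x : pts A * pts A | pt i x.1 /\ pt i x.2]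
    (difference (gr_path g) (gr_path g)) (gr_lift g);
  gg_mul : forall e e' : elts A, el i e -> el i e' -> tgt e = src e' ->
    [/\ el i (ge_mul e' e : elts A), src (ge_mul e' e : elts A) = src e,
        tgt (ge_mul e' e : elts A) = tgt e'
      & gr_lift g (ge_mul e' e) = gr_lift g e ** gr_lift g e'] }.

Section Gerbe.
Variables (I : Type) (i : I) (A : gerbe R I) (g : grading A).
Hypothesis gA : graded_gerbe i g.
Local Notation K := (gr_path g).
Local Notation F := (gr_lift g).

Lemma el_ends (e : elts A) : el i e ->
  [/\ pt i (src e), pt i (tgt e) & le_proj (F e) = pinv (K (src e)) **p K (tgt e)].
Proof. by move=> /(gb_proj (gg_bundle gA)) [[]]. Qed.

Lemma el_full (a b : pts A) x : pt i a -> pt i b -> le_proj x = pinv (K a) **p K b ->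
  exists e : elts A, [/\ el i e, src e = a, tgt e = b & F e = x].
Proof.
move=> ma mb px.
have [//|e [me pe Fe]] := @gb_full _ _ _ _ _ _ _ _ _ _ _ (gg_bundle gA) (a, b) x _ px.
by exists e; rewrite /src /tgt pe.
Qed.

Lemma el_inj (e e' : elts A) : el i e -> el i e' -> src e = src e' ->
  tgt e = tgt e' -> F e = F e' -> e = e'.
Proof.
move=> me me' es et; apply: (gb_inj (gg_bundle gA)) => //.
by rewrite [LHS]surjective_pairing [RHS]surjective_pairing; congr pair.
Qed.

(** Units are the idempotents, and the only idempotent of a group is 1. *)
Lemma unitP (e : elts A) :
  is_unit i e <-> [/\ el i e, src e = tgt e & F e = lie_one L].
Proof.
split=> [[me se ee]|[me se Fe]]; split=> //.
  have [_ _ _ h] := gg_mul gA me me (esym se).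
  by apply: (@lie_mulgI R L (F e)); rewrite -h ee lie_mulg1.
have [m1 s1 t1 F1] := gg_mul gA me me (esym se).
by apply: el_inj => //; rewrite F1 Fe lie_mulg1.
Qed.

Lemma mul_act (e e' : elts A) z w : el i e -> el i e' -> tgt e = src e' ->
  circle z -> circle w ->
  ge_mul (bu_act e' w) (bu_act e z) = bu_act (ge_mul e' e) (z * w).
Proof.
move=> me me' te cz cw; have [m1 p1 v1] := gb_act (gg_bundle gA) me cz.
have [m2 p2 v2] := gb_act (gg_bundle gA) me' cw.
have [m3 s3 t3 v3] := gg_mul gA me me' te.
have [m4 p4 v4] := gb_act (gg_bundle gA) m3 (circle_mul cz cw).
have t12 : tgt (bu_act e z : elts A) = src (bu_act e' w : elts A).
  by rewrite /tgt /src p1 p2.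
have [m5 s5 t5 v5] := gg_mul gA m1 m2 t12.
apply: el_inj => //.
- by rewrite s5 [RHS]/src p4 -/(src (ge_mul e' e : elts A)) s3 /src p1.
- by rewrite t5 [RHS]/tgt p4 -/(tgt (ge_mul e' e : elts A)) t3 /tgt p2.
- rewrite v5 v4 v1 v2 v3 le_inclM // -!lie_mulA; congr (_ ** _).
  by rewrite !lie_mulA le_incl_central.
Qed.

Lemma unit_at (a : pts A) : pt i a ->
  exists e : elts A, [/\ is_unit i e, el i e, src e = a, tgt e = a & F e = lie_one L].
Proof.
move=> ma.
have [|e [me se te Fe]] := @el_full a a (lie_one L) ma ma.
  by rewrite le_proj1 path_mulVg.
by exists e; split=> //; apply/unitP; split=> //; rewrite se te.
Qed.
End Gerbe.

Definition pull_grading (I J : Type) (f : J -> I) (A : gerbe R I) (g : grading A) :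
  grading (pull_gerbe f A) := @Grading J (pull_gerbe f A) (gr_path g) (gr_lift g).

Lemma graded_pull_gerbe (I J : Type) (f : J -> I) (j : J) (A : gerbe R I)
    (g : grading A) :
  graded_gerbe (f j) g -> graded_gerbe j (pull_grading f g).
Proof.
case=> h1 h2 h3 h4; split=> //.
exact: (@graded_pull _ _ _ L I J _ f j (ge_bundle A)).
Qed.

(** ** Tensor products *)

(** Shared by bundle gerbes and stable isomorphisms: in both cases the base points
    of the factors are pairs, which the tensor product regroups. *)
Lemma graded_tensor_square (I P P' Q Q' : Type) (i : I) (M : bundle R I (P * P'))
    (N : bundle R I (Q * Q')) (D : set P) (D' : set P') (C : set Q) (C' : set Q')
    (K : P -> R -> G) (K' : P' -> R -> G) (H : Q -> R -> G) (H' : Q' -> R -> G)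
    (phi : fa_sort M -> L) (psi : fa_sort N -> L) :
  (forall p, D p -> is_path (K p)) ->
  graded_bundle (M := M) i [set x | D x.1 /\ D' x.2] (difference K K') phi ->
  graded_bundle (M := N) i [set x | C x.1 /\ C' x.2] (difference H H') psi ->
  graded_bundle (M := rename_bundle (@middle_swap _ _ _ _) (tensor_bundle M N)) i
    [set x | (D x.1.1 /\ C x.1.2) /\ (D' x.2.1 /\ C' x.2.2)]
    (difference (fun x => H x.2 **p K x.1) (fun x => H' x.2 **p K' x.1))
    (tensor_val phi psi (fun x => K x.1)).
Proof.
move=> pK gM gN; apply: graded_rename; last first.
- by apply: graded_tensor gM gN _ => p [/pK].
- by move=> p _; rewrite /difference /= path_invM -!path_mulA path_mulVKg.
- apply/seteqP; split=> [[[a b] [c d]] /= [[? ?] [? ?]]|_ [[[a b] [c d]] /= [[? ?] [? ?]] <-]] //.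
  by exists ((a, c), (b, d)).
- by move=> [[a b] [c d]] [[a' b'] [c' d']] [-> -> -> ->].
Qed.

Definition tensor_grading (I : Type) (A C : gerbe R I) (gA : grading A) (gC : grading C) :
    grading (tensor_gerbe A C) :=
  @Grading I (tensor_gerbe A C) (fun y => gr_path gC y.2 **p gr_path gA y.1)
    (@tensor_val _ _ _ _ _ _ _ (ge_bundle A) (ge_bundle C) (gr_lift gA) (gr_lift gC)
       (fun x => gr_path gA x.1)).

Section TensorGerbe.
Variables (I : Type) (i : I) (A C : gerbe R I) (gA : grading A) (gC : grading C).
Hypothesis hA : graded_gerbe i gA.
Hypothesis hC : graded_gerbe i gC.
Local Notation tensor_lift := (gr_lift (tensor_grading gA gC)).

Lemma tensor_rho p : [set x : pts A * pts A | pt i x.1 /\ pt i x.2] p ->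
  is_path (gr_path gA p.1).
Proof. by move=> [/(gg_path hA)]. Qed.

Lemma tensor_el_memP (x : elts (tensor_gerbe A C)) : el i x ->
  (exists y, x.2 y) /\ forall y, x.2 y <->
  [/\ el i (y.1 : elts A), el i (y.2 : elts C), x.1 = (bu_proj y.1, bu_proj y.2)
    & twist (gr_path gA (src (y.1 : elts A))) (gr_lift gA y.1) (gr_lift gC y.2)
      = tensor_lift x].
Proof. exact: (tensor_memP (gg_bundle hA) (gg_bundle hC) tensor_rho). Qed.

Lemma tensP (a : elts A) (c : elts C) : el i a -> el i c ->
  [/\ el i (tens a c), src (tens a c) = (src a, src c), tgt (tens a c) = (tgt a, tgt c)
    & tensor_lift (tens a c) = twist (gr_path gA (src a)) (gr_lift gA a) (gr_lift gC c)].
Proof.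
move=> ma mc; split=> //; first by exists (a, c).
exact: (tensor_val_elt (gg_bundle hA) (gg_bundle hC) tensor_rho).
Qed.

Lemma tens_elim (x : elts (tensor_gerbe A C)) : el i x ->
  exists (a : elts A) (c : elts C), [/\ el i a, el i c & x = tens a c].
Proof. by move=> [[a c] [/= ma mc] <-]; exists a, c. Qed.

Lemma tens_mul (a a' : elts A) (c c' : elts C) : el i a -> el i a' -> el i c ->
  el i c' -> tgt a = src a' -> tgt c = src c' ->
  @ge_mul _ _ (tensor_gerbe A C) (tens a' c') (tens a c) =
  tens (ge_mul a' a : elts A) (ge_mul c' c : elts C).
Proof.
move=> ma ma' mc mc' ta tc.
have [_ s1 t1 _] := gg_mul hA ma ma' ta; have [_ s2 t2 _] := gg_mul hC mc mc' tc.
rewrite [RHS]surjective_pairing; congr pair.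
  rewrite /tens /tensor_elt /=; congr pair; rewrite [RHS]surjective_pairing;
    by congr pair.
apply/seteqP; split=> [_ [_ [_ [[w cw ->] [z cz ->] ->]]]|_ [z cz ->]] /=.
  exists (z * w); first exact: circle_mul.
  by rewrite (mul_act hA) // (mul_act hC) ?rmorphM //; exact: circle_conj.
(* the scalar z is put on the first factor, 1 on the second *)
have [w [cw w1]] : exists w : R[i], circle w /\ w = 1 by exists 1; split=> //; exact: circle1.
exists (bu_act a' w, bu_act c' (conjc w)), (bu_act a z, bu_act c (conjc z)).
split=> /=; [by exists w | by exists z|].
rewrite (mul_act hA) // (mul_act hC) //; try exact: circle_conj.
by rewrite -rmorphM w1 mulr1.
Qed.

(** That lifts multiply along composable elements is the interchange law twist_mul.
    *)
Lemma graded_tensor_gerbe : graded_gerbe i (tensor_grading gA gC).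
Proof.
split.
- have [a ma] := gg_inhabited hA; have [c mc] := gg_inhabited hC.
  by exists (a, c).
- move=> y [/= my1 my2]; apply: is_path_mul; [exact: gg_path hC _ _ | exact: gg_path hA _ _].
- exact: (graded_tensor_square (@gg_path _ _ _ _ hA) (gg_bundle hA) (gg_bundle hC)).
- move=> x x' /tens_elim [a [c [ma mc ->]]] /tens_elim [a' [c' [ma' mc' ->]]].
  have [mt st tt Ft] := tensP ma mc; have [mt' st' tt' Ft'] := tensP ma' mc'.
  rewrite tt st' => -[ta tc]; rewrite tens_mul //.
  have [m1 s1 t1 F1] := gg_mul hA ma ma' ta.
  have [m2 s2 t2 F2] := gg_mul hC mc mc' tc.
  have [mm -> -> ->] := tensP m1 m2; split=> //; first by rewrite s1 s2 st.
    by rewrite t1 t2 tt'.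
  have [pa pa' la] := el_ends hA ma.
  rewrite Ft Ft' s1 F1 F2 -ta; apply: twist_mul => //; exact: gg_path hA _ _.
Qed.
End TensorGerbe.

Lemma tensor_elP (I : Type) (i : I) (A C : gerbe R I) (gA : grading A)
    (gC : grading C) (e : elts (tensor_gerbe A C)) (a : elts A) (c : elts C) :
  graded_gerbe i gA -> graded_gerbe i gC -> el i e -> e.2 (a, c) ->
  [/\ el i a /\ el i c, src e = (src a, src c), tgt e = (tgt a, tgt c)
    & gr_lift (tensor_grading gA gC) e
      = twist (gr_path gA (src a)) (gr_lift gA a) (gr_lift gC c)].
Proof.
move=> hA hC me /((tensor_el_memP hA hC me).2 (a, c)) [ma mc p <-].
by rewrite /src /tgt /= p.
Qed.

Definition induced_grading (I : Type) (A : gerbe R I) (Z : Defs.family R I)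
    (f : fa_sort Z -> pts A) (g : grading A) : grading (induced_gerbe f) :=
  @Grading I (induced_gerbe f) (fun z => gr_path g (f z)) (fun x => gr_lift g x.2).

Lemma graded_induced (I : Type) (i : I) (A : gerbe R I) (Z : Defs.family R I)
    (f : fa_sort Z -> pts A) (g : grading A) :
  graded_gerbe i g -> (exists z, fa_mem Z i z) ->
  (forall z, fa_mem Z i z -> pt i (f z)) ->
  graded_gerbe i (induced_grading f g).
Proof.
move=> gA Zi Zf; split=> //; first by move=> z /Zf /(gg_path gA).
- split.
  + move=> [[z z'] e] /= [[[/= mz mz'] me] pe]; split=> //.
    by have [_ _ ->] := el_ends gA me; rewrite /src /tgt pe.
  + move=> [z z'] [/= mz mz'].
    have [e me pe] := gb_inhabited (gg_bundle gA) (conj (Zf _ mz) (Zf _ mz') : [set x : pts A * pts A | pt i x.1 /\ pt i x.2] (f z, f z')).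
    by exists ((z, z'), e).
  + move=> [zz e] [zz' e'] /= [[_ me] pe] [[_ me'] pe'] /= zE; move: pe pe'.
    rewrite -{}zE => pe pe' /= Fe; congr pair; apply: (gb_inj (gg_bundle gA)) => //.
    exact: etrans pe (esym pe').
  + move=> [zz e] z [/= [mz me] pe] cz; have [m1 p1 v1] := gb_act (gg_bundle gA) me cz.
    by split=> //=; split=> //=; rewrite p1.
- move=> [[z z'] e] [[y y'] e'] /= [[[/= mz mz'] me] pe] [[[/= my my'] me'] pe'].
  rewrite /src /tgt /= => zy.
  have te : tgt (e : elts A) = src (e' : elts A) by rewrite /src /tgt pe pe' /= zy.
  have [m1 s1 t1 v1] := gg_mul gA me me' te; split=> //; split=> //=.
  rewrite [LHS]surjective_pairing; congr pair.
    by rewrite -[LHS]/(src (ge_mul e' e : elts A)) s1 /src pe.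
  by rewrite -[LHS]/(tgt (ge_mul e' e : elts A)) t1 /tgt pe'.
Qed.

(** ** Morphisms *)

(** Over each point of the source, the graph of a morphism to a graded gerbe is
    determined by its values on points as soon as it preserves the gradings. *)
Record graded_map (I : Type) (i : I) (A C : gerbe R I) (gA : grading A)
    (gC : grading C) (f : gerbe_map A C) : Prop := GradedMap {
  gm_pt : forall a : pts A, pt i a ->
    pt i (gm_fun f a) /\ gr_path gC (gm_fun f a) = gr_path gA a;
  gm_el : forall e e', el i e -> gm_graph f e e' <->
    [/\ el i e', src e' = gm_fun f (src e), tgt e' = gm_fun f (tgt e)
      & gr_lift gC e' = gr_lift gA e] }.

Section Maps.
Variables (I : Type) (i : I).

(** Ends and lift determine an element of a graded gerbe, so an element with the
    prescribed ends and lift must be the one in the graph. *)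
Lemma graded_mapP (A C : gerbe R I) (gA : grading A) (gC : grading C)
    (f : gerbe_map A C) :
  graded_gerbe i gC ->
  (forall a : pts A, pt i a ->
    pt i (gm_fun f a) /\ gr_path gC (gm_fun f a) = gr_path gA a) ->
  (forall e, el i e -> (exists e', gm_graph f e e') /\
    forall e', gm_graph f e e' ->
    [/\ el i e', src e' = gm_fun f (src e), tgt e' = gm_fun f (tgt e)
      & gr_lift gC e' = gr_lift gA e]) ->
  graded_map i gA gC f.
Proof.
move=> hC hp he; split=> // e e' me; have [[e1 ge1] h] := he e me.
split=> [/h //|[m' s' t' v']]; have [m1 s1 t1 v1] := h _ ge1.
suff -> : e' = e1 by [].
by apply: (el_inj hC) => //; congruence.
Qed.

Section Map.
Variables (A C : gerbe R I) (gA : grading A) (gC : grading C) (f : gerbe_map A C).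
Hypothesis hA : graded_gerbe i gA.
Hypothesis hC : graded_gerbe i gC.
Hypothesis gf : graded_map i gA gC f.

Lemma gm_total e : el i e -> exists2 e', gm_graph f e e' &
  [/\ el i e', src e' = gm_fun f (src e), tgt e' = gm_fun f (tgt e)
    & gr_lift gC e' = gr_lift gA e].
Proof.
move=> me; have [ms mt l] := el_ends hA me.
have [ms' ps'] := gm_pt gf ms; have [mt' pt'] := gm_pt gf mt.
have [|e' [me' se' te' ve']] := el_full hC ms' mt' (x := gr_lift gA e).
  by rewrite ps' pt'.
by exists e' => //; apply/(gm_el gf).
Qed.

Lemma gm_functional e e' e'' : el i e -> gm_graph f e e' -> gm_graph f e e'' -> e' = e''.
Proof.
move=> me /(gm_el gf e' me) [m1 s1 t1 v1] /(gm_el gf e'' me) [m2 s2 t2 v2].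
by apply: (el_inj hC) => //; congruence.
Qed.

Lemma gm_act e e' z : el i e -> circle z -> gm_graph f e e' ->
  gm_graph f (bu_act e z) (bu_act e' z).
Proof.
move=> me cz /(gm_el gf e' me) [m1 s1 t1 v1].
have [m2 p2 v2] := gb_act (gg_bundle hA) me cz.
have [m3 p3 v3] := gb_act (gg_bundle hC) m1 cz.
apply/(gm_el gf) => //; split=> //.
- by rewrite /src p2 p3.
- by rewrite /tgt p2 p3.
- by rewrite v2 v3 v1.
Qed.
End Map.

Lemma graded_id_map (A : gerbe R I) (gA : grading A) :
  graded_gerbe i gA -> graded_map i gA gA (id_map A).
Proof.
move=> hA; apply: graded_mapP => // e me; split; first by exists e.
by rewrite /gm_graph /id_map => e' <-; split.
Qed.

Lemma graded_comp_map (A C D : gerbe R I) (gA : grading A) (gC : grading C)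
    (gD : grading D) (f : gerbe_map A C) (h : gerbe_map C D) :
  graded_gerbe i gC -> graded_gerbe i gD ->
  graded_map i gA gC f -> graded_map i gC gD h -> graded_gerbe i gA ->
  graded_map i gA gD (comp_map f h).
Proof.
move=> hC hD gf gh hA; apply: graded_mapP => //.
  move=> a ma; have [m1 p1] := gm_pt gf ma; have [m2 p2] := gm_pt gh m1.
  by split=> //=; rewrite p2.
move=> e me; split.
  have [e' he' [me' _ _ _]] := gm_total hA hC gf me.
  by have [e'' he'' _] := gm_total hC hD gh me'; exists e'', e'.
move=> e'' [e' /(gm_el gf) -/(_ me) [me' s' t' v'] /(gm_el gh) -/(_ me')].
by move=> [m'' s'' t'' v'']; split=> //=; congruence.
Qed.

Lemma graded_pull_map (J : Type) (f : J -> I) (j : J) (A C : gerbe R I)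
    (gA : grading A) (gC : grading C) (h : gerbe_map A C) :
  graded_map (f j) gA gC h ->
  graded_map j (pull_grading f gA) (pull_grading f gC) (pull_map f h).
Proof. by case=> h1 h2; split. Qed.

Lemma graded_tensor_map (A C A' C' : gerbe R I) (gA : grading A) (gC : grading C)
    (gA' : grading A') (gC' : grading C') (f : gerbe_map A A') (h : gerbe_map C C') :
  graded_gerbe i gA -> graded_gerbe i gC -> graded_gerbe i gA' -> graded_gerbe i gC' ->
  graded_map i gA gA' f -> graded_map i gC gC' h ->
  graded_map i (tensor_grading gA gC) (tensor_grading gA' gC') (tensor_map f h).
Proof.
move=> hA hC hA' hC' gf gh; have hT := graded_tensor_gerbe hA' hC'.
have hp : forall a : pts (tensor_gerbe A C), pt i a ->
    pt i (gm_fun (tensor_map f h) a) /\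
    gr_path (tensor_grading gA' gC') (gm_fun (tensor_map f h) a) =
    gr_path (tensor_grading gA gC) a.
  move=> a [/= /(gm_pt gf) [m1 p1] /(gm_pt gh) [m2 p2]].
  by split=> //=; rewrite p1 p2.
apply: graded_mapP => // e me; have [a [c [ma mc eE]]] := tens_elim me.
have [pa pa' la] := el_ends hA ma; have [pc pc' lc] := el_ends hC mc.
have [_ s t v] := tensP hA hC ma mc.
have [a' ga' [ma' sa' ta' va']] := gm_total hA hA' gf ma.
have [c' gc' [mc' sc' tc' vc']] := gm_total hC hC' gh mc.
have [mt' st' tt' vt'] := tensP hA' hC' ma' mc'.
have E e' : gm_graph (tensor_map f h) e e' <-> e' = tens a' c'.
  rewrite /gm_graph /= eE.
  have -> : e' = tens a' c' <-> e'.1 = (tens a' c').1 /\ e'.2 = (tens a' c').2.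
    by split=> [->//|[e1 e2]]; rewrite [e']surjective_pairing e1 e2.
  have -> : (tens a' c').1 = ((gm_fun f (src a), gm_fun f (tgt a)),
                              (gm_fun h (src c), gm_fun h (tgt c))).
    by rewrite -sa' -ta' -sc' -tc' /src /tgt -!surjective_pairing.
  suff -> : [set b | exists y, [/\ (tens a c).2 y, gm_graph f y.1 b.1
      & gm_graph h y.2 b.2]] = (tens a' c').2 by [].
  apply/seteqP; split=> [b [_ [[z cz ->] /= g1 g2]]|_ [z cz ->]].
    have cz' := circle_conj cz; exists z => //; rewrite [b]surjective_pairing.
    have [m1 _ _] := gb_act (gg_bundle hA) ma cz.
    have [m2 _ _] := gb_act (gg_bundle hC) mc cz'.
    congr pair.
      by apply: (gm_functional hA' gf m1 g1); apply: (gm_act hA hA').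
    by apply: (gm_functional hC' gh m2 g2); apply: (gm_act hC hC').
  have cz' := circle_conj cz; exists (bu_act a z, bu_act c (conjc z)).
  by split=> /=; [exists z | apply: (gm_act hA hA') | apply: (gm_act hC hC')].
split; first by exists (tens a' c'); apply/E.
move=> e' /E ->; rewrite st' tt' vt' eE s t v sa' sc' ta' tc' va' vc'.
by split=> //; have [_ ->] := gm_pt gf pa.
Qed.

(** Associativity of the crossed module, twist_assoc, compares the two lifts. *)
Lemma graded_tensor_assoc (A C D : gerbe R I) (gA : grading A) (gC : grading C)
    (gD : grading D) :
  graded_gerbe i gA -> graded_gerbe i gC -> graded_gerbe i gD ->
  graded_map i (tensor_grading (tensor_grading gA gC) gD)
    (tensor_grading gA (tensor_grading gC gD)) (tensor_assoc A C D).
Proof.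
move=> hA hC hD; have hAC := graded_tensor_gerbe hA hC.
have hCD := graded_tensor_gerbe hC hD.
apply: graded_mapP (graded_tensor_gerbe hA hCD) _ _.
  by move=> y [[m1 m2] m3]; split; [split | rewrite /= path_mulA].
move=> e me; have [[[ac d] ead] _] := tensor_el_memP hAC hD me.
have [[mac _] _ _ _] := tensor_elP hAC hD me ead.
have [[[a c] eac] _] := tensor_el_memP hA hC mac.
split; first by exists (tens a (tens c d)), ac, a, c, d.
move=> e' [ac' [a' [c' [d' [h1 h2 ->]]]]].
have [[mac' md] s1 t1 v1] := tensor_elP hAC hD me h1.
have [[ma mc] s2 t2 v2] := tensor_elP hA hC mac' h2.
have [m3 s3 t3 v3] := tensP hC hD mc md.
have [m4 s4 t4 v4] := tensP hA hCD ma m3.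
rewrite s4 t4 s3 t3 s1 t1 s2 t2 v4 v1 v2 v3 s2; split=> //.
have [pa _ _] := el_ends hA ma; have [pc _ _] := el_ends hC mc.
by rewrite twist_assoc //; [exact: gg_path hA _ pa | exact: gg_path hC _ pc].
Qed.

Lemma graded_tensor_assoc_inv (A C D : gerbe R I) (gA : grading A) (gC : grading C)
    (gD : grading D) :
  graded_gerbe i gA -> graded_gerbe i gC -> graded_gerbe i gD ->
  graded_map i (tensor_grading gA (tensor_grading gC gD))
    (tensor_grading (tensor_grading gA gC) gD) (tensor_assoc_inv A C D).
Proof.
move=> hA hC hD; have hAC := graded_tensor_gerbe hA hC.
have hCD := graded_tensor_gerbe hC hD.
apply: graded_mapP (graded_tensor_gerbe hAC hD) _ _.
  by move=> y [m1 [m2 m3]]; split; [split | rewrite /= path_mulA].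
move=> e me; have [[[a cd] ead] _] := tensor_el_memP hA hCD me.
have [[_ mcd] _ _ _] := tensor_elP hA hCD me ead.
have [[[c d] ecd] _] := tensor_el_memP hC hD mcd.
split; first by exists (tens (tens a c) d), a, cd, c, d.
move=> e' [a' [cd' [c' [d' [h1 h2 ->]]]]].
have [[ma mcd'] s1 t1 v1] := tensor_elP hA hCD me h1.
have [[mc md] s2 t2 v2] := tensor_elP hC hD mcd' h2.
have [m3 s3 t3 v3] := tensP hA hC ma mc.
have [m4 s4 t4 v4] := tensP hAC hD m3 md.
rewrite s4 t4 s3 t3 s1 t1 s2 t2 v4 v1 v2 v3 s3; split=> //.
have [pa _ _] := el_ends hA ma; have [pc _ _] := el_ends hC mc.
by rewrite twist_assoc //; [exact: gg_path hA _ pa | exact: gg_path hC _ pc].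
Qed.
End Maps.
End GradedGerbes.

(** * Graded stable isomorphisms *)

Section GradedStable.
Variables (R : realType) (G : lie_group R) (B : lie_alg G -> lie_alg G -> R).
Variable L : level1_extension B.
Local Notation "x ** y" := (@lie_mul R L x y) (at level 40, left associativity).
Local Notation inv := (@lie_inv R L).
Local Notation "p **p q" := (@path_mul R G p q) (at level 40, left associativity).
Local Notation pinv := (@path_inv R G).
Local Notation grading := (@grading R G B L _).

(** A stable isomorphism is a natural transformation between the functors to the
    crossed module: phi gives its components, and tau holds when the naturality
    square commutes. *)
Record graded_stable (I : Type) (i : I) (A C : gerbe R I) (gA : grading A)
    (gC : grading C) (s : stable A C) (phi : st_elts s -> L) : Prop := GradedStable {
  gs_bundle : graded_bundle (M := st_bundle s) i
    [set x : pts A * pts C | pt i x.1 /\ pt i x.2]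
    (difference (gr_path gA) (gr_path gC)) phi;
  gs_graph : forall (l1 l2 : st_elts s) (e : elts A) (f : elts C),
    st_mem i l1 -> st_mem i l2 -> el i e -> el i f ->
    bu_proj l1 = (src e, src f) -> bu_proj l2 = (tgt e, tgt f) ->
    st_graph i l1 l2 e f <-> gr_lift gA e ** phi l2 = phi l1 ** gr_lift gC f }.

Section Stable.
Variables (I : Type) (i : I) (A C : gerbe R I) (gA : grading A) (gC : grading C).
Variables (s : stable A C) (phi : st_elts s -> L).
Hypothesis gs : graded_stable i gA gC phi.

Lemma tauP (l1 l2 : st_elts s) (e : elts A) (f : elts C) : tau i l1 l2 e f <->
  [/\ [/\ st_mem i l1, st_mem i l2, el i e & el i f],
      bu_proj l1 = (src e, src f), bu_proj l2 = (tgt e, tgt f)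
    & gr_lift gA e ** phi l2 = phi l1 ** gr_lift gC f].
Proof.
by split=> [[[m1 m2 m3 m4] p1 p2 h]|[[m1 m2 m3 m4] p1 p2 h]]; split=> //;
  apply/(gs_graph gs).
Qed.

Lemma st_ends (l : st_elts s) : st_mem i l ->
  [/\ pt i (bu_proj l).1, pt i (bu_proj l).2
    & le_proj (phi l) = pinv (gr_path gA (bu_proj l).1) **p gr_path gC (bu_proj l).2].
Proof. by move=> /(gb_proj (gs_bundle gs)) [[]]. Qed.

Lemma st_inj (l l' : st_elts s) : st_mem i l -> st_mem i l' ->
  bu_proj l = bu_proj l' -> phi l = phi l' -> l = l'.
Proof. exact: gb_inj (gs_bundle gs) _ _. Qed.

Lemma st_full (x : pts A * pts C) v : pt i x.1 -> pt i x.2 ->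
  le_proj v = pinv (gr_path gA x.1) **p gr_path gC x.2 ->
  exists l : st_elts s, [/\ st_mem i l, bu_proj l = x & phi l = v].
Proof. by move=> m1 m2; apply: (gb_full (gs_bundle gs)). Qed.

(** Stable isomorphisms between the same graded gerbes have the same fibres.
    Elements of intermediate stable isomorphisms are produced in this way. *)
Lemma st_transport (s' : stable A C) (phi' : st_elts s' -> L) (l' : st_elts s') :
  graded_stable i gA gC phi' -> st_mem i l' ->
  exists l : st_elts s, [/\ st_mem i l, bu_proj l = bu_proj l' & phi l = phi' l'].
Proof.
by move=> gs' /(gb_proj (gs_bundle gs')) [[m1 m2] h]; apply: st_full.
Qed.
End Stable.

Definition pull_val (I J : Type) (h : J -> I) (A C : gerbe R I) (s : stable A C)
  (phi : st_elts s -> L) (l : st_elts (pull_stable h s)) : L := phi l.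

Lemma graded_pull_stable (I J : Type) (h : J -> I) (j : J) (A C : gerbe R I)
    (gA : grading A) (gC : grading C) (s : stable A C) (phi : st_elts s -> L) :
  graded_stable (h j) gA gC phi ->
  graded_stable j (pull_grading h gA) (pull_grading h gC) (pull_val (h := h) phi).
Proof. by case=> h1 h2; split=> //; case: h1. Qed.

Section Constructions.
Variables (I : Type) (i : I).

Definition adj_val (A C : gerbe R I) (s : stable A C) (phi : st_elts s -> L)
  (l : st_elts (adjoint_inverse s)) : L := inv (phi l).

(** A naturality square can be read from either side, with its components inverted.
    *)
Lemma graded_adjoint (A C : gerbe R I) (gA : grading A) (gC : grading C)
    (s : stable A C) (phi : st_elts s -> L) :
  graded_stable i gA gC phi ->
  graded_stable i gC gA (adj_val phi).
Proof.
move=> gs; split.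
  apply: graded_rename (graded_dual (gs_bundle gs)).
  - by move=> [a c] [a' c'] [-> ->].
  - apply/seteqP; split=> [[c a] /= [mc ma]|_ [[a c] /= [ma mc] <-]] //.
    by exists (a, c).
  - by move=> [a c] _; rewrite /difference /= path_invM path_invK.
move=> l1 l2 f e m1 m2 mf me p1 p2.
have swapP (x : pts A * pts C) y z : (x.2, x.1) = (y, z) -> x = (z, y).
  by case: x => x1 x2 [-> ->].
apply: (iff_trans (gs_graph gs m1 m2 me mf (swapP _ _ _ p1) (swapP _ _ _ p2))).
split=> h.
  apply: (@lie_mulgI R L (phi l1)); apply: (@lie_mulIg R L (phi l2)).
  by rewrite lie_mulVKg h -!lie_mulA lie_mulVg lie_mulg1.
apply: (@lie_mulgI R L (inv (phi l1))); apply: (@lie_mulIg R L (inv (phi l2))).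
by rewrite lie_mulKg h -!lie_mulA lie_mulgV lie_mulg1.
Qed.

Definition Sigma_val (A C : gerbe R I) (gC : grading C) (f : gerbe_map A C)
  (l : st_elts (Sigma f)) : L := gr_lift gC l.2.

Lemma Sigma_memP (A C : gerbe R I) (f : gerbe_map A C) (l : st_elts (Sigma f)) :
  st_mem i l <->
  [/\ pt i (l.1 : pts A), el i (l.2 : elts C) & src (l.2 : elts C) = gm_fun f l.1].
Proof. by split=> [[[h1 h2] h3]|[h1 h2 h3]]. Qed.

Lemma graded_Sigma (A C : gerbe R I) (gA : grading A) (gC : grading C)
    (f : gerbe_map A C) :
  graded_gerbe i gA -> graded_gerbe i gC -> graded_map i gA gC f ->
  graded_stable i gA gC (@Sigma_val A C gC f).
Proof.
move=> hA hC gf; split; first split.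
- move=> l /Sigma_memP [m1 m2 s2]; have [p1 p2 lp] := el_ends hC m2.
  by rewrite /Sigma_val lp s2; have [_ ->] := gm_pt gf m1.
- move=> [a c] [/= ma mc]; have [mfa pfa] := gm_pt gf ma.
  have [e me pe] := gb_inhabited (gg_bundle hC)
    (conj mfa mc : [set x : pts C * pts C | pt i x.1 /\ pt i x.2] (gm_fun f a, c)).
  exists (a, e); first by apply/Sigma_memP; split=> //; rewrite /src pe.
  by rewrite /= /tgt pe.
- move=> [a e] [a' e'] /Sigma_memP [_ m2 s2] /Sigma_memP [_ m2' s2'] /= [aa te] v.
  by rewrite /= in s2 s2' *; rewrite aa; congr pair; apply: (el_inj hC) => //; rewrite s2 s2' aa.
- move=> [a e] z /Sigma_memP [m1 m2 s2] cz; rewrite /= in m1 m2 s2.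
  have [m3 p3 v3] := gb_act (gg_bundle hC) m2 cz; split.
  + by apply/Sigma_memP; split=> //=; rewrite /src p3.
  + by rewrite /= /tgt p3.
  + exact: v3.
- move=> [a1 b1] [a2 b2] e b /Sigma_memP [ma1 mb1 s1] /Sigma_memP [ma2 mb2 s2].
  move=> me mb /= [ea1 t1] [ea2 t2]; rewrite /= in ma1 mb1 s1 ma2 mb2 s2; rewrite /Sigma_val /=.
  have [e' ge' [me' se' te' ve']] := gm_total hA hC gf me.
  have [n1 u1 w1 v1] := gg_mul hC mb1 mb t1.
  have c2 : tgt e' = src b2 by rewrite te' s2 ea2.
  have [n2 u2 w2 v2] := gg_mul hC me' mb2 c2.
  rewrite -ve' -v1 -v2; split=> [[e'' [_ ge'' ->]]|h].
    by rewrite (gm_functional hC gf me ge'' ge').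
  exists e'; split=> //; apply: (el_inj hC) => //.
    by rewrite u1 u2 s1 se' ea1.
  by rewrite w1 w2 t2.
Qed.

Definition pre_val (A A' C : gerbe R I) (f : gerbe_map A A') (s : stable A' C)
  (phi : st_elts s -> L) (x : st_elts (precompose f s)) : L := phi x.2.

Lemma pre_memP (A A' C : gerbe R I) (f : gerbe_map A A') (s : stable A' C)
    (x : st_elts (precompose f s)) : st_mem i x <->
  [/\ pt i (x.1 : pts A), st_mem i (x.2 : st_elts s)
    & (bu_proj (x.2 : st_elts s)).1 = gm_fun f x.1].
Proof. by split=> [[[h1 h2] h3]|[h1 h2 h3]]. Qed.

Lemma graded_precompose (A A' C : gerbe R I) (gA : grading A) (gA' : grading A')
    (gC : grading C) (f : gerbe_map A A') (s : stable A' C) (phi : st_elts s -> L) :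
  graded_gerbe i gA -> graded_gerbe i gA' -> graded_map i gA gA' f ->
  graded_stable i gA' gC phi ->
  graded_stable i gA gC (@pre_val A A' C f s phi).
Proof.
move=> hA hA' gf gs; split; first split.
- move=> l /pre_memP [m1 m2 s2]; have [p1 p2 lp] := st_ends gs m2.
  by rewrite /pre_val lp s2; have [_ ->] := gm_pt gf m1.
- move=> [a c] [/= ma mc]; have [mfa pfa] := gm_pt gf ma.
  have [e me pe] := gb_inhabited (gs_bundle gs)
    (conj mfa mc : [set x : pts A' * pts C | pt i x.1 /\ pt i x.2] (gm_fun f a, c)).
  exists (a, e); first by apply/pre_memP; split=> //; rewrite pe.
  by rewrite /= pe.
- move=> [a e] [a' e'] /pre_memP [_ m2 s2] /pre_memP [_ m2' s2'] /= [aa te] v.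
  rewrite /= in s2 s2'; rewrite aa; congr pair; apply: (st_inj gs) => //.
  by rewrite [LHS]surjective_pairing [RHS]surjective_pairing s2 s2' aa te.
- move=> [a e] z /pre_memP [m1 m2 s2] cz; rewrite /= in m1 m2 s2.
  have [m3 p3 v3] := gb_act (gs_bundle gs) m2 cz; split.
  + by apply/pre_memP; split=> //=; rewrite p3.
  + by rewrite /= p3.
  + exact: v3.
- move=> [a1 b1] [a2 b2] e b /pre_memP [ma1 mb1 s1] /pre_memP [ma2 mb2 s2].
  move=> me mb /= [ea1 t1] [ea2 t2]; rewrite /= in ma1 mb1 s1 ma2 mb2 s2; rewrite /pre_val /=.
  have [e' ge' [me' se' te' ve']] := gm_total hA hA' gf me.
  rewrite -ve'; split=> [[e'' ge'' /(tauP gs) [_ _ _]]|h].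
    by rewrite (gm_functional hA' gf me ge'' ge').
  exists e' => //; apply/(tauP gs); split=> //.
    by rewrite [LHS]surjective_pairing s1 t1 se' ea1.
  by rewrite [LHS]surjective_pairing s2 t2 te' ea2.
Qed.

(** ** Composites *)

Section Composite.
Variables (A C D : gerbe R I) (gA : grading A) (gC : grading C) (gD : grading D).
Variables (s : stable A C) (t : stable C D).
Variables (phi : st_elts s -> L) (psi : st_elts t -> L).
Hypotheses (hA : graded_gerbe i gA) (hC : graded_gerbe i gC) (hD : graded_gerbe i gD).
Hypotheses (gs : graded_stable i gA gC phi) (gt : graded_stable i gC gD psi).

Definition comp_val (x : st_elts (compose s t)) : L :=
  rep_val x.2 (fun y => phi y.1 ** psi y.2).

Definition composable (y : st_elts s * st_elts t) : Prop :=
  [/\ st_mem i y.1, st_mem i y.2 & (bu_proj y.1).2 = (bu_proj y.2).1].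

(** The descent data moves the middle point along an element f of the middle gerbe,
    which multiplies phi by the lift of f on the right and psi by its inverse on the
    left. The product is the only invariant, since f may have any lift compatible
    with its ends. *)
Lemma descent_classP y y' : composable y -> (descent_class i y).2 y' <->
  [/\ composable y', ((bu_proj y.1).1, (bu_proj y.2).2) =
        ((bu_proj y'.1).1, (bu_proj y'.2).2)
    & phi y'.1 ** psi y'.2 = phi y.1 ** psi y.2].
Proof.
case: y y' => l k [l' k'] [/= ml mk lk]; split.
  move=> [e [f [h [ue uh /(tauP gs) [[_ ml' me mf] p1 p1' t1] /(tauP gt)]]]].
  move=> [[_ mk' _ mh] p2 p2' t2] /=.
  have [_ se ve] := (unitP hA e).1 ue; have [_ sh vh] := (unitP hD h).1 uh.
  split; [by split=> //=; rewrite p1' p2'|by rewrite p1 p1' p2 p2' /= se sh|].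
  move: t1 t2; rewrite ve vh lie_mul1g lie_mulg1 => -> <-.
  by rewrite lie_mulA.
move=> [[/= ml' mk' lk'] [pa pd] v].
have [ma mc lp] := st_ends gs ml; have [ma' mc' lp'] := st_ends gs ml'.
have [mc1 md lq] := st_ends gt mk.
have [e [ue me se te ve]] := unit_at hA ma.
have [h [uh mh sh th vh]] := unit_at hD md.
have [|f [mf sf tf vf]] := el_full hC mc mc' (x := inv (phi l) ** phi l').
  by rewrite le_projM le_projV lp lp' -pa path_invM path_invK -path_mulA path_mulVKg.
exists e, f, h; split=> //=.
  apply/(tauP gs); split=> //.
  - by rewrite [LHS]surjective_pairing se sf.
  - by rewrite [LHS]surjective_pairing te tf pa.
  - by rewrite ve vf lie_mul1g lie_mulVKg.
apply/(tauP gt); split=> //.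
- by rewrite [LHS]surjective_pairing sf sh lk.
- by rewrite [LHS]surjective_pairing tf th pd lk'.
- by rewrite vf vh lie_mulg1 -lie_mulA v lie_mulKg.
Qed.

Lemma descent_class_mem y : composable y ->
  st_mem i (descent_class i y : st_elts (compose s t)).
Proof. by move=> [m1 m2 h]; exists y. Qed.

Lemma comp_val_class y : composable y ->
  comp_val (descent_class i y) = phi y.1 ** psi y.2.
Proof.
move=> cy; rewrite /comp_val (@rep_valE _ _ _ _ _ _ _ y) //.
  by apply/(descent_classP _ cy).
by move=> y' /(descent_classP _ cy) [].
Qed.

Lemma compose_elim (x : st_elts (compose s t)) : st_mem i x ->
  exists2 y, composable y & x = descent_class i y.
Proof. by move=> [y [[m1 m2] h] <-]; exists y. Qed.

Lemma compose_memP (x : st_elts (compose s t)) : st_mem i x ->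
  (exists y, x.2 y) /\ forall y, x.2 y <->
  [/\ composable y, x.1 = ((bu_proj y.1).1, (bu_proj y.2).2)
    & phi y.1 ** psi y.2 = comp_val x].
Proof.
move=> /compose_elim [y cy ->]; rewrite comp_val_class //; split.
  by exists y; apply/descent_classP.
by move=> y'; apply: descent_classP.
Qed.

(** An element of the composite with a given value is obtained by choosing any point
    of the middle gerbe. *)
Lemma graded_compose : graded_stable i gA gD comp_val.
Proof.
split; first split.
- move=> x /compose_elim [[l k] cy ->]; rewrite comp_val_class //=.
  have [ml mk lk] := cy; rewrite /= in ml mk lk.
  have [ma mc lp] := st_ends gs ml; have [mc1 md lq] := st_ends gt mk.
  by rewrite le_projM lp lq /difference /= lk -path_mulA path_mulVKg.
- move=> [a d] [/= ma md]; have [c mc] := gg_inhabited hC.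
  have [l ml pl] := gb_inhabited (gs_bundle gs)
    (conj ma mc : [set x : pts A * pts C | pt i x.1 /\ pt i x.2] (a, c)).
  have [k mk pk] := gb_inhabited (gs_bundle gt)
    (conj mc md : [set x : pts C * pts D | pt i x.1 /\ pt i x.2] (c, d)).
  exists (descent_class i (l, k)); last by rewrite /= pl pk.
  by apply: descent_class_mem; split=> //=; rewrite pl pk.
- move=> x x' mx mx' /= pp vv; have [_ hx] := compose_memP mx.
  have [_ hx'] := compose_memP mx'.
  rewrite [x]surjective_pairing [x']surjective_pairing pp; congr pair.
  apply/seteqP; split=> y.
    by move/hx => [cy py vy]; apply/hx'; split; congruence.
  by move/hx' => [cy py vy]; apply/hx; split; congruence.
- move=> x z /compose_elim [[l k] cy ->] cz; have [ml mk lk] := cy; rewrite /= in ml mk lk.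
  have [m1 p1 v1] := gb_act (gs_bundle gs) ml cz.
  have cy' : composable (bu_act l z, k) by split=> //=; rewrite p1.
  have -> : @bu_act _ _ _ (st_bundle (compose s t)) (descent_class i (l, k)) z =
      descent_class i (bu_act l z, k).
    rewrite [RHS]surjective_pairing; congr pair; first by rewrite /= p1.
    apply/seteqP; split=> [_ [y /(descent_classP _ cy) [[n1 n2 h] py vy] <-]|y].
      have [m2 p2 v2] := gb_act (gs_bundle gs) n1 cz.
      apply/(descent_classP _ cy'); split=> /=.
      - by split=> //=; rewrite p2.
      - by rewrite p1 p2.
      - rewrite v1 v2 -!lie_mulA !le_incl_central // !lie_mulA.
        by congr (_ ** _).
    move=> /(descent_classP _ cy') [[n1 n2 h] /= py vy].
    have cz' := circle_conj cz; have [m2 p2 v2] := gb_act (gs_bundle gs) n1 cz'.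
    exists (bu_act y.1 (conjc z), y.2).
      apply/(descent_classP _ cy); split=> /=.
      - by split=> //=; rewrite p2.
      - by rewrite p2 -py p1.
      - rewrite v2 -lie_mulA le_incl_central // lie_mulA vy v1 -!lie_mulA.
        congr (_ ** _); rewrite le_incl_central // -lie_mulA -le_inclM //.
        by rewrite circle_Vmul // le_incl1 lie_mulg1.
    rewrite /= (gb_actA (gs_bundle gs)) // circle_Vmul // (gb_act1 (gs_bundle gs)) //.
    by rewrite -surjective_pairing.
  split; [exact: descent_class_mem | by rewrite /= p1|].
  rewrite !comp_val_class //= v1 -!lie_mulA; congr (_ ** _).
  by rewrite le_incl_central.
- move=> x x' e h mx mx' me mh px px'; have [[y xy] hx] := compose_memP mx.
  have [[y' xy'] hx'] := compose_memP mx'; split.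
    move=> [z [z' [f [/hx [cz pz <-] /hx' [cz' pz' <-] /(tauP gs) [_ _ _ t1]]]]].
    move=> /(tauP gt) [_ _ _ t2].
    by rewrite lie_mulA t1 -!lie_mulA t2.
  move=> v; have [cy py vy] := (hx y).1 xy; have [cy' py' vy'] := (hx' y').1 xy'.
  have [m1 m2 q] := cy; have [m1' m2' q'] := cy'.
  have [ma mc lp] := st_ends gs m1; have [ma' mc' lp'] := st_ends gs m1'.
  have [_ _ le] := el_ends hA me.
  move: py py'; rewrite -[x.1]/(bu_proj x) -[x'.1]/(bu_proj x') px px'.
  move=> [se sh] [te th].
  have [|f [mf sf tf vf]] := el_full hC mc mc' (x := inv (phi y.1) ** (gr_lift gA e ** phi y'.1)).
    rewrite !le_projM le_projV lp lp' le se te path_invM path_invK -!path_mulA.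
    by rewrite !path_mulVKg.
  exists y, y', f; split=> //.
    apply/(tauP gs); split=> //.
    - by rewrite [LHS]surjective_pairing sf se.
    - by rewrite [LHS]surjective_pairing tf te.
    - by rewrite vf lie_mulVKg.
  apply/(tauP gt); split=> //.
  - by rewrite [LHS]surjective_pairing sf sh q.
  - by rewrite [LHS]surjective_pairing tf th q'.
  - by rewrite vf -!lie_mulA vy' v -vy -!lie_mulA lie_mulKg.
Qed.
End Composite.

(** ** Tensor products of stable isomorphisms *)

Section TensorStable.
Variables (A A' C C' : gerbe R I) (gA : grading A) (gA' : grading A').
Variables (gC : grading C) (gC' : grading C').
Variables (s : stable A A') (t : stable C C').
Variables (phi : st_elts s -> L) (psi : st_elts t -> L).
Hypotheses (hA : graded_gerbe i gA) (hA' : graded_gerbe i gA').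
Hypotheses (hC : graded_gerbe i gC) (hC' : graded_gerbe i gC').
Hypotheses (gs : graded_stable i gA gA' phi) (gt : graded_stable i gC gC' psi).

Definition tens_val (x : st_elts (tensor_stable s t)) : L :=
  @tensor_val _ _ _ _ _ _ _ (st_bundle s) (st_bundle t) phi psi
    (fun x => gr_path gA x.1) x.

Lemma stable_rho p : [set x : pts A * pts A' | pt i x.1 /\ pt i x.2] p ->
  is_path (gr_path gA p.1).
Proof. by move=> [/(gg_path hA)]. Qed.

Lemma tensor_st_memP (x : st_elts (tensor_stable s t)) : st_mem i x ->
  (exists y, x.2 y) /\ forall y, x.2 y <->
  [/\ st_mem i y.1, st_mem i y.2, x.1 = (bu_proj y.1, bu_proj y.2)
    & twist (gr_path gA (bu_proj y.1).1) (phi y.1) (psi y.2) = tens_val x].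
Proof. exact: (tensor_memP (gs_bundle gs) (gs_bundle gt) stable_rho). Qed.

Lemma st_tens_mem l k : st_mem i l -> st_mem i k ->
  st_mem i (tensor_elt l k : st_elts (tensor_stable s t)).
Proof. by move=> ml mk; exists (l, k). Qed.

Lemma tens_val_elt l k : st_mem i l -> st_mem i k ->
  tens_val (tensor_elt l k) = twist (gr_path gA (bu_proj l).1) (phi l) (psi k).
Proof. exact: (tensor_val_elt (gs_bundle gs) (gs_bundle gt) stable_rho). Qed.

(** The naturality square of the tensor product is the horizontal product of the two
    squares, by the interchange law. *)
Lemma graded_tensor_stable :
  graded_stable i (tensor_grading gA gC) (tensor_grading gA' gC') tens_val.
Proof.
split.
  exact: (graded_tensor_square (@gg_path _ _ _ _ _ _ _ _ hA) (gs_bundle gs) (gs_bundle gt)).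
move=> x x' e f mx mx' me mf px px'.
have [[y xy] hx] := tensor_st_memP mx; have [[y' xy'] hx'] := tensor_st_memP mx'.
have [[a ea] he] := tensor_el_memP hA hC me.
have [_ hf] := tensor_el_memP hA' hC' mf.
have combine (z z' : st_elts s * st_elts t) (c : elts A * elts C)
    (d : elts A' * elts C') :
    tau i z.1 z'.1 c.1 d.1 -> tau i z.2 z'.2 c.2 d.2 ->
    twist (gr_path gA (src c.1)) (gr_lift gA c.1) (gr_lift gC c.2) **
      twist (gr_path gA (bu_proj z'.1).1) (phi z'.1) (psi z'.2) =
    twist (gr_path gA (bu_proj z.1).1) (phi z.1) (psi z.2) **
      twist (gr_path gA' (src d.1)) (gr_lift gA' d.1) (gr_lift gC' d.2).
  move=> /(tauP gs) [[mz mz' mc md] p1 p1' t1] /(tauP gt) [_ _ _ t2].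
  have [pc pc' lc] := el_ends hA mc; have [pd pd' ld] := el_ends hA' md.
  have [_ _ lz] := st_ends gs mz.
  have [kc kc' kd] := And3 (gg_path hA pc) (gg_path hA pc') (gg_path hA' pd).
  rewrite p1 p1' /= -(twist_mul _ _ _ kc kc' lc) t1 t2.
  by rewrite -(twist_mul _ _ _ kc kd) // lz p1.
split=> [[z [z' [c [d [[xz xz'] [ec fd] t1 t2]]]]]|v].
  have [_ _ _ <-] := (hx z).1 xz; have [_ _ _ <-] := (hx' z').1 xz'.
  by have [_ _ _ <-] := (he c).1 ec; have [_ _ _ <-] := (hf d).1 fd; exact: combine.
have [m1 m2 q vy] := (hx y).1 xy; have [m1' m2' q' vy'] := (hx' y').1 xy'.
have [n1 n2 qa va] := (he a).1 ea.
(* a representative of f is chosen so that both factors of tau hold *)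
move: px px' mf hf v.
rewrite -[bu_proj x]/(middle_swap x.1) -[bu_proj x']/(middle_swap x'.1) q q'.
case: f => -[[b1 b1'] [b2 b2']] fS px px' mf hf v.
have {px} [sa1 sa2 sb1 sb2] : [/\ (bu_proj y.1).1 = src (a.1 : elts A),
    (bu_proj y.2).1 = src (a.2 : elts C), (bu_proj y.1).2 = b1
  & (bu_proj y.2).2 = b2].
  by move: px; rewrite /src /middle_swap /= qa /= => -[? ? ? ?].
have {px'} [ta1 ta2 tb1 tb2] : [/\ (bu_proj y'.1).1 = tgt (a.1 : elts A),
    (bu_proj y'.2).1 = tgt (a.2 : elts C), (bu_proj y'.1).2 = b1'
  & (bu_proj y'.2).2 = b2'].
  by move: px'; rewrite /tgt /middle_swap /= qa /= => -[? ? ? ?].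
have [pA pA' l1] := st_ends gs m1; have [rA rA' l1'] := st_ends gs m1'.
have [pC pC' l2] := st_ends gt m2; have [rC rC' l2'] := st_ends gt m2'.
have [_ _ k1] := el_ends hA n1; have [_ _ k2] := el_ends hC n2.
have [|d1 [md1 sd1 td1 vd1]] := el_full hA' pA' rA'
  (x := inv (phi y.1) ** (gr_lift gA a.1 ** phi y'.1)).
  rewrite !le_projM le_projV l1 l1' k1 sa1 ta1 path_invM path_invK -!path_mulA.
  by rewrite !path_mulVKg.
have [|d2 [md2 sd2 td2 vd2]] := el_full hC' pC' rC'
  (x := inv (psi y.2) ** (gr_lift gC a.2 ** psi y'.2)).
  rewrite !le_projM le_projV l2 l2' k2 sa2 ta2 path_invM path_invK -!path_mulA.
  by rewrite !path_mulVKg.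
have t1 : tau i y.1 y'.1 a.1 d1.
  apply/(tauP gs); split=> //; last by rewrite vd1 lie_mulVKg.
    by rewrite [LHS]surjective_pairing sd1 sa1.
  by rewrite [LHS]surjective_pairing td1 ta1.
have t2 : tau i y.2 y'.2 a.2 d2.
  apply/(tauP gt); split=> //; last by rewrite vd2 lie_mulVKg.
    by rewrite [LHS]surjective_pairing sd2 sa2.
  by rewrite [LHS]surjective_pairing td2 ta2.
exists y, y', a, (d1, d2); split=> //; split=> //.
apply/hf; split=> //=.
  rewrite [bu_proj d1]surjective_pairing [bu_proj d2]surjective_pairing.
  rewrite -[(bu_proj d1).1]/(src d1) -[(bu_proj d1).2]/(tgt d1).
  rewrite -[(bu_proj d2).1]/(src d2) -[(bu_proj d2).2]/(tgt d2).
  by rewrite sd1 td1 sd2 td2 sb1 sb2 tb1 tb2.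
apply: (@lie_mulgI R L (tens_val x)); rewrite -v -{1}vy -va -vy'.
by rewrite -(combine _ _ _ (d1, d2) t1 t2).
Qed.
End TensorStable.
End Constructions.
End GradedStable.

(** * Graded 2-arrows *)

Section GradedArrows.
Variables (R : realType) (G : lie_group R) (B : lie_alg G -> lie_alg G -> R).
Variable L : level1_extension B.
Local Notation "x ** y" := (@lie_mul R L x y) (at level 40, left associativity).
Local Notation inv := (@lie_inv R L).
Local Notation "p **p q" := (@path_mul R G p q) (at level 40, left associativity).
Local Notation pinv := (@path_inv R G).
Local Notation grading := (@grading R G B L _).
Variables (I : Type) (i : I).

(** In terms of the gradings a graded 2-arrow is the identity, so there is at most
    one; coherence then holds because every structural 2-arrow is graded. *)
Definition graded_arrow (A C : gerbe R I) (s t : stable A C) (phi : st_elts s -> L)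
    (psi : st_elts t -> L) (a : two_arrow s t) : Prop :=
  forall l l', st_mem i l -> st_mem i l' ->
    a i l l' <-> bu_proj l = bu_proj l' /\ phi l = psi l'.

Section Vertical.
Variables (A C : gerbe R I) (gA : grading A) (gC : grading C).
Variables (s t u : stable A C).
Variables (phi : st_elts s -> L) (psi : st_elts t -> L) (chi : st_elts u -> L).

Lemma graded_vid : graded_stable i gA gC phi -> graded_arrow phi phi (vid s).
Proof.
by move=> gs l l' ml ml'; split=> [->//|[p v]]; apply: (st_inj gs).
Qed.

Lemma graded_vcomp (a : two_arrow s t) (b : two_arrow t u) :
  graded_stable i gA gC phi -> graded_stable i gA gC psi ->
  graded_arrow phi psi a -> graded_arrow psi chi b -> graded_arrow phi chi (vcomp a b).
Proof.
move=> gs gt ga gb l l'' ml ml''; split=> [[l' [ml' /(ga _ _ ml ml') [p1 v1]]]|[p v]].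
  by move=> /(gb _ _ ml' ml'') [<- <-].
have [l' [ml' p' v']] := st_transport gt gs ml.
exists l'; split=> //; first by apply/ga.
by apply/gb => //; rewrite p' v'.
Qed.

Lemma graded_vinv (a : two_arrow s t) :
  graded_arrow phi psi a -> graded_arrow psi phi (vinv a).
Proof.
by move=> ga l l' ml ml'; apply: (iff_trans (ga _ _ ml' ml)); split=> -[].
Qed.

Lemma graded_hadjoint (a : two_arrow s t) :
  graded_arrow phi psi a ->
  graded_arrow (adj_val phi) (adj_val psi) (hadjoint a).
Proof.
move=> ga l l' ml ml'; apply: (iff_trans (ga _ _ ml ml')); split=> /= -[p v].
  by rewrite p /adj_val v.
split; last exact: (@lie_invI R L _ _ v).
by case: p => p1 p2; rewrite [LHS]surjective_pairing [RHS]surjective_pairing p1 p2.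
Qed.
End Vertical.

Lemma graded_hprecompose (A A' C : gerbe R I) (f : gerbe_map A A')
    (s t : stable A' C) (phi : st_elts s -> L) (psi : st_elts t -> L)
    (a : two_arrow s t) :
  graded_arrow phi psi a ->
  graded_arrow (@pre_val _ _ _ L I A A' C f s phi) (@pre_val _ _ _ L I A A' C f t psi)
    (hprecompose f a).
Proof.
move=> ga x x' /pre_memP [m1 m2 h] /pre_memP [m1' m2' h'].
have := ga _ _ m2 m2'; rewrite /hprecompose /pre_val /= => gx; split.
  by move=> [-> /gx [-> ->]].
move=> [[p1 p2] v]; split=> //; apply/gx; split=> //.
by rewrite [LHS]surjective_pairing [RHS]surjective_pairing h h' p1 p2.
Qed.

(** ** Composition *)

Section Horizontal.
Variables (A C D : gerbe R I) (gA : grading A) (gC : grading C) (gD : grading D).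
Variables (s s' : stable A C) (t t' : stable C D).
Variables (phi : st_elts s -> L) (phi' : st_elts s' -> L).
Variables (psi : st_elts t -> L) (psi' : st_elts t' -> L).
Hypotheses (hA : graded_gerbe i gA) (hC : graded_gerbe i gC) (hD : graded_gerbe i gD).
Hypotheses (gs : graded_stable i gA gC phi) (gs' : graded_stable i gA gC phi').
Hypotheses (gt : graded_stable i gC gD psi) (gt' : graded_stable i gC gD psi').

(** For the converse, a representative of the first element is transported factor by
    factor to a representative of the second. *)
Lemma graded_hcomp (a : two_arrow s s') (b : two_arrow t t') :
  graded_arrow phi phi' a -> graded_arrow psi psi' b ->
  graded_arrow (comp_val phi psi) (comp_val phi' psi') (hcomp a b).
Proof.
move=> ga gb x x' mx mx'; have [[y xy] hx] := compose_memP hA hC hD gs gt mx.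
have [_ hx'] := compose_memP hA hC hD gs' gt' mx'; split.
  move=> [z [z' [/hx [[m1 m2 q] p <-] /hx' [[m1' m2' q'] p' <-]]]].
  move=> /(ga _ _ m1 m1') [pa va] /(gb _ _ m2 m2') [pb vb].
  by rewrite va vb /= p p' pa pb.
move=> [p v]; have [[m1 m2 q] py vy] := (hx y).1 xy.
have [y1 [n1 p1 v1]] := st_transport gs' gs m1.
have [y2 [n2 p2 v2]] := st_transport gt' gt m2.
exists y, (y1, y2); split=> //=; [|by apply/ga|by apply/gb].
apply/hx'; split=> //=; first by split=> //=; rewrite p1 p2.
  by rewrite p1 p2 -py.
by rewrite v1 v2 vy.
Qed.
End Horizontal.

Section Associativity.
Variables (A C D E : gerbe R I) (gA : grading A) (gC : grading C) (gD : grading D).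
Variables (gE : grading E) (s : stable A C) (t : stable C D) (u : stable D E).
Variables (phi : st_elts s -> L) (psi : st_elts t -> L) (chi : st_elts u -> L).
Hypotheses (hA : graded_gerbe i gA) (hC : graded_gerbe i gC) (hD : graded_gerbe i gD).
Hypothesis hE : graded_gerbe i gE.
Hypotheses (gs : graded_stable i gA gC phi) (gt : graded_stable i gC gD psi).
Hypothesis gu : graded_stable i gD gE chi.

Lemma graded_vassoc :
  graded_arrow (comp_val (comp_val phi psi) chi) (comp_val phi (comp_val psi chi))
    (vassoc s t u).
Proof.
move=> x x' mx mx'; have gst := graded_compose hA hC hD gs gt.
have gtu := graded_compose hC hD hE gt gu.
have [[y xy] hx] := compose_memP hA hD hE gst gu mx.
have [_ hx'] := compose_memP hA hC hE gs gtu mx'; split.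
  move=> [lk [kn [l [k [n [/hx [[m1 m2 q] p <-] hlk /hx' [[m1' m2' q'] p' <-] hkn]]]]]].
  have [_ h1] := compose_memP hA hC hD gs gt m1.
  have [_ h2] := compose_memP hC hD hE gt gu m2'.
  have [_ r1 <-] := (h1 _).1 hlk; have [_ r2 <-] := (h2 _).1 hkn.
  by rewrite lie_mulA /= p p' /= r1 r2.
move=> [p v]; case: y xy => lk n xy; have [[m1 m2 q] py vy] := (hx _).1 xy.
rewrite /= in m1 m2 q py vy.
have [[[l k] lkE] h1] := compose_memP hA hC hD gs gt m1.
have [[n1 n2 q1] r1 v1] := (h1 _).1 lkE; rewrite /= in n1 n2 q1 r1 v1.
have ckn : composable (D := E) i (k, n) by split=> //=; rewrite -q r1.
exists lk, (descent_class i (k, n)), l, k, n; split=> //.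
  apply/hx'; split.
  - split=> //=; exact: descent_class_mem.
  - by move: p; rewrite /= py r1 => <-.
  - by rewrite (comp_val_class hC hD hE gt gu ckn) /= lie_mulA v1 vy v.
by apply/(descent_classP hC hD hE gt gu).
Qed.
End Associativity.

Section Units.
Variables (A C : gerbe R I) (gA : grading A) (gC : grading C).
Variables (s : stable A C) (phi : st_elts s -> L).
Hypotheses (hA : graded_gerbe i gA) (hC : graded_gerbe i gC).
Hypothesis gs : graded_stable i gA gC phi.

Definition id_val (D : gerbe R I) (gD : grading D) : st_elts (id_stable D) -> L :=
  @Sigma_val _ _ _ L I D D gD (id_map D).

Lemma graded_id (D : gerbe R I) (gD : grading D) :
  graded_gerbe i gD -> graded_stable i gD gD (id_val gD).
Proof. by move=> hD; apply: graded_Sigma => //; exact: graded_id_map. Qed.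

Lemma graded_unit_l : graded_arrow (comp_val (id_val gA) phi) phi (unit_l s).
Proof.
move=> x l' mx ml'.
have [[y xy] hx] := compose_memP hA hA hC (graded_id hA) gs mx; split.
  move=> [z [f [/hx [[/Sigma_memP [n1 n2 q2] m2 q] p <-] uf /(tauP gs)]]].
  move=> [[n m me mf] p1 p2 v]; have [_ sf vf] := (unitP hC f).1 uf.
  split; first by rewrite /= p /= p1 p2 /= q2 -sf.
  by rewrite /id_val /Sigma_val [LHS]v vf lie_mulg1.
move=> [p v]; have [[/Sigma_memP [n1 n2 q2] m2 q] py vy] := (hx y).1 xy.
have [pa pc _] := st_ends gs m2; have [f [uf mf sf tf vf]] := unit_at hC pc.
exists y, f; split=> //; apply/(tauP gs); split=> //.
- by rewrite -p /= py sf q2.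
- by rewrite [LHS]surjective_pairing tf -q.
- by rewrite vf lie_mulg1 -v -vy.
Qed.

Lemma graded_unit_r : graded_arrow (comp_val phi (id_val gC)) phi (unit_r s).
Proof.
move=> x l' mx ml'.
have [[y xy] hx] := compose_memP hA hC hC gs (graded_id hC) mx; split.
  move=> [z [e [/hx [[m1 /Sigma_memP [n1 n2 q2] q] p <-] ue /(tauP gs)]]].
  move=> [[n m me mf] p1 p2 v]; have [_ se ve] := (unitP hA e).1 ue.
  split; first by rewrite /= p /= p1 p2 /= se.
  by rewrite /id_val /Sigma_val -[LHS]v ve lie_mul1g.
move=> [p v]; have [[m1 /Sigma_memP [n1 n2 q2] q] py vy] := (hx y).1 xy.
have [pa pc _] := st_ends gs m1; have [e [ue me se te ve]] := unit_at hA pa.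
exists y, e; split=> //; apply/(tauP gs); split=> //.
- by rewrite [LHS]surjective_pairing se q2 q.
- by rewrite -p /= py te.
- by rewrite ve lie_mul1g -v -vy.
Qed.

Lemma graded_adj_unit : graded_arrow (id_val gA) (comp_val phi (adj_val phi)) (adj_unit s).
Proof.
move=> e x me mx; have ga := graded_adjoint gs.
have [[y xy] hx] := compose_memP hA hC hA gs ga mx.
have /Sigma_memP [n1 n2 q2] := me; split.
  move=> [z [f [/hx [[m1 m2 q] p <-] uf /(tauP gs) [[_ _ _ mf] p1 p2 v]]]].
  have [_ sf vf] := (unitP hC f).1 uf.
  rewrite /adj_val /= p /= p1 p2 /= q2; split=> //; apply: (@lie_mulIg R L (phi z.2)).
  by rewrite -lie_mulA lie_mulVg lie_mulg1 [LHS]v vf lie_mulg1.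
move=> [p v]; have [[m1 m2 q] py vy] := (hx y).1 xy.
have [pa pc _] := st_ends gs m1; have [f [uf mf sf tf vf]] := unit_at hC pc.
exists y, f; split=> //; apply/(tauP gs).
have [q1 q2'] : e.1 = (bu_proj y.1).1 /\ tgt (e.2 : elts A) = (bu_proj (y.2 : st_elts s)).1.
  by move: p; rewrite /= py => -[-> ->].
split=> //.
- by rewrite [LHS]surjective_pairing sf q2 -q1.
- by rewrite [LHS]surjective_pairing tf q2' q.
- by rewrite vf lie_mulg1 -[gr_lift gA e.2]/(id_val gA e) v -vy /adj_val -lie_mulA lie_mulVg lie_mulg1.
Qed.

Lemma graded_adj_counit :
  graded_arrow (comp_val (adj_val phi) phi) (id_val gC) (adj_counit s).
Proof.
move=> x f mx mf; have ga := graded_adjoint gs.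
have [[y xy] hx] := compose_memP hC hA hC ga gs mx.
have /Sigma_memP [n1 n2 q2] := mf; split.
  move=> [z [e [/hx [[m1 m2 q] p <-] ue /(tauP gs) [[_ _ me _] p1 p2 v]]]].
  have [_ se ve] := (unitP hA e).1 ue.
  rewrite /adj_val /= p /= p1 p2 /= q2; split=> //; apply: (@lie_mulgI R L (phi z.1)).
  by rewrite lie_mulVKg -[RHS]v ve lie_mul1g.
move=> [p v]; have [[m1 m2 q] py vy] := (hx y).1 xy.
have [pa pc _] := st_ends gs m2; have [e [ue me se te ve]] := unit_at hA pa.
exists y, e; split=> //; apply/(tauP gs).
have [q1 q2'] : (bu_proj (y.1 : st_elts s)).2 = f.1 /\ (bu_proj y.2).2 = tgt (f.2 : elts C).
  by move: p; rewrite /= py => -[<- <-].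
split=> //.
- by rewrite [LHS]surjective_pairing se q2 -q1 -q.
- by rewrite [LHS]surjective_pairing te q2'.
- by rewrite ve lie_mul1g -[gr_lift gC f.2]/(id_val gC f) -v -vy /adj_val lie_mulVKg.
Qed.
End Units.
End GradedArrows.

(** * Structural 2-arrows *)

(** The identity 2-arrow between stable isomorphisms induced by morphisms that agree
    on points and elements without being given by the same term. *)
Definition equality_arrow (R : realType) (I : Type) (A C : gerbe R I)
  (f h : gerbe_map A C) : two_arrow (Sigma f) (Sigma h) :=
  fun _ (l l' : pts A * elts C) => l = l'.
Arguments equality_arrow {R I A C} f h i l l'.

Section StructuralArrows.
Variables (R : realType) (G : lie_group R) (B : lie_alg G -> lie_alg G -> R).
Variable L : level1_extension B.
Local Notation "x ** y" := (@lie_mul R L x y) (at level 40, left associativity).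
Local Notation inv := (@lie_inv R L).
Local Notation "p **p q" := (@path_mul R G p q) (at level 40, left associativity).
Local Notation pinv := (@path_inv R G).
Local Notation grading := (@grading R G B L _).
Variables (I : Type) (i : I).
Local Notation graded_arrow := (@graded_arrow R G B L I i).
Local Notation graded_stable := (@graded_stable R G B L I i).
Local Notation graded_gerbe := (@graded_gerbe R G B L I i).
Local Notation graded_map := (@graded_map R G B L I i).
Local Notation Sval gC f := (@Sigma_val _ _ _ L I _ _ gC f).

(** A mate is a pasting of the given 2-arrow with units, counits and associators,
    all of which are graded. *)
Lemma graded_mate (A C D E : gerbe R I) (gA : grading A) (gC : grading C)
    (gD : grading D) (gE : grading E) (p : stable A C) (q : stable C E)
    (r : stable A D) (t : stable D E) (vp : st_elts p -> L) (vq : st_elts q -> L)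
    (vr : st_elts r -> L) (vt : st_elts t -> L)
    (a : two_arrow (compose p q) (compose r t)) :
  graded_gerbe gA -> graded_gerbe gC -> graded_gerbe gD -> graded_gerbe gE ->
  graded_stable gA gC vp -> graded_stable gC gE vq ->
  graded_stable gA gD vr -> graded_stable gD gE vt ->
  graded_arrow (comp_val vp vq) (comp_val vr vt) a ->
  graded_arrow (comp_val vq (adj_val vt)) (comp_val (adj_val vp) vr) (mate a).
Proof.
move=> hA hC hD hE gp gq gr gt ga.
have gp' := graded_adjoint gp; have gt' := graded_adjoint gt.
have gid (X : gerbe R I) (gX : grading X) (hX : graded_gerbe gX) := graded_id hX.
have gqt := graded_compose hC hE hD gq gt'.
have gpp := graded_compose hC hA hC gp' gp.
have gtt := graded_compose hD hE hD gt gt'.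
have gpq := graded_compose hA hC hE gp gq.
have grt := graded_compose hA hD hE gr gt.
have g1 := graded_compose hA hD hD gr (gid _ _ hD).
have g2 := graded_compose hA hD hD gr gtt.
have g3 := graded_compose hA hE hD grt gt'.
have g4 := graded_compose hA hE hD gpq gt'.
have g5 := graded_compose hA hC hD gp gqt.
have g6 := graded_compose hC hA hD gp' g5.
have g7 := graded_compose hC hC hD gpp gqt.
have g8 := graded_compose hC hC hD (gid _ _ hC) gqt.
have g9 := graded_compose hC hA hD gp' gr.
have a1 := graded_hcomp hA hD hD gr gr gtt (gid _ _ hD) (graded_vid gr)
  (graded_vinv (graded_adj_unit hD hE gt)).
have b1 := graded_vcomp g2 g1 a1 (graded_unit_r hA hD gr).
have b2 := graded_vcomp g3 g2 (graded_vassoc hA hD hE hD gr gt gt') b1.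
have a3 := graded_hcomp hA hE hD gpq grt gt' gt' ga (graded_vid gt').
have b3 := graded_vcomp g4 g3 a3 b2.
have b4 := graded_vcomp g5 g4 (graded_vinv (graded_vassoc hA hC hE hD gp gq gt')) b3.
have b5 := graded_hcomp hC hA hD gp' gp' g5 gr (graded_vid gp') b4.
have b6 := graded_vcomp g7 g6 (graded_vassoc hC hA hC hD gp' gp gqt) b5.
have a7 := graded_hcomp hC hC hD (gid _ _ hC) gpp gqt gqt
  (graded_vinv (graded_adj_counit hA hC gp)) (graded_vid gqt).
have b7 := graded_vcomp g8 g7 a7 b6.
exact: graded_vcomp gqt g8 (graded_vinv (graded_unit_l hC hD gqt)) b7.
Qed.

(** ** Stable isomorphisms induced by morphisms *)

Lemma graded_Sigma_comp (A C D : gerbe R I) (gA : grading A) (gC : grading C)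
    (gD : grading D) (f : gerbe_map A C) (h : gerbe_map C D) :
  graded_gerbe gA -> graded_gerbe gC -> graded_gerbe gD ->
  graded_map gA gC f -> graded_map gC gD h ->
  graded_arrow (comp_val (Sval gC f) (Sval gD h))
    (Sval gD (comp_map f h)) (Sigma_comp f h).
Proof.
move=> hA hC hD gf gh x l mx ml.
have gsf := graded_Sigma hA hC gf; have gsh := graded_Sigma hC hD gh.
have gsfh := graded_Sigma hA hD (graded_comp_map hC hD gf gh hA).
have [[y xy] hx] := compose_memP hA hC hD gsf gsh mx.
have key y' c : x.2 y' -> el i c -> gm_graph h y'.1.2 c ->
    [/\ st_mem i ((y'.1.1, ge_mul y'.2.2 c) : st_elts (Sigma (comp_map f h))),
      bu_proj x = bu_proj ((y'.1.1, ge_mul y'.2.2 c) : st_elts (Sigma (comp_map f h)))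
    & comp_val (Sval gC f) (Sval gD h) x
      = Sval gD (comp_map f h) (y'.1.1, ge_mul y'.2.2 c)].
  move=> /hx [[/Sigma_memP [m1 m2 q2] /Sigma_memP [m3 m4 q4] q] p v] mc gc.
  rewrite /= in q.
  have [_ sc tc vc] := (gm_el gh c m2).1 gc.
  have tsc : tgt c = src (y'.2.2 : elts D) by rewrite tc q4 -q.
  have [m5 s5 t5 v5] := gg_mul hD mc m4 tsc; split.
  - by apply/Sigma_memP; split=> //=; rewrite s5 sc q2.
  - by rewrite /= p /= t5.
  - by rewrite -v /Sigma_val /= v5 vc.
split=> [[y' [c [xy' mc gc ->]]]|[p v]]; first by have [] := key y' c xy' mc gc.
have [[/Sigma_memP [m1 m2 q2] _ _] _ _] := (hx y).1 xy.
have [c gc [mc _ _ _]] := gm_total hC hD gh m2.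
have [mm pp vv] := key y c xy mc gc; exists y, c; split=> //.
by apply: (st_inj gsfh); rewrite -?pp -?vv.
Qed.

(** The two composite morphisms agree on points and preserve the gradings, so an
    element of one induced stable isomorphism is also one of the other, with the
    same value. *)
Lemma graded_Sigma_square (A C D E : gerbe R I) (gA : grading A) (gC : grading C)
    (gD : grading D) (gE : grading E) (p : gerbe_map A C) (q : gerbe_map C E)
    (r : gerbe_map A D) (t : gerbe_map D E) :
  graded_gerbe gA -> graded_gerbe gC -> graded_gerbe gD -> graded_gerbe gE ->
  graded_map gA gC p -> graded_map gC gE q ->
  graded_map gA gD r -> graded_map gD gE t ->
  (forall a : pts A, pt i a -> gm_fun q (gm_fun p a) = gm_fun t (gm_fun r a)) ->
  graded_arrow (comp_val (Sval gC p) (Sval gE q))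
    (comp_val (Sval gD r) (Sval gE t)) (Sigma_square p q r t).
Proof.
move=> hA hC hD hE gp gq gr gt pqrt x x' mx mx'.
have h1 := graded_Sigma_comp hA hC hE gp gq.
have h2 := graded_Sigma_comp hA hD hE gr gt.
have gsx := graded_compose hA hC hE (graded_Sigma hA hC gp) (graded_Sigma hC hE gq).
have gpq := graded_Sigma hA hE (graded_comp_map hC hE gp gq hA).
have same l : st_mem i (l : st_elts (Sigma (comp_map p q))) ->
    st_mem i (l : st_elts (Sigma (comp_map r t))).
  by move=> /Sigma_memP [m1 m2 e]; apply/Sigma_memP; split=> //; rewrite e /= pqrt.
split=> [[l [ml /(h1 _ _ mx ml) [p1 v1] /(h2 _ _ mx' (same _ ml)) [p2 v2]]]|[pp vv]].
  by split; [exact: etrans p1 (esym p2) | exact: etrans v1 (esym v2)].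
have [l [ml pl vl]] := st_transport gpq gsx mx.
exists l; split=> //; first by apply/h1.
apply/h2; [by []|exact: same|].
by rewrite -pp -vv -pl -vl.
Qed.

Lemma graded_equality (A C : gerbe R I) (gA : grading A) (gC : grading C)
    (f h : gerbe_map A C) :
  graded_gerbe gA -> graded_gerbe gC -> graded_map gA gC f ->
  (forall a : pts A, pt i a -> gm_fun f a = gm_fun h a) ->
  graded_arrow (Sval gC f) (Sval gC h)
    (equality_arrow f h).
Proof.
move=> hA hC gf fh l l' ml /Sigma_memP [m1 m2 e]; split=> [->//|[p v]].
apply: (st_inj (graded_Sigma hA hC gf)) => //.
by apply/Sigma_memP; split=> //; rewrite e fh.
Qed.

Lemma graded_Sigma_tensor (A C A' C' : gerbe R I) (gA : grading A) (gC : grading C)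
    (gA' : grading A') (gC' : grading C') (f : gerbe_map A A') (h : gerbe_map C C') :
  graded_gerbe gA -> graded_gerbe gC -> graded_gerbe gA' -> graded_gerbe gC' ->
  graded_map gA gA' f -> graded_map gC gC' h ->
  graded_arrow (tens_val gA (Sval gA' f) (Sval gC' h))
    (Sval (tensor_grading gA' gC') (tensor_map f h)) (Sigma_tensor f h).
Proof.
move=> hA hC hA' hC' gf gh x l mx ml.
have gsf := graded_Sigma hA hA' gf; have gsh := graded_Sigma hC hC' gh.
have hT := graded_tensor_gerbe hA hC; have hT' := graded_tensor_gerbe hA' hC'.
have gst := graded_Sigma hT hT' (graded_tensor_map hA hC hA' hC' gf gh).
have [[y xy] hx] := tensor_st_memP hA gsf gsh mx.
have key y' : x.2 y' ->
    [/\ st_mem i (((y'.1.1, y'.2.1), tens y'.1.2 y'.2.2)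
          : st_elts (Sigma (tensor_map f h))),
      bu_proj x = bu_proj (((y'.1.1, y'.2.1), tens y'.1.2 y'.2.2)
          : st_elts (Sigma (tensor_map f h)))
    & tens_val gA (Sval gA' f) (Sval gC' h) x
      = Sval (tensor_grading gA' gC') (tensor_map f h)
          ((y'.1.1, y'.2.1), tens y'.1.2 y'.2.2)].
  move=> /hx [/Sigma_memP [m1 m2 q2] /Sigma_memP [m3 m4 q4] p v].
  have [mt st tt vt] := tensP hA' hC' m2 m4; split.
  - by apply/Sigma_memP; split=> //; rewrite st q2 q4.
  - by rewrite /= p.
  - rewrite -v /Sigma_val [RHS]vt q2 /=.
    by have [_ ->] := gm_pt gf m1.
split=> [[y' xy' ->]|[p v]]; first by have [] := key y' xy'.
have [mm pp vv] := key y xy; exists y => //.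
by apply: (st_inj gst); rewrite -?pp -?vv.
Qed.

(** ** Tensor products *)

Section Tensor.
Variables (A C A' C' : gerbe R I) (gA : grading A) (gC : grading C).
Variables (gA' : grading A') (gC' : grading C').
Variables (s s2 : stable A A') (t t2 : stable C C').
Variables (phi : st_elts s -> L) (phi2 : st_elts s2 -> L).
Variables (psi : st_elts t -> L) (psi2 : st_elts t2 -> L).
Hypotheses (hA : graded_gerbe gA) (hC : graded_gerbe gC).
Hypotheses (hA' : graded_gerbe gA') (hC' : graded_gerbe gC').
Hypotheses (gs : graded_stable gA gA' phi) (gs2 : graded_stable gA gA' phi2).
Hypotheses (gt : graded_stable gC gC' psi) (gt2 : graded_stable gC gC' psi2).

Lemma graded_htensor (a : two_arrow s s2) (b : two_arrow t t2) :
  graded_arrow phi phi2 a -> graded_arrow psi psi2 b ->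
  graded_arrow (tens_val gA phi psi) (tens_val gA phi2 psi2) (htensor a b).
Proof.
move=> ga gb x x' mx mx'; have [[y xy] hx] := tensor_st_memP hA gs gt mx.
have [_ hx'] := tensor_st_memP hA gs2 gt2 mx'; split.
  move=> [z [z' [/hx [m1 m2 p <-] /hx' [m1' m2' p' <-]]]].
  move=> /(ga _ _ m1 m1') [pa va] /(gb _ _ m2 m2') [pb vb].
  by rewrite va vb /= p p' pa pb.
move=> [p v]; have [m1 m2 py vy] := (hx y).1 xy.
have [y1 [n1 p1 v1]] := st_transport gs2 gs m1.
have [y2 [n2 p2 v2]] := st_transport gt2 gt m2.
exists y, (y1, y2); split=> //=; [|by apply/ga|by apply/gb].
apply/hx'; split=> //=.
  rewrite p1 p2 -py; apply: (can_inj (g := @middle_swap _ _ _ _)); last exact: esym p.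
  by case=> -[? ?] [? ?].
by rewrite p1 v1 v2 vy.
Qed.

(** Adjoints invert values, and by twist_inv the inverse of a horizontal product is
    the horizontal product of the inverses at the target path. *)
Lemma graded_adjoint_tensor :
  graded_arrow (tens_val gA' (adj_val phi) (adj_val psi)) (adj_val (tens_val gA phi psi))
    (adjoint_tensor s t).
Proof.
move=> x x' mx mx'; have gs' := graded_adjoint gs; have gt' := graded_adjoint gt.
have [[y xy] hx] := tensor_st_memP hA' gs' gt' mx.
have [[y' xy'] hx'] := tensor_st_memP hA gs gt mx'.
have E (z : st_elts s * st_elts t) : st_mem i z.1 ->
    twist (gr_path gA' (bu_proj z.1).2) (adj_val phi z.1) (adj_val psi z.2) =
    inv (twist (gr_path gA (bu_proj z.1).1) (phi z.1) (psi z.2)).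
  move=> mz; have [pa pa' lz] := st_ends gs mz.
  by rewrite (twist_inv _ (gg_path hA pa) (gg_path hA' pa') lz).
have projE (z : st_elts s * st_elts t) :
    x.1 = (bu_proj (z.1 : st_elts (adjoint_inverse s)),
           bu_proj (z.2 : st_elts (adjoint_inverse t))) ->
    (x'.1 = (bu_proj z.1, bu_proj z.2) <-> bu_proj x = bu_proj x').
  move=> p; rewrite /= p; case: (x'.1) => -[a b] [c d] /=.
  case: (bu_proj z.1) (bu_proj z.2) => a' b' [c' d'] /=; rewrite /middle_swap /=.
  by split=> [[-> -> -> ->]|[-> -> -> ->]].
split=> [xx|[p v]].
  have [m1 m2 p1 v1] := (hx y).1 xy.
  have [_ _ p2 v2] : [/\ st_mem i (y.1 : st_elts s), st_mem i (y.2 : st_elts t),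
    x'.1 = (bu_proj (y.1 : st_elts s), bu_proj (y.2 : st_elts t)) &
    twist (gr_path gA (bu_proj (y.1 : st_elts s)).1) (phi y.1) (psi y.2) =
    tens_val gA phi psi x'] by apply/hx'; rewrite -xx.
  split; first by apply/(projE y).
  by rewrite -v1 /adj_val -v2 -E.
apply/seteqP; split=> z.
  move=> /hx [m1 m2 p1 v1]; apply/hx'; split=> //; first by apply/(projE z).
  by apply: (@lie_invI R L); rewrite -[RHS]v -v1 -E.
move=> /hx' [m1 m2 p1 v1]; apply/hx; split=> //; last first.
  by rewrite [RHS]v /adj_val -v1; apply: E.
move: p; rewrite /= p1; case: (x.1) => -[a b] [c d].
case: (bu_proj z.1) (bu_proj z.2) => a' b' [c' d'] /=; rewrite /middle_swap /=.
by move=> [-> -> -> ->].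
Qed.
End Tensor.

(** On values, this is the interchange law of the crossed module. *)
Lemma graded_interchange (A C D A' C' D' : gerbe R I) (gA : grading A)
    (gC : grading C) (gD : grading D) (gA' : grading A') (gC' : grading C')
    (gD' : grading D') (s : stable A C) (t : stable C D) (s' : stable A' C')
    (t' : stable C' D') (phi : st_elts s -> L) (psi : st_elts t -> L)
    (phi' : st_elts s' -> L) (psi' : st_elts t' -> L) :
  graded_gerbe gA -> graded_gerbe gC -> graded_gerbe gD ->
  graded_gerbe gA' -> graded_gerbe gC' -> graded_gerbe gD' ->
  graded_stable gA gC phi -> graded_stable gC gD psi ->
  graded_stable gA' gC' phi' -> graded_stable gC' gD' psi' ->
  graded_arrow (tens_val gA (comp_val phi psi) (comp_val phi' psi'))
    (comp_val (tens_val gA phi phi') (tens_val gC psi psi'))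
    (Defs.interchange s t s' t').
Proof.
move=> hA hC hD hA' hC' hD' gs gt gs' gt' x x' mx mx'.
have gst := graded_compose hA hC hD gs gt.
have gst' := graded_compose hA' hC' hD' gs' gt'.
have gss := graded_tensor_stable hA hC hA' hC' gs gs'.
have gtt := graded_tensor_stable hC hD hC' hD' gt gt'.
have [[[a a'] xa] hx] := tensor_st_memP hA gst gst' mx.
have hT := graded_tensor_gerbe hA hA'; have hT' := graded_tensor_gerbe hC hC'.
have hT'' := graded_tensor_gerbe hD hD'.
have [_ hx'] := compose_memP hT hT' hT'' gss gtt mx'.
(* the common value, through the Peiffer identity *)
have valE l k l' k' : composable i (l, k) -> composable i (l', k') ->
    twist (gr_path gA (bu_proj l).1) (phi l ** psi k) (phi' l' ** psi' k') =
    twist (gr_path gA (bu_proj l).1) (phi l) (phi' l') **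
    twist (gr_path gC (bu_proj k).1) (psi k) (psi' k').
  move=> [ml mk lk] _; rewrite /= in ml mk lk; have [pa pc pl] := st_ends gs ml.
  by apply: twist_mul; rewrite -?lk //; [exact: gg_path hA _ pa|exact: gg_path hC _ pc].
split.
  move=> [b [b' [c [c' [l [l' [k [k' [/hx [m1 m2 p <-] [bl bl'] /hx']]]]]]]]].
  move=> [[n1 n2 q] p' <-] [cl ck].
  have [_ h1] := compose_memP hA hC hD gs gt m1.
  have [_ h2] := compose_memP hA' hC' hD' gs' gt' m2.
  have [_ h3] := tensor_st_memP hA gs gs' n1.
  have [_ h4] := tensor_st_memP hC gt gt' n2.
  have [c1 r1 v1] := (h1 _).1 bl; have [c2 r2 v2] := (h2 _).1 bl'.
  have [_ _ r3 v3] := (h3 _).1 cl; have [_ _ r4 v4] := (h4 _).1 ck.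
  rewrite /= in p p' r1 r2 r3 r4; split.
    by rewrite /= p p' /= r1 r2 r3 r4.
  by rewrite -v1 -v2 -v3 -v4 /= r1 valE.
move=> [p v]; have [m1 m2 px vx] := (hx _).1 xa.
have [[[l k] al] h1] := compose_memP hA hC hD gs gt m1.
have [[[l' k'] al'] h2] := compose_memP hA' hC' hD' gs' gt' m2.
have [c1 r1 v1] := (h1 _).1 al; have [c2 r2 v2] := (h2 _).1 al'.
have [[ml mk lk] [ml' mk' lk']] := (c1, c2); rewrite /= in ml mk lk ml' mk' lk'.
exists a, a', (tensor_elt l l'), (tensor_elt k k'), l, l', k, k'.
have c1' := circle1 R.
have [_ ht] := tensor_st_memP hA gs gs' (st_tens_mem (s := s) (t := s') ml ml').
have [_ ht'] := tensor_st_memP hC gt gt' (st_tens_mem (s := t) (t := t') mk mk').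
split=> //; last first.
  by split; [apply/ht|apply/ht']; split=> //;
    rewrite (tens_val_elt hA gs gs', tens_val_elt hC gt gt').
apply/hx'; split.
- split; [exact: st_tens_mem | exact: st_tens_mem|].
  by rewrite /= /middle_swap /= lk lk'.
- by move: p; rewrite /= px /= r1 r2 => <-.
- rewrite (tens_val_elt hA gs gs' ml ml') (tens_val_elt hC gt gt' mk mk') -valE //.
  by rewrite -v -vx -v1 -v2 /= r1.
Qed.
End StructuralArrows.

(** ** Spans *)

Definition span_val (R : realType) (G : lie_group R) (B : lie_alg G -> lie_alg G -> R)
    (L : level1_extension B) (I : Type) (A C D : gerbe R I) (gA : grading L A)
    (gD : grading L D) (f : gerbe_map C A) (h : gerbe_map C D)
    (x : st_elts (span_stable f h)) : L :=
  comp_val (adj_val (@Sigma_val _ _ _ L _ _ _ gA f)) (@Sigma_val _ _ _ L _ _ _ gD h) x.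
Arguments span_val {R G B L I A C D} gA gD f h x.

Section Spans.
Variables (R : realType) (G : lie_group R) (B : lie_alg G -> lie_alg G -> R).
Variable L : level1_extension B.
Local Notation "x ** y" := (@lie_mul R L x y) (at level 40, left associativity).
Local Notation inv := (@lie_inv R L).
Local Notation grading := (@grading R G B L _).
Variables (I : Type) (i : I).
Local Notation graded_arrow := (@graded_arrow R G B L I i).
Local Notation graded_stable := (@graded_stable R G B L I i).
Local Notation graded_gerbe := (@graded_gerbe R G B L I i).
Local Notation graded_map := (@graded_map R G B L I i).
Local Notation Sval gC f := (@Sigma_val _ _ _ L I _ _ gC f).
Local Notation Pval f phi := (@pre_val _ _ _ L I _ _ _ f _ phi).

Lemma graded_precompose_comp (A A' C D : gerbe R I) (gA : grading A)
    (gA' : grading A') (gC : grading C) (gD : grading D) (f : gerbe_map A A')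
    (s : stable A' C) (t : stable C D) (phi : st_elts s -> L) (psi : st_elts t -> L) :
  graded_gerbe gA -> graded_gerbe gA' -> graded_gerbe gC -> graded_gerbe gD ->
  graded_map gA gA' f -> graded_stable gA' gC phi -> graded_stable gC gD psi ->
  graded_arrow (Pval f (comp_val phi psi)) (comp_val (Pval f phi) psi)
    (precompose_comp f s t).
Proof.
move=> hA hA' hC hD gf gs gt x x' /pre_memP [ma mx ex] mx'.
have gpre := graded_precompose hA hA' gf gs.
have [[[l k] xlk] hx] := compose_memP hA' hC hD gs gt mx.
have [_ hx'] := compose_memP hA hC hD gpre gt mx'; split.
  move=> [l' [k' [/hx [_ p v] /hx' [_ p' <-]]]].
  rewrite /= in p p'; split; last by rewrite /pre_val -v.
  by rewrite /= p' p.
move=> [p v]; have [[ml mk lk] px vx] := (hx _).1 xlk; rewrite /= in ml mk lk px.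
exists l, k; split=> //; apply/hx'; split.
- split=> //; apply/pre_memP; split=> //=.
  by move: ex; rewrite /= px.
- by move: p; rewrite /= px /= => <-.
- by rewrite -v /pre_val -vx.
Qed.

Lemma graded_precompose_Sigma (A A' C : gerbe R I) (gA : grading A)
    (gA' : grading A') (gC : grading C) (f : gerbe_map A A') (h : gerbe_map A' C) :
  graded_gerbe gA -> graded_gerbe gA' -> graded_gerbe gC ->
  graded_map gA gA' f -> graded_map gA' gC h ->
  graded_arrow (Pval f (Sval gC h)) (Sval gC (comp_map f h)) (precompose_Sigma f h).
Proof.
move=> hA hA' hC gf gh [a [a' e]] l /pre_memP [ma /Sigma_memP [_ me se] p] ml.
rewrite /= in ma me se p.
have gsx := graded_Sigma hA hC (graded_comp_map hA' hC gf gh hA).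
split=> [->//|[q v]]; apply: (st_inj gsx) => //.
by apply/Sigma_memP; split=> //=; rewrite se p.
Qed.

Lemma graded_precompose_adjoint (A A' C : gerbe R I) (gA : grading A)
    (gA' : grading A') (gC : grading C) (f : gerbe_map A A') (f' : gerbe_map A' A)
    (h : gerbe_map C A') :
  graded_gerbe gA -> graded_gerbe gA' -> graded_gerbe gC ->
  graded_map gA gA' f -> graded_map gA' gA f' -> graded_map gC gA' h ->
  (forall a : pts A, pt i a -> gm_fun f' (gm_fun f a) = a) ->
  graded_arrow (Pval f (adj_val (Sval gA' h))) (adj_val (Sval gA (comp_map h f')))
    (precompose_adjoint f f' h).
Proof.
move=> hA hA' hC gf gf' gh f'f [a [c e']] [c' e].
move=> /pre_memP [ma /Sigma_memP [mc me' se'] p] /Sigma_memP [_ me se].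
rewrite /= in ma mc me' se' p me se.
rewrite /precompose_adjoint /pre_val /adj_val /Sigma_val /=.
split=> [[cc /(gm_el gf') -/(_ me') [_ s1 t1 v1]]|[[ac cc] /lie_invI v]].
  by rewrite v1 t1 p f'f // cc.
split=> //; apply/(gm_el gf') => //; split=> //.
- by rewrite se se' cc.
- by rewrite p f'f.
Qed.

Lemma graded_span (A C D : gerbe R I) (gA : grading A) (gC : grading C)
    (gD : grading D) (f : gerbe_map C A) (h : gerbe_map C D) :
  graded_gerbe gA -> graded_gerbe gC -> graded_gerbe gD ->
  graded_map gC gA f -> graded_map gC gD h ->
  graded_stable gA gD (span_val gA gD f h).
Proof.
move=> hA hC hD gf gh.
exact: graded_compose hA hC hD (graded_adjoint (graded_Sigma hC hA gf))
  (graded_Sigma hC hD gh).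
Qed.

Section SpanTensor.
Variables (A C D E : gerbe R I) (gA : grading A) (gC : grading C).
Variables (gD : grading D) (gE : grading E) (f : gerbe_map C A) (h : gerbe_map C D).
Hypotheses (hA : graded_gerbe gA) (hC : graded_gerbe gC).
Hypotheses (hD : graded_gerbe gD) (hE : graded_gerbe gE).
Hypotheses (gf : graded_map gC gA f) (gh : graded_map gC gD h).
Let id := graded_id_map hE.
Let sid := graded_id hE.
Let gspan := graded_span hA hC hD gf gh.
Let gf' := graded_adjoint (graded_Sigma hC hA gf).
Let gid' := graded_adjoint sid.
Let gsh := graded_Sigma hC hD gh.
Let gii := graded_compose hE hE hE gid' sid.
Let a0 : graded_arrow (id_val gE) (comp_val (adj_val (id_val gE)) (id_val gE))
  (id_adjoint_id E) := graded_vinv (graded_adj_counit hE hE sid).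

Lemma graded_span_tensor_id :
  graded_arrow (tens_val gA (span_val gA gD f h) (id_val gE))
    (span_val (tensor_grading gA gE) (tensor_grading gD gE)
      (tensor_map f (id_map E)) (tensor_map h (id_map E)))
    (span_tensor_id E f h).
Proof.
have hAE := graded_tensor_gerbe hA hE; have hCE := graded_tensor_gerbe hC hE.
have hDE := graded_tensor_gerbe hD hE.
have tf := graded_tensor_map hC hE hA hE gf id.
have th := graded_tensor_map hC hE hD hE gh id.
have g1 := graded_tensor_stable hA hD hE hE gspan sid.
have g2 := graded_tensor_stable hA hD hE hE gspan gii.
have g3 := graded_tensor_stable hA hC hE hE gf' gid'.
have g4 := graded_tensor_stable hC hD hE hE gsh sid.
have g5 := graded_compose hAE hCE hDE g3 g4.
have g6 := graded_adjoint (graded_tensor_stable hC hA hE hE (graded_Sigma hC hA gf) sid).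
have g7 := graded_adjoint (graded_Sigma hCE hAE tf).
have g8 := graded_Sigma hCE hDE th.
have a1 := graded_htensor hA gspan gspan sid gii (graded_vid gspan) a0.
have a2 := graded_interchange hA hC hD hE hE hE gf' gsh gid' sid.
have a3 := graded_adjoint_tensor hC hA (graded_Sigma hC hA gf) sid.
have a4 := graded_hadjoint (graded_Sigma_tensor hC hE hA hE gf id).
have a5 := graded_vcomp g3 g6 a3 a4.
have a6 := graded_Sigma_tensor hC hE hD hE gh id.
have a7 := graded_hcomp hAE hCE hDE g3 g7 g4 g8 a5 a6.
exact: graded_vcomp g1 g2 a1 (graded_vcomp g2 g5 a2 a7).
Qed.

Lemma graded_span_id_tensor :
  graded_arrow (tens_val gE (id_val gE) (span_val gA gD f h))
    (span_val (tensor_grading gE gA) (tensor_grading gE gD)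
      (tensor_map (id_map E) f) (tensor_map (id_map E) h))
    (span_id_tensor E f h).
Proof.
have hAE := graded_tensor_gerbe hE hA; have hCE := graded_tensor_gerbe hE hC.
have hDE := graded_tensor_gerbe hE hD.
have tf := graded_tensor_map hE hC hE hA id gf.
have th := graded_tensor_map hE hC hE hD id gh.
have g1 := graded_tensor_stable hE hE hA hD sid gspan.
have g2 := graded_tensor_stable hE hE hA hD gii gspan.
have g3 := graded_tensor_stable hE hE hA hC gid' gf'.
have g4 := graded_tensor_stable hE hE hC hD sid gsh.
have g5 := graded_compose hAE hCE hDE g3 g4.
have g6 := graded_adjoint (graded_tensor_stable hE hE hC hA sid (graded_Sigma hC hA gf)).
have g7 := graded_adjoint (graded_Sigma hCE hAE tf).
have g8 := graded_Sigma hCE hDE th.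
have a1 := graded_htensor hE sid gii gspan gspan a0 (graded_vid gspan).
have a2 := graded_interchange hE hE hE hA hC hD gid' sid gf' gsh.
have a3 := graded_adjoint_tensor hE hE sid (graded_Sigma hC hA gf).
have a4 := graded_hadjoint (graded_Sigma_tensor hE hC hE hA id gf).
have a5 := graded_vcomp g3 g6 a3 a4.
have a6 := graded_Sigma_tensor hE hC hE hD id gh.
have a7 := graded_hcomp hAE hCE hDE g3 g7 g4 g8 a5 a6.
exact: graded_vcomp g1 g2 a1 (graded_vcomp g2 g5 a2 a7).
Qed.
End SpanTensor.

(** ** The pasting of a diagram of morphisms *)

Section GradedPasting.
Variables (A C D E O F H K J : gerbe R I).
Variables (gA : grading A) (gC : grading C) (gD : grading D) (gE : grading E).
Variables (gO : grading O) (gF : grading F) (gH : grading H) (gK : grading K).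
Variable gJ : grading J.
Hypotheses (hA : graded_gerbe gA) (hC : graded_gerbe gC) (hD : graded_gerbe gD).
Hypotheses (hE : graded_gerbe gE) (hO : graded_gerbe gO) (hF : graded_gerbe gF).
Hypotheses (hH : graded_gerbe gH) (hK : graded_gerbe gK) (hJ : graded_gerbe gJ).
Variables (a1 : gerbe_map C A) (a2 : gerbe_map C D).
Variables (b1 : gerbe_map O E) (b2 : gerbe_map O F).
Variables (c1 : gerbe_map K H) (c2 : gerbe_map K J).
Variables (u1 : gerbe_map E A) (u2 : gerbe_map O C) (u3 : gerbe_map F D).
Variables (v1 : gerbe_map E H) (v2 : gerbe_map O K) (v3 : gerbe_map F J).
Hypotheses (ga1 : graded_map gC gA a1) (ga2 : graded_map gC gD a2).
Hypotheses (gb1 : graded_map gO gE b1) (gb2 : graded_map gO gF b2).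
Hypotheses (gc1 : graded_map gK gH c1) (gc2 : graded_map gK gJ c2).
Hypotheses (gu1 : graded_map gE gA u1) (gu2 : graded_map gO gC u2).
Hypothesis gu3 : graded_map gF gD u3.
Hypotheses (gv1 : graded_map gE gH v1) (gv2 : graded_map gO gK v2).
Hypothesis gv3 : graded_map gF gJ v3.
Hypothesis upper_left_comm : forall o : pts O, pt i o ->
  gm_fun a1 (gm_fun u2 o) = gm_fun u1 (gm_fun b1 o).
Hypothesis upper_right_comm : forall o : pts O, pt i o ->
  gm_fun a2 (gm_fun u2 o) = gm_fun u3 (gm_fun b2 o).
Hypothesis lower_left_comm : forall o : pts O, pt i o ->
  gm_fun v1 (gm_fun b1 o) = gm_fun c1 (gm_fun v2 o).
Hypothesis lower_right_comm : forall o : pts O, pt i o ->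
  gm_fun v3 (gm_fun b2 o) = gm_fun c2 (gm_fun v2 o).

(** Three of the squares enter through mates with respect to the arrows that are
    inverted. Commutativity on points suffices, because the gradings determine the
    morphisms on elements. *)
Lemma graded_pasting :
  graded_arrow
    (comp_val (span_val gA gD a1 a2) (span_val gD gJ u3 v3))
    (comp_val (span_val gA gH u1 v1) (span_val gH gJ c1 c2))
    (pasting a1 a2 b1 b2 c1 c2 u1 u2 u3 v1 v2 v3).
Proof.
have Sa1 := graded_Sigma hC hA ga1; have Sa2 := graded_Sigma hC hD ga2.
have Sb1 := graded_Sigma hO hE gb1; have Sb2 := graded_Sigma hO hF gb2.
have Sc1 := graded_Sigma hK hH gc1; have Sc2 := graded_Sigma hK hJ gc2.
have Su1 := graded_Sigma hE hA gu1; have Su2 := graded_Sigma hO hC gu2.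
have Su3 := graded_Sigma hF hD gu3; have Sv1 := graded_Sigma hE hH gv1.
have Sv2 := graded_Sigma hO hK gv2; have Sv3 := graded_Sigma hF hJ gv3.
have Sa1' := graded_adjoint Sa1; have Sb1' := graded_adjoint Sb1.
have Sc1' := graded_adjoint Sc1; have Su1' := graded_adjoint Su1.
have Su2' := graded_adjoint Su2; have Su3' := graded_adjoint Su3.
(* the lower right square enters as it is, the others through their mates *)
have ur := graded_mate hO hC hF hD Su2 Sa2 Sb2 Su3
  (graded_Sigma_square hO hC hF hD gu2 ga2 gb2 gu3 upper_right_comm).
have ll := graded_vinv (graded_mate hO hE hK hH Sb1 Sv1 Sv2 Sc1
  (graded_Sigma_square hO hE hK hH gb1 gv1 gv2 gc1 lower_left_comm)).
have ul := graded_vinv (graded_mate hC hA hO hE Sa1 Su1' Su2' Sb1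
  (graded_mate hO hC hE hA Su2 Sa1 Sb1 Su1
    (graded_Sigma_square hO hC hE hA gu2 ga1 gb1 gu1 upper_left_comm))).
have lr := graded_Sigma_square hO hF hK hJ gb2 gv3 gv2 gc2 lower_right_comm.
(* the two squares on the right, whiskered: between composites from C to J *)
have s1 := graded_compose hD hF hJ Su3' Sv3.
have s2 := graded_compose hO hK hJ Sv2 Sc2.
have s3 := graded_compose hC hD hJ Sa2 s1.
have s4 := graded_compose hC hD hF Sa2 Su3'.
have s5 := graded_compose hC hF hJ s4 Sv3.
have s6 := graded_compose hC hO hF Su2' Sb2.
have s7 := graded_compose hC hF hJ s6 Sv3.
have s8 := graded_compose hO hF hJ Sb2 Sv3.
have s9 := graded_compose hC hO hJ Su2' s8.
have s10 := graded_compose hC hO hJ Su2' s2.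
have right := graded_vcomp s3 s5 (graded_vinv (graded_vassoc hC hD hF hJ Sa2 Su3' Sv3))
  (graded_vcomp s5 s7 (graded_hcomp hC hF hJ s4 s6 Sv3 Sv3 ur (graded_vid Sv3))
  (graded_vcomp s7 s9 (graded_vassoc hC hO hF hJ Su2' Sb2 Sv3)
    (graded_hcomp hC hO hJ Su2' Su2' s8 s2 (graded_vid Su2') lr))).
(* the lower left square, whiskered: between composites from E to J *)
have t1 := graded_compose hE hO hJ Sb1' s2.
have t2 := graded_compose hE hO hK Sb1' Sv2.
have t3 := graded_compose hE hK hJ t2 Sc2.
have t4 := graded_compose hE hH hK Sv1 Sc1'.
have t5 := graded_compose hE hK hJ t4 Sc2.
have t6 := graded_compose hH hK hJ Sc1' Sc2.
have t7 := graded_compose hE hH hJ Sv1 t6.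
have left := graded_vcomp t1 t3 (graded_vinv (graded_vassoc hE hO hK hJ Sb1' Sv2 Sc2))
  (graded_vcomp t3 t5 (graded_hcomp hE hK hJ t2 t4 Sc2 Sc2 ll (graded_vid Sc2))
    (graded_vassoc hE hH hK hJ Sv1 Sc1' Sc2)).
(* the right half, the upper left square and the left half, up to associators *)
have w1 := graded_compose hA hD hJ (graded_compose hA hC hD Sa1' Sa2) s1.
have w2 := graded_compose hA hC hJ Sa1' s3.
have w3 := graded_compose hA hC hJ Sa1' s10.
have x4 := graded_compose hA hC hO Sa1' Su2'.
have w4 := graded_compose hA hO hJ x4 s2.
have x5 := graded_compose hA hE hO Su1' Sb1'.
have w5 := graded_compose hA hO hJ x5 s2.
have w6 := graded_compose hA hE hJ Su1' t1.
have w7 := graded_compose hA hE hJ Su1' t7.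
have e1 := graded_vassoc hA hC hD hJ Sa1' Sa2 s1.
have e2 := graded_hcomp hA hC hJ Sa1' Sa1' s3 s10 (graded_vid Sa1') right.
have e3 := graded_vinv (graded_vassoc hA hC hO hJ Sa1' Su2' s2).
have e4 := graded_hcomp hA hO hJ x4 x5 s2 s2 ul (graded_vid s2).
have e5 := graded_vassoc hA hE hO hJ Su1' Sb1' s2.
have e6 := graded_hcomp hA hE hJ Su1' Su1' t1 t7 (graded_vid Su1') left.
have e7 := graded_vinv (graded_vassoc hA hE hH hJ Su1' Sv1 t6).
exact: graded_vcomp w1 w2 e1 (graded_vcomp w2 w3 e2 (graded_vcomp w3 w4 e3
  (graded_vcomp w4 w5 e4 (graded_vcomp w5 w6 e5 (graded_vcomp w6 w7 e6 e7))))).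
Qed.
End GradedPasting.
End Spans.

(** Pullback commutes strictly with the formation of classes: both sides have the
    same elements, with the same values. *)
Lemma graded_pull_span (R : realType) (G : lie_group R) (B : lie_alg G -> lie_alg G -> R)
    (L : level1_extension B) (I J : Type) (h : J -> I) (j : J) (A C D : gerbe R I)
    (gA : grading L A) (gC : grading L C) (gD : grading L D)
    (f : gerbe_map C A) (k : gerbe_map C D) :
  graded_gerbe (h j) gA -> graded_gerbe (h j) gC -> graded_gerbe (h j) gD ->
  graded_map (h j) gC gA f -> graded_map (h j) gC gD k ->
  graded_arrow j
    (pull_val (h := h) (span_val gA gD f k))
    (span_val (pull_grading h gA) (pull_grading h gD) (pull_map h f) (pull_map h k))
    (@pull_span R I J h A C D f k).
Proof.
move=> hA hC hD gf gk l l' ml ml'.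
have gs := graded_span (graded_pull_gerbe hA) (graded_pull_gerbe hC)
  (graded_pull_gerbe hD) (graded_pull_map gf) (graded_pull_map gk).
pose l0 : st_elts (span_stable (pull_map h f) (pull_map h k)) := l.
have ml0 : st_mem j l0 := ml.
have vE : pull_val (h := h) (span_val gA gD f k) l =
    span_val (pull_grading h gA) (pull_grading h gD) (pull_map h f) (pull_map h k) l0.
  by rewrite /pull_val /span_val /comp_val /adj_val /Sigma_val.
split=> [e|[p v]]; last exact: (st_inj gs ml0 ml' p (etrans (esym vE) v)).
have {}e : l0 = l' := e.
by rewrite -e; split; [| exact: vE].
Qed.

Lemma graded_pull_Sigma (R : realType) (G : lie_group R) (B : lie_alg G -> lie_alg G -> R)
    (L : level1_extension B) (I J : Type) (h : J -> I) (j : J) (A C : gerbe R I)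
    (gA : grading L A) (gC : grading L C) (f : gerbe_map A C) :
  graded_gerbe (h j) gA -> graded_gerbe (h j) gC -> graded_map (h j) gA gC f ->
  graded_arrow j (pull_val (h := h) (@Sigma_val _ _ _ L _ _ _ gC f))
    (@Sigma_val _ _ _ L _ _ _ (pull_grading h gC) (pull_map h f))
    (@pull_Sigma R I J h A C f).
Proof.
move=> hA hC gf l l' ml ml'.
have gs := graded_Sigma (graded_pull_gerbe hA) (graded_pull_gerbe hC)
  (graded_pull_map gf).
pose l0 : st_elts (Sigma (pull_map h f)) := l.
have ml0 : st_mem j l0 := ml.
split=> [e|[p v]]; last exact: (st_inj gs ml0 ml' p v).
by have <- : l0 = l' := e.
Qed.

(** * Elements of composites of tensor products *)

Section CompositeElements.
Variables (R : realType) (G : lie_group R) (B : lie_alg G -> lie_alg G -> R).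
Variable L : level1_extension B.
Local Notation "x ** y" := (@lie_mul R L x y) (at level 40, left associativity).
Local Notation grading := (@grading R G B L _).
Variables (I : Type) (i : I) (D : gerbe R I) (gD : grading D).
Variables (A1 A2 C1 C2 : gerbe R I) (gA1 : grading A1) (gA2 : grading A2).
Variables (gC1 : grading C1) (gC2 : grading C2).
Variables (s1 : stable A1 C1) (s2 : stable A2 C2) (t : stable (tensor_gerbe C1 C2) D).
Variables (phi1 : st_elts s1 -> L) (phi2 : st_elts s2 -> L) (psi : st_elts t -> L).
Hypotheses (hA1 : graded_gerbe i gA1) (hA2 : graded_gerbe i gA2).
Hypotheses (hC1 : graded_gerbe i gC1) (hC2 : graded_gerbe i gC2).
Hypothesis hD : graded_gerbe i gD.
Hypotheses (gs1 : graded_stable i gA1 gC1 phi1) (gs2 : graded_stable i gA2 gC2 phi2).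
Hypothesis gt : graded_stable i (tensor_grading gC1 gC2) gD psi.

Let hC := graded_tensor_gerbe hC1 hC2.
Let gs := graded_tensor_stable hA1 hC1 hA2 hC2 gs1 gs2.

(** The value of a class is computed on any representative; in this form the sides
    of the associators can be compared component by component. *)
Lemma tensor_compose_elim (x : st_elts (compose (tensor_stable s1 s2) t)) y z :
  st_mem i x -> x.2 y -> y.1.2 z ->
  bu_proj x = (((bu_proj z.1).1, (bu_proj z.2).1), (bu_proj y.2).2) /\
  comp_val (tens_val gA1 phi1 phi2) psi x =
    twist (gr_path gA1 (bu_proj z.1).1) (phi1 z.1) (phi2 z.2) ** psi y.2.
Proof.
move=> mx xc xab.
have [_ hx] := compose_memP (graded_tensor_gerbe hA1 hA2) hC hD gs gt mx.
have [[mab _ _] px <-] := (hx y).1 xc.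
have [_ hab] := tensor_st_memP hA1 gs1 gs2 mab.
have [_ _ pab <-] := (hab z).1 xab.
by split=> //; rewrite [LHS]px /= pab.
Qed.

Lemma precompose_compose_elim (A : gerbe R I) (gA : grading A)
    (f : gerbe_map A (tensor_gerbe A1 A2))
    (x : st_elts (compose (precompose f (tensor_stable s1 s2)) t)) y z :
  graded_gerbe i gA -> graded_map i gA (tensor_grading gA1 gA2) f ->
  st_mem i x -> x.2 y -> y.1.2.2 z ->
  bu_proj x = (y.1.1, (bu_proj y.2).2) /\
  comp_val (@pre_val _ _ _ L _ _ _ _ f (tensor_stable s1 s2) (tens_val gA1 phi1 phi2)) psi x =
    twist (gr_path gA1 (bu_proj z.1).1) (phi1 z.1) (phi2 z.2) ** psi y.2.
Proof.
move=> hA gf mx xc xab; have hA12 := graded_tensor_gerbe hA1 hA2.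
have [_ hx] := compose_memP hA hC hD (graded_precompose hA hA12 gf gs) gt mx.
have [[/pre_memP [_ mab _] _ _] px <-] := (hx y).1 xc.
have [_ hab] := tensor_st_memP hA1 gs1 gs2 mab.
have [_ _ _ vab] := (hab z).1 xab.
by split=> //; congr (_ ** _); exact: esym vab.
Qed.
End CompositeElements.

(** * The two sides of an associator *)

Section AssociatorSides.
Variables (R : realType) (G : lie_group R) (B : lie_alg G -> lie_alg G -> R).
Variable L : level1_extension B.
Local Notation "x ** y" := (@lie_mul R L x y) (at level 40, left associativity).
Local Notation grading := (@grading R G B L _).
Variables (Y : Type) (E : gerbe R (Y * Y)) (g : grading E).
Variables (s : stable (product12_01 E) (pull_gerbe e02 E)) (phi : st_elts s -> L).
Local Notation E_ p := (pull_gerbe p E).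
Local Notation gE p := (pull_grading p g).
Local Notation mul_val f A C D := (@pull_val R G B L _ _ f _ _ s phi
  : st_elts (pull_stable f s : stable (tensor_gerbe A C) D) -> L).

Definition assoc_source_val : st_elts (assoc_source s) -> L :=
  comp_val (tens_val (tensor_grading (gE g23) (gE g12))
    (mul_val f123 (E_ g23) (E_ g12) (E_ g13)) (id_val (gE g01)))
    (mul_val f013 (E_ g13) (E_ g01) (E_ g03)).

Definition assoc_target_val : st_elts (assoc_target s) -> L :=
  comp_val (@pre_val _ _ _ L _ _ _ _ (tensor_assoc (E_ g23) (E_ g12) (E_ g01)) _
    (tens_val (gE g23) (id_val (gE g23)) (mul_val f012 (E_ g12) (E_ g01) (E_ g02))))
    (mul_val f023 (E_ g23) (E_ g02) (E_ g03)).

Variable i : Y * Y * Y * Y.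

Definition graded_edges : Prop :=
  [/\ graded_gerbe (g01 i) g, graded_gerbe (g12 i) g, graded_gerbe (g23 i) g
    & [/\ graded_gerbe (g02 i) g, graded_gerbe (g13 i) g & graded_gerbe (g03 i) g]].

Definition graded_mul_at (j : Y * Y * Y) : Prop :=
  graded_stable j (tensor_grading (gE e12) (gE e01)) (gE e02) phi.

Hypothesis gg : graded_edges.
Let E01 : graded_gerbe i (gE g01). Proof. by case: gg => h _ _ _; exact: graded_pull_gerbe. Qed.
Let E12 : graded_gerbe i (gE g12). Proof. by case: gg => _ h _ _; exact: graded_pull_gerbe. Qed.
Let E23 : graded_gerbe i (gE g23). Proof. by case: gg => _ _ h _; exact: graded_pull_gerbe. Qed.
Let E02 : graded_gerbe i (gE g02).
Proof. by case: gg => _ _ _ [h _ _]; exact: graded_pull_gerbe. Qed.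
Let E13 : graded_gerbe i (gE g13).
Proof. by case: gg => _ _ _ [_ h _]; exact: graded_pull_gerbe. Qed.
Let E03 : graded_gerbe i (gE g03).
Proof. by case: gg => _ _ _ [_ _ h]; exact: graded_pull_gerbe. Qed.
Let E23_12 := graded_tensor_gerbe E23 E12.
Let E12_01 := graded_tensor_gerbe E12 E01.
Let E13_01 := graded_tensor_gerbe E13 E01.
Let E23_02 := graded_tensor_gerbe E23 E02.
Let E23_12_01 := graded_tensor_gerbe E23_12 E01.
Let E23_p12_01 := graded_tensor_gerbe E23 E12_01.
Let triple := tensor_grading (tensor_grading (gE g23) (gE g12)) (gE g01).

Section Source.
Hypotheses (p123 : graded_mul_at (f123 i)) (p013 : graded_mul_at (f013 i)).

Let m123 : graded_stable (A := tensor_gerbe (E_ g23) (E_ g12)) (C := E_ g13) i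
  (tensor_grading (gE g23) (gE g12)) (gE g13) (s := pull_stable f123 s)
  (pull_val (h := f123) phi).
Proof. exact: graded_pull_stable p123. Qed.
Let m013 : graded_stable (A := tensor_gerbe (E_ g13) (E_ g01)) (C := E_ g03) i
  (tensor_grading (gE g13) (gE g01)) (gE g03) (s := pull_stable f013 s)
  (pull_val (h := f013) phi).
Proof. exact: graded_pull_stable p013. Qed.

Lemma graded_assoc_source : graded_stable i triple (gE g03) assoc_source_val.
Proof.
exact: (graded_compose E23_12_01 E13_01 E03
  (graded_tensor_stable E23_12 E13 E01 E01 m123 (graded_id E01)) m013).
Qed.

Lemma assoc_source_elim (x : st_elts (assoc_source s))
    (y : ((pts E * pts E * pts E * (pts E * pts E)) * set (st_elts s * (pts E * elts E)))
         * st_elts s) (z : st_elts s * (pts E * elts E)) :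
  st_mem i x -> x.2 y -> y.1.2 z ->
  bu_proj x = (((bu_proj z.1).1, z.2.1), (bu_proj y.2).2) /\
  assoc_source_val x =
    twist (gr_path (tensor_grading (gE g23) (gE g12)) (bu_proj z.1).1) (phi z.1)
      (gr_lift g z.2.2) ** phi y.2.
Proof.
exact: (tensor_compose_elim E23_12 E01 E13 E01 E03 m123 (graded_id E01) m013).
Qed.
End Source.

Section Target.
Hypotheses (p012 : graded_mul_at (f012 i)) (p023 : graded_mul_at (f023 i)).

Let m012 : graded_stable (A := tensor_gerbe (E_ g12) (E_ g01)) (C := E_ g02) i
  (tensor_grading (gE g12) (gE g01)) (gE g02) (s := pull_stable f012 s)
  (pull_val (h := f012) phi).
Proof. exact: graded_pull_stable p012. Qed.
Let m023 : graded_stable (A := tensor_gerbe (E_ g23) (E_ g02)) (C := E_ g03) i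
  (tensor_grading (gE g23) (gE g02)) (gE g03) (s := pull_stable f023 s)
  (pull_val (h := f023) phi).
Proof. exact: graded_pull_stable p023. Qed.

Lemma graded_assoc_target : graded_stable i triple (gE g03) assoc_target_val.
Proof.
exact: (graded_compose E23_12_01 E23_02 E03
  (graded_precompose E23_12_01 E23_p12_01 (graded_tensor_assoc E23 E12 E01)
    (graded_tensor_stable E23 E23 E12_01 E02 (graded_id E23) m012)) m023).
Qed.

Lemma assoc_target_elim (x : st_elts (assoc_target s))
    (y : ((pts E * pts E * pts E)
          * ((pts E * pts E * (pts E * pts E * pts E)) * set (pts E * elts E * st_elts s)))
         * st_elts s) (z : pts E * elts E * st_elts s) :
  st_mem i x -> x.2 y -> y.1.2.2 z ->
  bu_proj x = (y.1.1, (bu_proj y.2).2) /\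
  assoc_target_val x = twist (gr_path g z.1.1) (gr_lift g z.1.2) (phi z.2) ** phi y.2.
Proof.
exact: (precompose_compose_elim E23 E12_01 E23 E02 E03 (graded_id E23) m012 m023
  E23_12_01 (graded_tensor_assoc E23 E12 E01)).
Qed.
End Target.
End AssociatorSides.

(** * Comparing associators *)

Section AssociatorComparison.
Variables (R : realType) (G : lie_group R) (B : lie_alg G -> lie_alg G -> R).
Variable L : level1_extension B.
Local Notation grading := (@grading R G B L _).
Variables (X : fmanifold R) (Y : Defs.space R) (E E' : gerbe R (Y * Y)) (g : grading E) (g' : grading E').
Variables (s : stable (product12_01 E) (pull_gerbe e02 E)) (phi : st_elts s -> L).
Variables (s' : stable (product12_01 E') (pull_gerbe e02 E')) (phi' : st_elts s' -> L).
Variables (rY : Y * Y -> pts E -> pts E' -> Prop) (rE : Y * Y -> elts E -> elts E' -> Prop).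

(** The graph of an isomorphism when both stable isomorphisms are graded by the same
    crossed module, since values are coordinates on the fibres. *)
Definition same_value (j : Y * Y * Y) (l : st_elts s) (l' : st_elts s') : Prop :=
  [/\ rY (e12 j) (bu_proj l).1.1 (bu_proj l').1.1,
      rY (e01 j) (bu_proj l).1.2 (bu_proj l').1.2,
      rY (e02 j) (bu_proj l).2 (bu_proj l').2
    & phi l = phi' l'].

Variables (p p' : Y -> X) (a : two_arrow (assoc_source s) (assoc_target s)).
Variable a' : two_arrow (assoc_source s') (assoc_target s').
Local Notation G1 := (@Bundle2Gerbe R X Y p E s a).
Local Notation G2 := (@Bundle2Gerbe R X Y p' E' s' a').
Variable rL : Y * Y * Y -> st_elts s -> st_elts s' -> Prop.
Hypothesis rL_value : forall j l l', rL j l l' -> same_value j l l'.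
Local Notation rel_source := (@rel_source R X G1 G2 rY rE rL).
Local Notation rel_target := (@rel_target R X G1 G2 rY rE rL).
Variable i : Y * Y * Y * Y.

Hypotheses (gg : graded_edges g i) (gg' : graded_edges g' i).
Hypotheses (p123 : graded_mul_at g phi (f123 i)) (p013 : graded_mul_at g phi (f013 i)).
Hypotheses (p012 : graded_mul_at g phi (f012 i)) (p023 : graded_mul_at g phi (f023 i)).
Hypotheses (p123' : graded_mul_at g' phi' (f123 i)) (p013' : graded_mul_at g' phi' (f013 i)).
Hypotheses (p012' : graded_mul_at g' phi' (f012 i)) (p023' : graded_mul_at g' phi' (f023 i)).
Hypothesis rY_path : forall j z z', rY j z z' -> gr_path g z = gr_path g' z'.
Hypothesis rE_lift : forall j e e', rE j e e' -> gr_lift g e = gr_lift g' e'.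

Let same_ends (p : pts E * pts E * pts E * pts E) (p' : pts E' * pts E' * pts E' * pts E') :=
  [/\ rY (g23 i) p.1.1.1 p'.1.1.1, rY (g12 i) p.1.1.2 p'.1.1.2, rY (g01 i) p.1.2 p'.1.2
    & rY (g03 i) p.2 p'.2].

Lemma rel_source_val x x' : st_mem i x -> st_mem i x' -> rel_source i x x' ->
  same_ends (bu_proj x) (bu_proj x')
  /\ assoc_source_val g phi x = assoc_source_val g' phi' x'.
Proof.
move=> mx mx' [y [y' [xy xy' [z [z' [yz yz' ra rb]]] rc]]].
have [-> ->] := assoc_source_elim gg p123 p013 mx xy yz.
have [-> ->] := assoc_source_elim gg' p123' p013' mx' xy' yz'.
have [ra1 ra2 _ va] := rL_value ra; have [rb1 rb2] := rb.
have [_ _ rc3 vc] := rL_value rc.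
split; first by split.
congr lie_mul; last exact: vc.
rewrite va (rE_lift rb2); congr twist.
by rewrite /= (rY_path ra1) (rY_path ra2).
Qed.

Lemma rel_target_val x x' : st_mem i x -> st_mem i x' -> rel_target i x x' ->
  same_ends (bu_proj x) (bu_proj x')
  /\ assoc_target_val g phi x = assoc_target_val g' phi' x'.
Proof.
move=> mx mx' [y [y' [xy xy' [r1 r2 r3 [z [z' [yz yz' [ra1 ra2] rb]]]] rc]]].
have [-> ->] := assoc_target_elim gg p012 p023 mx xy yz.
have [-> ->] := assoc_target_elim gg' p012' p023' mx' xy' yz'.
have [_ _ _ vb] := rL_value rb; have [_ _ rc3 vc] := rL_value rc.
split; first by split.
congr lie_mul; last exact: vc.
by rewrite (rE_lift ra2) (rY_path ra1); congr twist; exact: vb.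
Qed.

Variable edge : Y * Y -> Prop.
Hypotheses (i23 : edge (g23 i)) (i12 : edge (g12 i)) (i01 : edge (g01 i)).
Hypothesis i03 : edge (g03 i).
Hypothesis rY_bij : forall j z1 z2 z1' z2', edge j -> pt j z1 -> pt j z2 ->
  rY j z1 z1' -> rY j z2 z2' -> z1 = z2 <-> z1' = z2'.

Let quadruple_ext (T : Type) (u v : T * T * T * T) : u.1.1.1 = v.1.1.1 ->
  u.1.1.2 = v.1.1.2 -> u.1.2 = v.1.2 -> u.2 = v.2 -> u = v.
Proof. by case: u v => [[[? ?] ?] ?] [[[? ?] ?] ?] /= -> -> -> ->. Qed.

(** Related elements have the same value, and a graded 2-arrow relates exactly the
    elements with the same ends and value; so it is transported to any other graded
    2-arrow. *)
Lemma graded_arrows_agree x y x' y' :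
  graded_arrow i (assoc_source_val g phi) (assoc_target_val g phi) a ->
  graded_arrow i (assoc_source_val g' phi') (assoc_target_val g' phi') a' ->
  st_mem i x -> st_mem i y -> st_mem i x' -> st_mem i y' ->
  rel_source i x x' -> rel_target i y y' -> a i x y <-> a' i x' y'.
Proof.
move=> ga ga' mx my mx' my' rx ry.
have [[rx1 rx2 rx3 rx4] vx] := rel_source_val mx mx' rx.
have [[ry1 ry2 ry3 ry4] vy] := rel_target_val my my' ry.
have [[[mx1 mx2] mx3] mx4 _] := st_ends (graded_assoc_source gg p123 p013) mx.
have [[[my1 my2] my3] my4 _] := st_ends (graded_assoc_target gg p012 p023) my.
have q1 := rY_bij i23 mx1 my1 rx1 ry1; have q2 := rY_bij i12 mx2 my2 rx2 ry2.
have q3 := rY_bij i01 mx3 my3 rx3 ry3; have q4 := rY_bij i03 mx4 my4 rx4 ry4.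
have pp : bu_proj x = bu_proj y <-> bu_proj x' = bu_proj y'.
  split=> [h|h]; apply: quadruple_ext.
  - by apply/q1; rewrite h.
  - by apply/q2; rewrite h.
  - by apply/q3; rewrite h.
  - by apply/q4; rewrite h.
  - by apply/q1; rewrite h.
  - by apply/q2; rewrite h.
  - by apply/q3; rewrite h.
  - by apply/q4; rewrite h.
split.
  by move/(ga _ _ mx my) => [/pp ? v]; apply/(ga' _ _ mx' my'); rewrite -vx -vy.
by move/(ga' _ _ mx' my') => [/pp ? v]; apply/(ga _ _ mx my); rewrite vx vy.
Qed.
End AssociatorComparison.

(** * Graded rigid bundle 2-gerbes *)

Section GradedRigid.
Variables (R : realType) (G : lie_group R) (X : fmanifold R).
Variables (B : lie_alg G -> lie_alg G -> R) (L : level1_extension B).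
Variable W : rigid_bundle_2_gerbe X.
Local Notation "p **p q" := (@path_mul R G p q) (at level 40, left associativity).
Local Notation pinv := (@path_inv R G).
Local Notation grading := (@grading R G B L _).
Local Notation Y := (rb_sub W).
Local Notation E := (w_gerbe W).
Local Notation E_ p := (pull_gerbe p (w_gerbe W)).
Local Notation T_ p := (pull_gerbe p (w_gerbe012 W)).
Local Notation Pval f phi := (@pre_val _ _ _ L _ _ _ _ f _ phi).
Local Notation d20 := (@rb_face_2_0 R X W).
Local Notation d21 := (@rb_face_2_1 R X W).
Local Notation d22 := (@rb_face_2_2 R X W).
Local Notation d30 := (@rb_face_3_0 R X W).
Local Notation d31 := (@rb_face_3_1 R X W).
Local Notation d32 := (@rb_face_3_2 R X W).
Local Notation d33 := (@rb_face_3_3 R X W).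

Definition inhabited_at (j : Y * Y) : Prop := exists z : pts E, pt j z.

(** A grading of the bundle gerbe of a rigid bundle 2-gerbe for which M is the
    product of the crossed module; besides the simplicial identities, the faces must
    lie over the projections, and simplices over a point of a fibre power must
    exist as soon as their edges do. *)
Record graded_rigid (g : grading E) : Prop := GradedRigid {
  gr_gerbe : forall j, inhabited_at j -> graded_gerbe j g;
  gr_face2 : forall i (w : pts (w_gerbe012 W)), pt i w ->
    [/\ pt (e12 i) (d20 w : pts E), pt (e02 i) (d21 w : pts E),
        pt (e01 i) (d22 w : pts E)
      & gr_path g (d21 w) = gr_path g (d22 w) **p gr_path g (d20 w)];
  gr_fill2 : forall i, inhabited_at (e12 i) -> inhabited_at (e01 i) ->
    exists w : pts (w_gerbe012 W), pt i w;
  gr_M : forall i (w w' : pts (w_gerbe012 W)) (a b : elts E), pt i w -> pt i w' ->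
    el (e12 i) a -> el (e01 i) b -> src a = d20 w -> src b = d22 w ->
    tgt a = d20 w' -> tgt b = d22 w' ->
    [/\ el (e02 i) (rb_M (w, w') a b : elts E),
        src (rb_M (w, w') a b : elts E) = d21 w,
        tgt (rb_M (w, w') a b : elts E) = d21 w'
      & gr_lift g (rb_M (w, w') a b)
        = twist (gr_path g (d20 w)) (gr_lift g a) (gr_lift g b)];
  gr_face3 : forall i (z : pts (w_gerbe0123 W)), pt i z ->
    [/\ pt (f123 i) (d30 z : pts (w_gerbe012 W)),
        pt (f023 i) (d31 z : pts (w_gerbe012 W)),
        pt (f013 i) (d32 z : pts (w_gerbe012 W))
      & pt (f012 i) (d33 z : pts (w_gerbe012 W))];
  gr_fill3 : forall i, inhabited_at (g23 i) -> inhabited_at (g12 i) ->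
    inhabited_at (g01 i) -> exists z : pts (w_gerbe0123 W), pt i z;
  gr_simplicial : forall z,
    [/\ d22 (d30 z) = d20 (d33 z), d20 (d31 z) = d20 (d30 z),
        d20 (d32 z) = d21 (d30 z)
      & [/\ d22 (d31 z) = d21 (d33 z), d22 (d32 z) = d22 (d33 z)
          & d21 (d32 z) = d21 (d31 z)]] }.

Variable g : grading E.
Hypothesis gW : graded_rigid g.
Local Notation gE p := (pull_grading p g).

Definition w_grading12_01 : grading (product12_01 E) :=
  tensor_grading (gE e12) (gE e01).

Definition w_grading012 : grading (w_gerbe012 W) :=
  @induced_grading _ _ _ L _ (product12_01 E) (family_of (@rb_proj2 R X W))
    (fun w => (d20 w, d22 w)) w_grading12_01.

(** ** The multiplication *)

Section Multiplication.
Variable i : Y * Y * Y.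
Hypothesis h12 : inhabited_at (e12 i).
Hypothesis h01 : inhabited_at (e01 i).

Lemma w_inhabited02 : inhabited_at (e02 i).
Proof. by have [w /(gr_face2 gW) [_ m _ _]] := gr_fill2 gW h12 h01; exists (d21 w). Qed.

Lemma graded_w12 : graded_gerbe i (gE e12).
Proof. exact/graded_pull_gerbe/(gr_gerbe gW). Qed.

Lemma graded_w01 : graded_gerbe i (gE e01).
Proof. exact/graded_pull_gerbe/(gr_gerbe gW). Qed.

Lemma graded_w02 : graded_gerbe i (gE e02).
Proof. exact/graded_pull_gerbe/(gr_gerbe gW)/w_inhabited02. Qed.

Lemma graded_w12_01 : graded_gerbe i w_grading12_01.
Proof. exact: graded_tensor_gerbe graded_w12 graded_w01. Qed.

Lemma graded_w012 : graded_gerbe i w_grading012.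
Proof.
apply: graded_induced graded_w12_01 (gr_fill2 gW h12 h01) _ => w.
by move=> /(gr_face2 gW) [].
Qed.

Lemma graded_w_span : graded_map i w_grading012 w_grading12_01 (w_span W).
Proof.
apply: graded_mapP graded_w12_01 _ _.
  by move=> w /(gr_face2 gW) [].
move=> [[w w'] e] [[_ me] pe]; split; first by exists e.
by move=> _ ->; split=> //; rewrite /src /tgt [LHS]surjective_pairing pe.
Qed.

Lemma graded_w_M : graded_map i w_grading012 (gE e02) (w_M W).
Proof.
apply: graded_mapP graded_w02 _ _; first by move=> w /(gr_face2 gW) [].
move=> [[w w'] e] [[[mw mw'] me] pe].
have {}me : @el R _ (product12_01 E) i e := me.
split.
  have [[[a b] eab] _] := tensor_el_memP graded_w12 graded_w01 me.
  by exists (rb_M (w, w') a b), a, b.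
move=> e' [a [b [/= eab ->]]].
have [[ma mb] se te ve] := tensor_elP graded_w12 graded_w01 me eab.
have [sa sb] : (src a, src b) = (d20 w, d22 w) by rewrite -se /src pe.
have [ta tb] : (tgt a, tgt b) = (d20 w', d22 w') by rewrite -te /tgt pe.
have [m s t v] := gr_M gW mw mw' ma mb sa sb ta tb.
split=> //; rewrite [LHS]v [RHS]ve.
by congr twist; rewrite sa.
Qed.

Definition w_mul_val : st_elts (w_mul W) -> L :=
  span_val w_grading12_01 (gE e02) (w_span W) (w_M W).

Lemma graded_w_mul : graded_stable i w_grading12_01 (gE e02) w_mul_val.
Proof.
exact: graded_span graded_w12_01 graded_w012 graded_w02 graded_w_span graded_w_M.
Qed.
End Multiplication.

(** ** The diagram of the associator *)

Section Associator.
Local Notation gT p := (pull_grading p w_grading012).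
Variable i : Y * Y * Y * Y.
Hypothesis h23 : inhabited_at (g23 i).
Hypothesis h12 : inhabited_at (g12 i).
Hypothesis h01 : inhabited_at (g01 i).

Let h13 : inhabited_at (g13 i) := @w_inhabited02 (f123 i) h23 h12.
Let h02 : inhabited_at (g02 i) := @w_inhabited02 (f012 i) h12 h01.
Let h03 : inhabited_at (g03 i) := @w_inhabited02 (f013 i) h13 h01.

Let E23 : graded_gerbe i (gE g23). Proof. exact/graded_pull_gerbe/(gr_gerbe gW). Qed.
Let E12 : graded_gerbe i (gE g12). Proof. exact/graded_pull_gerbe/(gr_gerbe gW). Qed.
Let E01 : graded_gerbe i (gE g01). Proof. exact/graded_pull_gerbe/(gr_gerbe gW). Qed.
Let E13 : graded_gerbe i (gE g13). Proof. exact/graded_pull_gerbe/(gr_gerbe gW). Qed.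
Let E02 : graded_gerbe i (gE g02). Proof. exact/graded_pull_gerbe/(gr_gerbe gW). Qed.
Let E03 : graded_gerbe i (gE g03). Proof. exact/graded_pull_gerbe/(gr_gerbe gW). Qed.

Let T123 : graded_gerbe i (gT f123).
Proof. exact: (graded_pull_gerbe (graded_w012 (i := f123 i) h23 h12)). Qed.
Let T012 : graded_gerbe i (gT f012).
Proof. exact: (graded_pull_gerbe (graded_w012 (i := f012 i) h12 h01)). Qed.
Let T013 : graded_gerbe i (gT f013).
Proof. exact: (graded_pull_gerbe (graded_w012 (i := f013 i) h13 h01)). Qed.
Let T023 : graded_gerbe i (gT f023).
Proof. exact: (graded_pull_gerbe (graded_w012 (i := f023 i) h23 h02)). Qed.

Definition w_grading_triple : grading (w_E23_E12_E01 W) :=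
  tensor_grading (tensor_grading (gE g23) (gE g12)) (gE g01).

Definition w_grading0123 : grading (w_gerbe0123 W) :=
  @induced_grading _ _ _ L _ (w_E23_E12_E01 W) (family_of (@rb_proj3 R X W))
    (fun z => ((d20 (d30 z), d20 (d33 z)), d22 (d33 z))) w_grading_triple.

Let E23_12 := graded_tensor_gerbe E23 E12.
Let E23_12_01 : graded_gerbe i w_grading_triple := graded_tensor_gerbe E23_12 E01.

Let O0123 : graded_gerbe i w_grading0123.
Proof.
apply: graded_induced E23_12_01 (gr_fill3 gW h23 h12 h01) _ => z.
move=> /(gr_face3 gW) [/(gr_face2 gW) [m1 _ _ _] _ _ /(gr_face2 gW) [m2 _ m3 _]].
by split; [split|].
Qed.

Let pair_inj (S T : Type) (a a' : S) (b b' : T) :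
  (a, b) = (a', b') -> a = a' /\ b = b'.
Proof. by case. Qed.

(** The morphisms out of the centre are defined on representatives; this gives their
    components over the edges 23, 12 and 01, in any choice of representatives. *)
Lemma w_el0123P (e : elts (w_gerbe0123 W)) : el i e ->
  [/\ @pt R _ (w_gerbe0123 W) i e.1.1, @pt R _ (w_gerbe0123 W) i e.1.2,
    exists (ab : elts (tensor_gerbe (E_ g23) (E_ g12))) (a : elts (E_ g23))
      (b : elts (E_ g12)) (c : elts (E_ g01)), e.2.2 (ab, c) /\ ab.2 (a, b)
  & forall (ab : elts (tensor_gerbe (E_ g23) (E_ g12))) (c : elts (E_ g01)),
    e.2.2 (ab, c) ->
    [/\ el i ab, el i c, src ab = (d20 (d30 e.1.1), d20 (d33 e.1.1)),
        tgt ab = (d20 (d30 e.1.2), d20 (d33 e.1.2))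
      & [/\ src c = d22 (d33 e.1.1), tgt c = d22 (d33 e.1.2)
      & gr_lift w_grading0123 e
        = twist (gr_path (tensor_grading (gE g23) (gE g12)) (src ab))
          (gr_lift (tensor_grading (gE g23) (gE g12)) ab) (gr_lift (gE g01) c)]]].
Proof.
case: e => -[z z'] e [[[mz mz'] me] pe]; split; [exact: mz|exact: mz'| |].
  have {}me : @el R _ (w_E23_E12_E01 W) i e := me.
  have [[[ab c] eab] _] := tensor_el_memP E23_12 E01 me.
  have [[mab _] _ _ _] := tensor_elP E23_12 E01 me eab.
  have [[[a b] hab] _] := tensor_el_memP E23 E12 mab.
  by exists ab, a, b, c.
have {}me : @el R _ (w_E23_E12_E01 W) i e := me.
move=> ab c eab.
have [[mab mc] s1 t1 v1] := tensor_elP E23_12 E01 me eab.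
have se : src e = ((d20 (d30 z), d20 (d33 z)), d22 (d33 z)) := congr1 fst pe.
have te : tgt e = ((d20 (d30 z'), d20 (d33 z')), d22 (d33 z')) := congr1 snd pe.
have [sab sc] := pair_inj (etrans (esym s1) se).
have [tab tc] := pair_inj (etrans (esym t1) te).
by split.
Qed.

Lemma w_el012 (f : Y * Y * Y * Y -> Y * Y * Y) (w w' : pts (T_ f))
    (e : elts (pull_gerbe f (product12_01 E))) :
  pt i w -> pt i w' -> el i e ->
  src e = (d20 w, d22 w) -> tgt e = (d20 w', d22 w') ->
  [/\ @el R _ (T_ f) i ((w, w'), e), @src R _ (T_ f) ((w, w'), e) = w,
      @tgt R _ (T_ f) ((w, w'), e) = w'
    & gr_lift (gT f) ((w, w'), e) = gr_lift (pull_grading f w_grading12_01) e].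
Proof.
move=> mw mw' me se te; split=> //; split; first by split.
by rewrite /= -se -te /src /tgt -surjective_pairing.
Qed.

Lemma graded_to_123_01 :
  graded_map i w_grading0123 (tensor_grading (gT f123) (gE g01)) (w_to_123_01 W).
Proof.
apply: graded_mapP (graded_tensor_gerbe T123 E01) _ _.
  move=> z mz; have [m1 _ _ /(gr_face2 gW) [_ _ m2 _]] := gr_face3 gW mz.
  have [q _ _ _] := gr_simplicial gW z.
  by split; [split | rewrite /= q].
move=> e me; have [mz mz' [ab [a [b [c [h1 h2]]]]] h] := w_el0123P me.
split; first by exists (tens (((d30 e.1.1, d30 e.1.2), ab) : elts (T_ f123)) c), ab, c.
move=> e' [ab' [c' [h1' ->]]] {ab a b c h1 h2}.
have [mab mc sab tab [sc tc ->]] := h _ _ h1'.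
have [m1 _ _ _] := gr_face3 gW mz; have [m1' _ _ _] := gr_face3 gW mz'.
have [q _ _ _] := gr_simplicial gW e.1.1; have [q' _ _ _] := gr_simplicial gW e.1.2.
have [||mT sT tT vT] := @w_el012 f123 _ _ ab' m1 m1' mab _ _; rewrite ?q ?q' //.
have [mt st tt vt] := tensP T123 E01 mT mc.
rewrite st tt sT tT sc tc vt vT sT sab; split=> //.
by rewrite /= q.
Qed.

(** The lift is bracketed on the left; twist_assoc moves the factors over the edges
    12 and 01 together, as the face 012 requires. *)
Let bc_ends (e : elts (w_gerbe0123 W)) (me : el i e) (ab : elts (tensor_gerbe (E_ g23) (E_ g12)))
    (a : elts (E_ g23)) (b : elts (E_ g12)) (c : elts (E_ g01)) :
  e.2.2 (ab, c) -> ab.2 (a, b) ->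
  [/\ [/\ el i a, el i b & el i c],
      [/\ src a = d20 (d30 e.1.1), src b = d20 (d33 e.1.1) & src c = d22 (d33 e.1.1)],
      [/\ tgt a = d20 (d30 e.1.2), tgt b = d20 (d33 e.1.2) & tgt c = d22 (d33 e.1.2)]
    & gr_lift w_grading0123 e =
      twist (gr_path g (src a)) (gr_lift g a)
        (gr_lift (tensor_grading (gE g12) (gE g01)) (tens b c : elts (tensor_gerbe (E_ g12) (E_ g01))))].
Proof.
move=> h1 h2; have [mz mz' _ h] := w_el0123P me.
have [mab mc sab tab [sc tc ->]] := h _ _ h1.
have [[ma mb] s2 t2 v2] := tensor_elP E23 E12 mab h2.
have [sa sb] := pair_inj (etrans (esym s2) sab).
have [ta tb] := pair_inj (etrans (esym t2) tab).
split=> //; have [_ _ _ ->] := tensP E12 E01 mb mc.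
have [pa _ _] := el_ends E23 ma; have [pb _ _] := el_ends E12 mb.
rewrite v2 s2; symmetry; apply: twist_assoc;
  [exact: gg_path E23 _ pa | exact: gg_path E12 _ pb].
Qed.

Lemma graded_to_23_012 :
  graded_map i w_grading0123 (tensor_grading (gE g23) (gT f012)) (w_to_23_012 W).
Proof.
apply: graded_mapP (graded_tensor_gerbe E23 T012) _ _.
  move=> z mz; have [/(gr_face2 gW) [m1 _ _ _] _ _ m2] := gr_face3 gW mz.
  by split; [split | rewrite /= path_mulA].
move=> e me; have [mz mz' [ab [a [b [c [h1 h2]]]]] _] := w_el0123P me.
split; first by exists (tens a (((d33 e.1.1, d33 e.1.2), tens b c) : elts (T_ f012))), ab, a, b, c.
move=> e' [ab' [a' [b' [c' [h1' h2' ->]]]]] {ab a b c h1 h2}.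
have [[ma mb mc] [sa sb sc] [ta tb tc] ->] := bc_ends me h1' h2'.
have [mbc sbc tbc vbc] := tensP E12 E01 mb mc.
have [_ _ _ m1] := gr_face3 gW mz; have [_ _ _ m1'] := gr_face3 gW mz'.
have [||mT sT tT vT] := @w_el012 f012 _ _ (tens b' c') m1 m1' mbc _ _.
- by rewrite [LHS]sbc sb sc.
- by rewrite [LHS]tbc tb tc.
have [mt st tt vt] := tensP E23 T012 ma mT.
by rewrite st tt sT tT sa ta vt vT sa.
Qed.

(** M over the face 123 multiplies the factors over the edges 23 and 12. *)
Lemma graded_to_013 : graded_map i w_grading0123 (gT f013) (w_to_013 W).
Proof.
apply: graded_mapP T013 _ _.
  move=> z mz; have [m1 _ m2 _] := gr_face3 gW mz.
  have [_ _ _ r1] := gr_face2 gW m1; have [q1 _ q2 [_ q3 _]] := gr_simplicial gW z.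
  by split=> //=; rewrite q2 q3 r1 q1.
move=> e me; have [mz mz' [ab [a [b [c [h1 h2]]]]] h] := w_el0123P me.
split.
  by exists ((d32 e.1.1, d32 e.1.2),
    tens (rb_M (d30 e.1.1, d30 e.1.2) a b : elts (E_ g13)) c), ab, a, b, c.
move=> e' [ab' [a' [b' [c' [h1' h2' ->]]]]] {ab a b c h1 h2}.
have [mab mc sab tab [sc tc ->]] := h _ _ h1'.
have [m1 _ m2 _] := gr_face3 gW mz; have [m1' _ m2' _] := gr_face3 gW mz'.
have [q1 _ q2 [_ q3 _]] := gr_simplicial gW e.1.1.
have [q1' _ q2' [_ q3' _]] := gr_simplicial gW e.1.2.
have [||mT sT tT vT] := @w_el012 f123 _ _ ab' m1 m1' mab _ _; rewrite ?q1 ?q1' //.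
have gM : gm_graph (w_M W) ((d30 e.1.1, d30 e.1.2), ab')
  (rb_M (d30 e.1.1, d30 e.1.2) a' b') by exists a', b'.
have [mM sM tM vM] := (gm_el (graded_w_M (i := f123 i) h23 h12) _ mT).1 gM.
have [mt st tt vt] := tensP E13 E01 mM mc.
have [||mU sU tU vU] := @w_el012 f013 _ _
    (tens (rb_M (d30 e.1.1, d30 e.1.2) a' b' : elts (E_ g13)) c') m2 m2' mt _ _.
- by rewrite [LHS]st [X in (X, _)]sM sc q2 q3.
- by rewrite [LHS]tt [X in (X, _)]tM tc q2' q3'.
split=> //; rewrite [LHS]vU [LHS]vt [X in twist (gr_path _ X)]sM [X in twist _ X]vM.
have [_ _ _ r1] := gr_face2 gW m1.
by congr twist; rewrite sab /= r1 q1.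
Qed.

(** M over the face 012 multiplies the factors over the edges 12 and 01. *)
Lemma graded_to_023 : graded_map i w_grading0123 (gT f023) (w_to_023 W).
Proof.
apply: graded_mapP T023 _ _.
  move=> z mz; have [_ m2 _ m1] := gr_face3 gW mz.
  have [_ _ _ r1] := gr_face2 gW m1; have [_ q1 _ [q2 _ _]] := gr_simplicial gW z.
  by split=> //=; rewrite q1 q2 r1 path_mulA.
move=> e me; have [mz mz' [ab [a [b [c [h1 h2]]]]] _] := w_el0123P me.
split.
  by exists ((d31 e.1.1, d31 e.1.2),
    tens a (rb_M (d33 e.1.1, d33 e.1.2) b c : elts (E_ g02))), ab, a, b, c.
move=> e' [ab' [a' [b' [c' [h1' h2' ->]]]]] {ab a b c h1 h2}.
have [[ma mb mc] [sa sb sc] [ta tb tc] ->] := bc_ends me h1' h2'.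
have [mbc sbc tbc vbc] := tensP E12 E01 mb mc.
have [_ m2 _ m1] := gr_face3 gW mz; have [_ m2' _ m1'] := gr_face3 gW mz'.
have [_ q1 _ [q2 _ _]] := gr_simplicial gW e.1.1.
have [_ q1' _ [q2' _ _]] := gr_simplicial gW e.1.2.
have [||mT sT tT vT] := @w_el012 f012 _ _ (tens b' c') m1 m1' mbc _ _.
- by rewrite [LHS]sbc sb sc.
- by rewrite [LHS]tbc tb tc.
have gM : gm_graph (w_M W) ((d33 e.1.1, d33 e.1.2), tens b' c')
  (rb_M (d33 e.1.1, d33 e.1.2) b' c').
  by exists b', c'; split=> //; apply/(tensor_el_memP E12 E01 mbc).2; split.
have [mM sM tM vM] := (gm_el (graded_w_M (i := f012 i) h12 h01) _ mT).1 gM.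
have [mt st tt vt] := tensP E23 E02 ma mM.
have [||mU sU tU vU] := @w_el012 f023 _ _
    (tens a' (rb_M (d33 e.1.1, d33 e.1.2) b' c' : elts (E_ g02))) m2 m2' mt _ _.
- by rewrite [LHS]st [X in (_, X)]sM sa q1 q2.
- by rewrite [LHS]tt [X in (_, X)]tM ta q1' q2'.
by split=> //; rewrite [LHS]vU [LHS]vt [X in twist _ _ X]vM.
Qed.

(** ** The associator *)

Let span123 : graded_map i (gT f123) (tensor_grading (gE g23) (gE g12)) (w_span123 W).
Proof. exact: (graded_pull_map (graded_w_span (i := f123 i) h23 h12)). Qed.
Let span012 : graded_map i (gT f012) (tensor_grading (gE g12) (gE g01)) (w_span012 W).
Proof. exact: (graded_pull_map (graded_w_span (i := f012 i) h12 h01)). Qed.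
Let span013 : graded_map i (gT f013) (tensor_grading (gE g13) (gE g01)) (w_span013 W).
Proof. exact: (graded_pull_map (graded_w_span (i := f013 i) h13 h01)). Qed.
Let span023 : graded_map i (gT f023) (tensor_grading (gE g23) (gE g02)) (w_span023 W).
Proof. exact: (graded_pull_map (graded_w_span (i := f023 i) h23 h02)). Qed.
Let M123 : graded_map i (gT f123) (gE g13) (w_M123 W).
Proof. exact: (graded_pull_map (graded_w_M (i := f123 i) h23 h12)). Qed.
Let M012 : graded_map i (gT f012) (gE g02) (w_M012 W).
Proof. exact: (graded_pull_map (graded_w_M (i := f012 i) h12 h01)). Qed.
Let M013 : graded_map i (gT f013) (gE g03) (w_M013 W).
Proof. exact: (graded_pull_map (graded_w_M (i := f013 i) h13 h01)). Qed.
Let M023 : graded_map i (gT f023) (gE g03) (w_M023 W).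
Proof. exact: (graded_pull_map (graded_w_M (i := f023 i) h23 h02)). Qed.

Let T123_01 := graded_tensor_gerbe T123 E01.
Let E13_01 := graded_tensor_gerbe E13 E01.
Let E23_T012 := graded_tensor_gerbe E23 T012.
Let E12_01 := graded_tensor_gerbe E12 E01.
Let E23_02 := graded_tensor_gerbe E23 E02.
Let E23_p12_01 := graded_tensor_gerbe E23 E12_01.
Let id01 := graded_id_map E01.
Let id23 := graded_id_map E23.
Let a1 := graded_tensor_map T123 E01 E23_12 E01 span123 id01.
Let a2 := graded_tensor_map T123 E01 E13 E01 M123 id01.
Let u1' := graded_tensor_map E23 T012 E23 E12_01 id23 span012.
Let u1 := graded_comp_map E23_p12_01 E23_12_01 u1'
  (graded_tensor_assoc_inv E23 E12 E01) E23_T012.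
Let v1 := graded_tensor_map E23 T012 E23 E02 id23 M012.

Local Notation first_source_val := (span_val w_grading_triple
  (tensor_grading (gE g13) (gE g01)) (tensor_map (w_span123 W) (id_map (E_ g01)))
  (tensor_map (w_M123 W) (id_map (E_ g01)))).
Local Notation second_source_val := (span_val (tensor_grading (gE g13) (gE g01))
  (gE g03) (w_span013 W) (w_M013 W)).
Local Notation first_target_val := (span_val w_grading_triple
  (tensor_grading (gE g23) (gE g02))
  (comp_map (tensor_map (id_map (E_ g23)) (w_span012 W))
     (tensor_assoc_inv (E_ g23) (E_ g12) (E_ g01)))
  (tensor_map (id_map (E_ g23)) (w_M012 W))).
Local Notation second_target_val := (span_val (tensor_grading (gE g23) (gE g02))
  (gE g03) (w_span023 W) (w_M023 W)).

(** The squares commute on points by the simplicial identities. *)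
Lemma graded_w_pasting :
  graded_arrow i (comp_val first_source_val second_source_val)
    (comp_val first_target_val second_target_val) (@w_pasting R X W).
Proof.
apply: (graded_pasting E23_12_01 T123_01 E13_01 E23_T012 O0123 T013 E23_02 T023 E03
  a1 a2 graded_to_23_012 graded_to_013 span023 M023 u1 graded_to_123_01 span013
  v1 graded_to_023 M013).
- by move=> z _; have [q _ _ _] := gr_simplicial gW z; rewrite /= q.
- by move=> z _; have [_ _ q [_ q' _]] := gr_simplicial gW z; rewrite /= q q'.
- by move=> z _; have [_ q _ [q' _ _]] := gr_simplicial gW z; rewrite /= q q'.
- by move=> z _; have [_ _ _ [_ _ q]] := gr_simplicial gW z; rewrite /= q.
Qed.

Local Notation w_source_val := (assoc_source_val g w_mul_val).
Local Notation w_target_val := (assoc_target_val g w_mul_val).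

Let s123 := graded_span E23_12 T123 E13 span123 M123.
Let s012 := graded_span E12_01 T012 E02 span012 M012.
Let s013 := graded_span E13_01 T013 E03 span013 M013.
Let s023 := graded_span E23_02 T023 E03 span023 M023.
Let sid01 := graded_id E01.
Let sid23 := graded_id E23.

Let m123 : graded_stable (A := tensor_gerbe (E_ g23) (E_ g12)) (C := E_ g13) i
  (tensor_grading (gE g23) (gE g12)) (gE g13) (s := pull_stable f123 (w_mul W)) (pull_val (h := f123) w_mul_val).
Proof. exact: (graded_pull_stable (graded_w_mul (i := f123 i) h23 h12)). Qed.
Let m012 : graded_stable (A := tensor_gerbe (E_ g12) (E_ g01)) (C := E_ g02) i
  (tensor_grading (gE g12) (gE g01)) (gE g02) (s := pull_stable f012 (w_mul W)) (pull_val (h := f012) w_mul_val).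
Proof. exact: (graded_pull_stable (graded_w_mul (i := f012 i) h12 h01)). Qed.
Let m013 : graded_stable (A := tensor_gerbe (E_ g13) (E_ g01)) (C := E_ g03) i
  (tensor_grading (gE g13) (gE g01)) (gE g03) (s := pull_stable f013 (w_mul W)) (pull_val (h := f013) w_mul_val).
Proof. exact: (graded_pull_stable (graded_w_mul (i := f013 i) h13 h01)). Qed.
Let m023 : graded_stable (A := tensor_gerbe (E_ g23) (E_ g02)) (C := E_ g03) i
  (tensor_grading (gE g23) (gE g02)) (gE g03) (s := pull_stable f023 (w_mul W)) (pull_val (h := f023) w_mul_val).
Proof. exact: (graded_pull_stable (graded_w_mul (i := f023 i) h23 h02)). Qed.

Lemma graded_w_source : graded_stable i w_grading_triple (gE g03) w_source_val.
Proof.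
exact: (graded_compose E23_12_01 E13_01 E03
  (graded_tensor_stable E23_12 E13 E01 E01 m123 sid01) m013).
Qed.

Let assoc_map := graded_tensor_assoc E23 E12 E01.

Lemma graded_w_target : graded_stable i w_grading_triple (gE g03) w_target_val.
Proof.
exact: (graded_compose E23_12_01 E23_02 E03
  (graded_precompose E23_12_01 E23_p12_01 assoc_map
    (graded_tensor_stable E23 E23 E12_01 E02 sid23 m012)) m023).
Qed.

Let p123 := @graded_pull_span R G B L _ _ f123 i _ _ _ _ _ _ _ _
  (graded_w12_01 (i := f123 i) h23 h12) (graded_w012 (i := f123 i) h23 h12)
  (graded_w02 (i := f123 i) h23 h12) (graded_w_span (i := f123 i) h23 h12)
  (graded_w_M (i := f123 i) h23 h12).
Let p012 := @graded_pull_span R G B L _ _ f012 i _ _ _ _ _ _ _ _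
  (graded_w12_01 (i := f012 i) h12 h01) (graded_w012 (i := f012 i) h12 h01)
  (graded_w02 (i := f012 i) h12 h01) (graded_w_span (i := f012 i) h12 h01)
  (graded_w_M (i := f012 i) h12 h01).
Let p013 := @graded_pull_span R G B L _ _ f013 i _ _ _ _ _ _ _ _
  (graded_w12_01 (i := f013 i) h13 h01) (graded_w012 (i := f013 i) h13 h01)
  (graded_w02 (i := f013 i) h13 h01) (graded_w_span (i := f013 i) h13 h01)
  (graded_w_M (i := f013 i) h13 h01).
Let p023 := @graded_pull_span R G B L _ _ f023 i _ _ _ _ _ _ _ _
  (graded_w12_01 (i := f023 i) h23 h02) (graded_w012 (i := f023 i) h23 h02)
  (graded_w02 (i := f023 i) h23 h02) (graded_w_span (i := f023 i) h23 h02)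
  (graded_w_M (i := f023 i) h23 h02).

Let gsource2 := graded_compose E23_12_01 E13_01 E03
  (graded_span E23_12_01 T123_01 E13_01 a1 a2) s013.

Lemma graded_w_assoc_source :
  graded_arrow i w_source_val (comp_val first_source_val second_source_val)
    (@w_assoc_source R X W).
Proof.
have t1 := graded_tensor_stable E23_12 E13 E01 E01 m123 sid01.
have t2 := graded_tensor_stable E23_12 E13 E01 E01 s123 sid01.
have t3 := graded_span E23_12_01 T123_01 E13_01 a1 a2.
have b1 := graded_htensor E23_12 m123 s123 sid01 sid01 p123 (graded_vid sid01).
have b2 := graded_hcomp E23_12_01 E13_01 E03 t1 t2 m013 s013 b1 p013.
have b3 := graded_span_tensor_id E23_12 T123 E13 E01 span123 M123.
have b4 := graded_hcomp E23_12_01 E13_01 E03 t2 t3 s013 s013 b3 (graded_vid s013).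
have c := graded_vcomp graded_w_source (graded_compose E23_12_01 E13_01 E03 t2 s013) b2 b4.
(* the 2-arrow unfolds to this pasting *)
exact_no_check c.
Qed.

Let gtarget2 := graded_compose E23_12_01 E23_02 E03
  (graded_span E23_12_01 E23_T012 E23_02 u1 v1) s023.

Lemma graded_w_assoc_target :
  graded_arrow i w_target_val (comp_val first_target_val second_target_val)
    (@w_assoc_target R X W).
Proof.
have t1 := graded_tensor_stable E23 E23 E12_01 E02 sid23 m012.
have t2 := graded_tensor_stable E23 E23 E12_01 E02 sid23 s012.
have t3 := graded_span E23_p12_01 E23_T012 E23_02 u1' v1.
have t4 := graded_span E23_12_01 E23_T012 E23_02 u1 v1.
have p1 := graded_precompose E23_12_01 E23_p12_01 assoc_map t1.
have p2 := graded_precompose E23_12_01 E23_p12_01 assoc_map t2.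
have p3 := graded_precompose E23_12_01 E23_p12_01 assoc_map t3.
have f' := graded_adjoint (graded_Sigma E23_T012 E23_p12_01 u1').
have p4 := graded_precompose E23_12_01 E23_p12_01 assoc_map f'.
have sv1 := graded_Sigma E23_T012 E23_02 v1.
have p5 := graded_adjoint (graded_Sigma E23_T012 E23_12_01 u1).
have p6 := graded_compose E23_12_01 E23_T012 E23_02 p4 sv1.
have b1 := graded_hprecompose (f := tensor_assoc _ _ _)
  (graded_htensor E23 sid23 sid23 m012 s012 (graded_vid sid23) p012).
have b2 := graded_hcomp E23_12_01 E23_02 E03 p1 p2 m023 s023 b1 p023.
have c1 := graded_hprecompose (f := tensor_assoc _ _ _)
  (graded_span_id_tensor E12_01 T012 E02 E23 span012 M012).
have c2 := graded_precompose_comp E23_12_01 E23_p12_01 E23_T012 E23_02 assoc_map f' sv1.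
have c3 := graded_precompose_adjoint E23_12_01 E23_p12_01 E23_T012 assoc_map
  (graded_tensor_assoc_inv E23 E12 E01) u1'.
have {}c3 := c3 _; have {}c3 := c3 (fun '(x, y, z) => fun _ => erefl).
have c4 := graded_hcomp E23_12_01 E23_T012 E23_02 p4 p5 sv1 sv1 c3 (graded_vid sv1).
have c5 := graded_vcomp p2 p3 c1 (graded_vcomp p3 p6 c2 c4).
have c6 := graded_hcomp E23_12_01 E23_02 E03 p2 t4 s023 s023 c5 (graded_vid s023).
have c := graded_vcomp graded_w_target (graded_compose E23_12_01 E23_02 E03 p2 s023) b2 c6.
(* the 2-arrow unfolds to this pasting *)
exact_no_check c.
Qed.

(** The associator is a pasting of graded 2-arrows, so it is the identity on values.
    *)
Lemma graded_w_assoc : graded_arrow i w_source_val w_target_val (@w_assoc R X W).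
Proof.
exact: (graded_vcomp graded_w_source gsource2 graded_w_assoc_source
  (graded_vcomp gsource2 gtarget2 graded_w_pasting
    (graded_vinv graded_w_assoc_target))).
Qed.
End Associator.
End GradedRigid.

(** ** Fibres with elements *)

Section Inhabited.
Variables (R : realType) (G : lie_group R) (X : fmanifold R).
Variables (B : lie_alg G -> lie_alg G -> R) (L : level1_extension B).
Variables (W : rigid_bundle_2_gerbe X) (g : grading L (w_gerbe W)).
Hypothesis gW : graded_rigid g.
Local Notation E := (w_gerbe W).

Let adjoint_Sigma_mem (I : Type) (i : I) (A C : gerbe R I) (f : gerbe_map A C)
    (l : st_elts (adjoint_inverse (Sigma f))) : st_mem i l ->
  [/\ pt i (l.1 : pts A), el i (l.2 : elts C) & src (l.2 : elts C) = gm_fun f l.1].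
Proof. by move=> [[? ?] ?]. Qed.

(** A representative contains a point of Z_2, whose faces are points over the edges.
    *)
Lemma w_mul_inhabited i (l : st_elts (w_mul W)) : st_mem i l ->
  inhabited_at (e12 i) /\ inhabited_at (e01 i).
Proof.
move=> ml.
have [y [my _ _] _] := compose_elim (s := adjoint_inverse (Sigma (w_span W)))
  (t := Sigma (w_M W)) ml.
have [mw _ _] := adjoint_Sigma_mem my.
have [m1 _ m2 _] := gr_face2 gW mw.
by split; eexists; [exact: m1 | exact: m2].
Qed.

Let first_factor (I : Type) (i : I) (A C D F : gerbe R I) (s : stable A C)
    (t : stable (tensor_gerbe C D) F)
    (x : st_elts (compose (tensor_stable s (id_stable D)) t)) : st_mem i x ->
  exists (l : st_elts s) (z : pts D), st_mem i l /\ pt i z.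
Proof.
move=> mx; have [y [[[l k] [ml [[mk _] _]] _] _ _] _] := compose_elim mx.
by exists l, k.1.
Qed.

Lemma w_assoc_inhabited i (x : st_elts (assoc_source (w_mul W))) : st_mem i x ->
  [/\ inhabited_at (g23 i), inhabited_at (g12 i) & inhabited_at (g01 i)].
Proof.
move=> mx; have [l [z [ml mz]]] := first_factor
  (A := tensor_gerbe (pull_gerbe g23 E) (pull_gerbe g12 E)) (C := pull_gerbe g13 E)
  (D := pull_gerbe g01 E) (F := pull_gerbe g03 E) (s := pull_stable f123 (w_mul W))
  (t := pull_stable f013 (w_mul W)) mx.
have [h1 h2] := @w_mul_inhabited (f123 i) l ml.
by split=> //; exists z; exact: mz.
Qed.

Section Fibre.
Variable i : rb_sub W * rb_sub W * rb_sub W * rb_sub W.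
Hypotheses (h23 : inhabited_at (g23 i)) (h12 : inhabited_at (g12 i)).
Hypothesis h01 : inhabited_at (g01 i).

Let h13 : inhabited_at (g13 i) := @w_inhabited02 _ _ _ _ _ _ g gW (f123 i) h23 h12.
Let h02 : inhabited_at (g02 i) := @w_inhabited02 _ _ _ _ _ _ g gW (f012 i) h12 h01.
Let h03 : inhabited_at (g03 i) := @w_inhabited02 _ _ _ _ _ _ g gW (f013 i) h13 h01.

Lemma graded_w_edges : graded_edges g i.
Proof. by split; [..|split]; exact: gr_gerbe. Qed.

Lemma graded_w_faces :
  [/\ graded_mul_at g (w_mul_val g) (f123 i), graded_mul_at g (w_mul_val g) (f013 i),
      graded_mul_at g (w_mul_val g) (f012 i) & graded_mul_at g (w_mul_val g) (f023 i)].
Proof.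
split; [exact: (graded_w_mul (i := f123 i) gW h23 h12)
  | exact: (graded_w_mul (i := f013 i) gW h13 h01)
  | exact: (graded_w_mul (i := f012 i) gW h12 h01)
  | exact: (graded_w_mul (i := f023 i) gW h23 h02)].
Qed.
End Fibre.
End Inhabited.

(** ** Plots of the multiplication *)

Section MultiplicationPlots.
Variables (R : realType) (G : lie_group R) (X : fmanifold R).
Variables (B : lie_alg G -> lie_alg G -> R) (L : level1_extension B).
Variables (W : rigid_bundle_2_gerbe X) (g : grading L (w_gerbe W)).
Hypothesis gW : graded_rigid g.
Hypotheses (ZS : sheaf_of_plots (rb_Z2 W)) (ES : sheaf_of_plots (rb_E W)).
Local Notation Y := (rb_sub W).
Local Notation E := (w_gerbe W).
Variables (V : tvsType R) (U : set V) (i : V -> Y * Y * Y).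
Variable a : V -> st_elts (w_mul W).

Section Value.
Variables (u : V) (w w2 : pts (w_gerbe012 W)) (x y e : elts E).
Hypotheses (mw : pt (i u) w) (mw2 : pt (i u) w2).
Hypotheses (mx : el (e12 (i u)) x) (my : el (e01 (i u)) y) (me : el (e02 (i u)) e).
Hypotheses (sx : (src x, src y) = (rb_face_2_0 w, rb_face_2_2 w)).
Hypotheses (se : src e = rb_face_2_1 w2) (ww : w = w2).

(** The first leg of the span is inverted, so the class has as value the inverse of
    the horizontal product of x and y, times the lift of e. *)
Lemma w_mul_class :
  let l := descent_class (s := adjoint_inverse (Sigma (w_span W))) (t := Sigma (w_M W))
    (i u) ((w, @tens R _ (pull_gerbe e12 E) (pull_gerbe e01 E) x y), (w2, e)) in
  [/\ st_mem (i u) (l : st_elts (w_mul W)),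
      @bu_proj _ _ _ (st_bundle (w_mul W)) l = ((tgt x, tgt y), tgt e)
    & w_mul_val g l = lie_mul (lie_inv (twist (gr_path g (src x)) (gr_lift g x)
                                  (gr_lift g y))) (gr_lift g e)].
Proof.
have [f1 f2 f3 _] := gr_face2 gW mw.
have h12 : inhabited_at (e12 (i u)) by eexists; exact: f1.
have h01 : inhabited_at (e01 (i u)) by eexists; exact: f3.
have [mt st tt vt] := tensP (graded_w12 gW h12) (graded_w01 gW h01) mx my.
pose s1 : st_elts (adjoint_inverse (Sigma (w_span W))) :=
  (w, @tens R _ (pull_gerbe e12 E) (pull_gerbe e01 E) x y).
pose s2 : st_elts (Sigma (w_M W)) := (w2, e).
have m1 : st_mem (i u) s1.
  by split; [split; [exact: mw | exact: mt] | rewrite /= [LHS]st; exact: sx].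
have m2 : st_mem (i u) s2 by split; [split; [exact: mw2 | exact: me] | exact: se].
have cy : composable (i u) (s1, s2) by split.
move=> l; split; first exact: descent_class_mem cy.
  by rewrite /= [X in (X, _)]tt.
have v := comp_val_class (graded_w12_01 gW h12 h01) (graded_w012 gW h12 h01)
  (graded_w02 gW h12 h01)
  (graded_adjoint (graded_Sigma (graded_w012 gW h12 h01) (graded_w12_01 gW h12 h01)
     (graded_w_span gW h12 h01)))
  (graded_Sigma (graded_w012 gW h12 h01) (graded_w02 gW h12 h01)
     (graded_w_M gW h12 h01)) cy.
rewrite [LHS]v; congr lie_mul; congr lie_inv; exact: vt.
Qed.
End Value.

(** A plot of the multiplication lifts locally twice, through the quotient defining
    the composite and through the one defining the tensor product. *)
Lemma w_mul_plot_lift : @fa_plot R _ (st_bundle (w_mul W)) V U i a ->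
  forall u, U u -> exists N (x y e : V -> elts E), [/\ open N /\ N u,
    [/\ @sp_plot R (rb_E W) V (U `&` N) x, @sp_plot R (rb_E W) V (U `&` N) y
      & @sp_plot R (rb_E W) V (U `&` N) e]
    & forall u', U u' -> N u' -> bu_proj (a u') = ((tgt (x u'), tgt (y u')), tgt (e u'))
      /\ w_mul_val g (a u') =
         lie_mul (lie_inv (twist (gr_path g (src (x u'))) (gr_lift g (x u'))
                     (gr_lift g (y u')))) (gr_lift g (e u'))].
Proof.
move=> pa u Uu; have [N [s [[oN Nu] [[[[pw ptens] ss] [[pw2 pe] se]] ms] sE]]] := pa u Uu.
have [N' [t [[oN' N'u] [px py] tE]]] := ptens u (conj Uu Nu).
exists (N `&` N'), (fst \o t), (snd \o t), (fun v => (s v).2.2).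
have NN : U `&` (N `&` N') = (U `&` N) `&` N' by rewrite setIA.
have [[px1 px2] [py1 py2]] := (px, py); have [[pw1 pw3] [pe1 pe2]] := (pw, pe).
have [pv1 pv3] := pw2.
rewrite NN; split; [by split; [exact: openI|]| |].
  by split; [exact: px1 | exact: py1 | apply: (plot_restrict ES) => //; exact: pe1].
move=> u' Uu' [Nu' N'u']; have UN : (U `&` N) u' by [].
have UNN : ((U `&` N) `&` N') u' by [].
have mw : pt (i u') ((s u').1.1 : pts (w_gerbe012 W)).
  by split; [exact: plot_mem ZS _ _ _ _ pw1 UN | exact: pw3].
have mw2 : pt (i u') ((s u').2.1 : pts (w_gerbe012 W)).
  by split; [exact: plot_mem ZS _ _ _ _ pv1 UN | exact: pv3].
have mx : el (e12 (i u')) ((t u').1 : elts E).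
  by split; [exact: plot_mem ES _ _ _ _ px1 UNN | exact: px2].
have my : el (e01 (i u')) ((t u').2 : elts E).
  by split; [exact: plot_mem ES _ _ _ _ py1 UNN | exact: py2].
have me : el (e02 (i u')) ((s u').2.2 : elts E).
  by split; [exact: plot_mem ES _ _ _ _ pe1 UN | exact: pe2].
have tu : @tens R _ (pull_gerbe e12 E) (pull_gerbe e01 E) (t u').1 (t u').2 = (s u').1.2.
  exact: tE u' UN N'u'.
have sx : (src ((t u').1 : elts E), src ((t u').2 : elts E)) =
  (rb_face_2_0 (s u').1.1, rb_face_2_2 (s u').1.1).
  by have := ss u' UN; rewrite /= -tu.
have ww : (s u').1.1 = (s u').2.1 := ms u' UN.
have [_ p v] := w_mul_class mw mw2 mx my me sx (se u' UN) ww.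
have <- : descent_class (s := adjoint_inverse (Sigma (w_span W)))
    (t := Sigma (w_M W)) (i u') (((s u').1.1,
      @tens R _ (pull_gerbe e12 E) (pull_gerbe e01 E) (t u').1 (t u').2),
      ((s u').2.1, (s u').2.2)) = a u'.
  rewrite -(sE u' Uu' Nu') tu; congr descent_class.
  by case: (s u') => -[? ?] [? ?].
by split.
Qed.

(** Conversely smooth representatives over the whole parameter set serve as lifts
    for both quotients. *)
Lemma w_mul_plot_build (w : V -> pts (w_gerbe012 W)) (x y e : V -> elts E) :
  @sp_plot R (rb_Z2 W) V U w -> @sp_plot R (rb_E W) V U x ->
  @sp_plot R (rb_E W) V U y -> @sp_plot R (rb_E W) V U e ->
  (forall u, U u -> [/\ pt (i u) (w u), el (e12 (i u)) (x u), el (e01 (i u)) (y u)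
    & el (e02 (i u)) (e u)]) ->
  (forall u, U u -> (src (x u), src (y u)) = (rb_face_2_0 (w u), rb_face_2_2 (w u))
    /\ src (e u) = rb_face_2_1 (w u)) ->
  (forall u, U u -> [/\ st_mem (i u) (a u),
    bu_proj (a u) = ((tgt (x u), tgt (y u)), tgt (e u))
    & w_mul_val g (a u) =
         lie_mul (lie_inv (twist (gr_path g (src (x u))) (gr_lift g (x u))
                     (gr_lift g (y u)))) (gr_lift g (e u))]) ->
  @fa_plot R _ (st_bundle (w_mul W)) V U i a.
Proof.
move=> pw px py pe m ss av u Uu.
exists setT, (fun v => ((w v, @tens R _ (pull_gerbe e12 E) (pull_gerbe e01 E) (x v) (y v)),
  (w v, e v))); rewrite setIT; split=> //; first by split=> //; exact: openT.
  split; last by [].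
  split.
    split; last by move=> v Uv; have [] := ss v Uv.
    split; first by split; [exact: pw | move=> v Uv; have [[]] := m v Uv].
    move=> v Uv; exists setT, (fun v => (x v, y v)); rewrite setIT.
    split=> //; first by split=> //; exact: openT.
    split; split=> // v' Uv'; first by have [_ []] := m v' Uv'.
    by have [_ _ []] := m v' Uv'.
  split; last by move=> v Uv; have [] := ss v Uv.
  split; first by split; [exact: pw | move=> v Uv; have [[]] := m v Uv].
  by split; [exact: pe | move=> v Uv; have [_ _ _ []] := m v Uv].
move=> v Uv _; have [mw mx my me] := m v Uv; have [sx se] := ss v Uv.
have [ma pa va] := av v Uv; have [ml pl vl] := w_mul_class mw mw mx my me sx se erefl.
have [f1 _ f3 _] := gr_face2 gW mw.
have gm : graded_stable (i v) (w_grading12_01 g) (pull_grading e02 g) (w_mul_val g).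
  by apply: graded_w_mul => //; eexists; [exact: f1 | exact: f3].
apply: (st_inj gm ml ma); first exact: etrans pl (esym pa).
exact: etrans vl (esym va).
Qed.
End MultiplicationPlots.

(** * The rigid Chern-Simons bundle 2-gerbe *)

Section RigidChernSimons.
Variables (R : realType) (G : lie_group R) (X : fmanifold R) (Q : principal_bundle G X).
Variables (B : lie_alg G -> lie_alg G -> R) (L : level1_extension B).
Local Notation "p **p q" := (@path_mul R G p q) (at level 40, left associativity).
Local Notation pinv := (@path_inv R G).
Local Notation E := (w_gerbe (CS Q L)).
Local Notation ev y p := (pb_act y (p (2 * pi))).

Definition cs_grading : grading L E :=
  @Grading R G B L _ E (fun z : Q * (R -> G) => z.2) (fun e : Q * (R -> G) * L => e.2).

Lemma cs_ptP j (z : Q * (R -> G)) :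
  pt j (z : pts E) <-> is_path z.2 /\ (z.1, ev z.1 z.2) = j.
Proof. by split=> [[[]]|[? ?]]. Qed.

Lemma cs_elP j (e : Q * (R -> G) * L) : el j (e : elts E) <-> pt j (e.1 : pts E).
Proof. by case: e => -[y p] c; split=> [[[[_ pp] _] ej]|[[_ pp] ej]]; split. Qed.

Lemma cs_pt012P i (w : Q * (R -> G) * (R -> G)) :
  pt i (w : pts (w_gerbe012 (CS Q L))) <->
  [/\ is_path w.1.2, is_path w.2
    & (w.1.1, ev w.1.1 w.1.2, ev (ev w.1.1 w.1.2) w.2) = i].
Proof. by case: w => -[y p] q; split=> [[[[_ ?] ?] ?]|[? ? ?]]. Qed.

Lemma cs_pt0123P i (z : Q * (R -> G) * (R -> G) * (R -> G)) :
  pt i (z : pts (w_gerbe0123 (CS Q L))) <->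
  [/\ is_path z.1.1.2, is_path z.1.2, is_path z.2
    & let: (y, p, q, r) := z in
      (y, ev y p, ev (ev y p) q, ev (ev (ev y p) q) r) = i].
Proof. by case: z => -[[y p] q] r; split=> [[[[[_ ?] ?] ?] ?]|[? ? ? ?]]. Qed.

Lemma ev_mul (y : Q) (p q : R -> G) : ev y (p **p q) = ev (ev y p) q.
Proof. by rewrite /path_mul pb_actM. Qed.

Lemma cs_graded_gerbe j : (exists z : pts E, pt j z) -> graded_gerbe j cs_grading.
Proof.
move=> wj; split=> //; first by move=> z /cs_ptP [].
- split.
  + move=> [[y p] c] me; have /cs_elP mz := me.
    have [pp jE] := (cs_ptP _ _).1 mz; rewrite /= in pp jE.
    have [pc lc] := le_proj_loop c; split.
      split; first exact: mz.
      apply/cs_ptP; split; first exact: is_path_mul.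
      by rewrite -jE /= /path_mul lc lie_mulg1.
    by rewrite /difference /= path_mulKg.
  + move=> [[y p] [y' p']] [mz mz']; rewrite /= in mz mz'.
    have [pp jE] := (cs_ptP _ _).1 mz; have [pp' jE'] := (cs_ptP _ _).1 mz'.
    rewrite /= in pp jE pp' jE'; move: jE'; rewrite -jE => -[yy pe].
    subst y'; have {}pe := pb_act_free pe.
    have [c cE] : exists c : L, le_proj c = pinv p **p p'.
      apply: le_proj_surj; first exact/is_path_mul/pp'/is_path_inv.
      by rewrite /path_mul /path_inv pe lie_mulVg.
    exists (y, p, c); first by apply/cs_elP.
    by rewrite /= cE path_mulVKg.
  + by move=> [[y p] c] [[y' p'] c'] _ _ /= [-> -> _ _] /= ->.
  + move=> [[y p] c] z me cz; split.
    * by apply/cs_elP; exact/(cs_elP _ _).1/me.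
    * by rewrite /= le_projM le_proj_incl // path_mulg1.
    * by [].
- move=> [[y p] c] [[y' p'] c'] me me' ee.
  have [yy pp] : y = y' /\ p **p le_proj c = p' by case: ee.
  split=> //.
  by rewrite /tgt /= -yy -pp le_projM path_mulA.
Qed.

(** The formula for M is the horizontal product twist; the face conditions are the
    associativity of path multiplication and of the action of G. *)
Lemma cs_graded : graded_rigid cs_grading.
Proof.
split.
- exact: cs_graded_gerbe.
- move=> i [[y p] q] /cs_pt012P [/= pp qq <-]; split=> //; apply/cs_ptP => //.
  by split; [exact: is_path_mul | rewrite /= ev_mul].
- move=> [[y0 y1] y2] [[y q] /cs_ptP [/= qq [y1E' y2E]]].
  move=> [[y' p] /cs_ptP [/= pp [y0E y1E]]]; exists (y', p, q).
  by apply/cs_pt012P; split=> //=; rewrite y1E -y1E' y2E y0E.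
- move=> i [[y p] q] [[y' p'] q'] [[ya pa] ca] [[yb pb] cb].
  move=> /cs_pt012P [/= pp qq iE] _ _ _ [-> ->] [-> ->] [_ tq] [ty tp]; split=> //.
  + apply/cs_elP/cs_ptP; split; first exact: is_path_mul.
    by rewrite -iE /= ev_mul.
  + rewrite /tgt /= -tq -ty -tp le_projM le_Ad_proj; last exact: is_path_inv.
    by rewrite path_invK -!path_mulA path_mulVKg.
- move=> i [[[y p] q] r] /cs_pt0123P [/= pp qq rr <-]; split=> //.
  + apply/cs_pt012P; split=> //=; first exact: is_path_mul.
    by rewrite !ev_mul.
  + apply/cs_pt012P; split=> //=; first exact: is_path_mul.
    by rewrite !ev_mul.
- move=> [[[x0 x1] x2] x3] [[y2 r] /cs_ptP [/= rr [e2' e3]]].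
  move=> [[y1 q] /cs_ptP [/= qq [e1' e2]]] [[y0 p] /cs_ptP [/= pp [e0 e1]]].
  exists (y0, p, q, r); apply/cs_pt0123P; split=> //=.
  by rewrite e1 -e1' e2 -e2' e3 e0.
- by move=> [[[y p] q] r]; split=> //=; rewrite ?ev_mul ?path_mulA.
Qed.
End RigidChernSimons.

(** * Strictly associative multiplications *)

Section StrictMultiplication.
Variables (R : realType) (G : lie_group R) (B : lie_alg G -> lie_alg G -> R).
Variable L : level1_extension B.
Variables (Y : Type) (E : gerbe R (Y * Y)).
Variable m : gerbe_map (product12_01 E) (pull_gerbe e02 E).
Local Notation grading := (@grading R G B L _).
Local Notation E_ p := (pull_gerbe p E).
Local Notation Sval gC f := (@Sigma_val _ _ _ L _ _ _ gC f).
Local Notation Pval f phi := (@pre_val _ _ _ L _ _ _ _ f _ phi).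

Definition m123 : gerbe_map (tensor_gerbe (E_ g23) (E_ g12)) (E_ g13) := pull_map f123 m.
Definition m012 : gerbe_map (tensor_gerbe (E_ g12) (E_ g01)) (E_ g02) := pull_map f012 m.
Definition m013 : gerbe_map (tensor_gerbe (E_ g13) (E_ g01)) (E_ g03) := pull_map f013 m.
Definition m023 : gerbe_map (tensor_gerbe (E_ g23) (E_ g02)) (E_ g03) := pull_map f023 m.

Definition strict_map_source :
    gerbe_map (tensor_gerbe (tensor_gerbe (E_ g23) (E_ g12)) (E_ g01)) (E_ g03) :=
  comp_map (tensor_map m123 (id_map (E_ g01))) m013.

Definition strict_map_target :
    gerbe_map (tensor_gerbe (tensor_gerbe (E_ g23) (E_ g12)) (E_ g01)) (E_ g03) :=
  comp_map
    (comp_map (tensor_assoc (E_ g23) (E_ g12) (E_ g01))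
              (tensor_map (id_map (E_ g23)) m012))
    m023.

Definition strict_assoc_source :
    two_arrow (assoc_source (Sigma m)) (Sigma strict_map_source) :=
  vcomp (hcomp (htensor (@pull_Sigma R _ _ f123 _ _ m) (vid (id_stable (E_ g01))))
               (@pull_Sigma R _ _ f013 _ _ m))
  (vcomp (whisker_r (Sigma m013) (Sigma_tensor m123 (id_map (E_ g01))))
         (Sigma_comp (tensor_map m123 (id_map (E_ g01))) m013)).

Definition strict_assoc_target :
    two_arrow (assoc_target (Sigma m)) (Sigma strict_map_target) :=
  let a := tensor_assoc (E_ g23) (E_ g12) (E_ g01) in
  let g := tensor_map (id_map (E_ g23)) m012 in
  vcomp (hcomp (hprecompose a
                  (htensor (vid (id_stable (E_ g23))) (@pull_Sigma R _ _ f012 _ _ m)))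
               (@pull_Sigma R _ _ f023 _ _ m))
  (vcomp (whisker_r (Sigma m023)
            (vcomp (hprecompose a (Sigma_tensor (id_map (E_ g23)) m012))
                   (precompose_Sigma a g)))
         (Sigma_comp (comp_map a g) m023)).

(** The identity 2-arrow, where the two sides are the same morphism of bundle
    gerbes. *)
Definition strict_assoc : two_arrow (assoc_source (Sigma m)) (assoc_target (Sigma m)) :=
  vcomp strict_assoc_source
    (vcomp (equality_arrow strict_map_source strict_map_target)
      (vinv strict_assoc_target)).

Variable g : grading E.
Local Notation gE p := (pull_grading p g).

Definition strict_mul_val : st_elts (Sigma m) -> L := Sval (gE e02) m.

Variable i : Y * Y * Y * Y.
Hypotheses (h01 : graded_gerbe (g01 i) g) (h12 : graded_gerbe (g12 i) g).
Hypotheses (h23 : graded_gerbe (g23 i) g) (h02 : graded_gerbe (g02 i) g).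
Hypotheses (h13 : graded_gerbe (g13 i) g) (h03 : graded_gerbe (g03 i) g).
Local Notation graded_mul j :=
  (graded_map j (tensor_grading (gE e12) (gE e01)) (gE e02) m).
Hypotheses (gm123 : graded_mul (f123 i)) (gm013 : graded_mul (f013 i)).
Hypotheses (gm012 : graded_mul (f012 i)) (gm023 : graded_mul (f023 i)).
Hypothesis mulA : forall a b c : pts E,
  gm_fun m (gm_fun m (a, b), c) = gm_fun m (a, gm_fun m (b, c)).

Let E23 : graded_gerbe i (gE g23) := graded_pull_gerbe h23.
Let E12 : graded_gerbe i (gE g12) := graded_pull_gerbe h12.
Let E01 : graded_gerbe i (gE g01) := graded_pull_gerbe h01.
Let E13 : graded_gerbe i (gE g13) := graded_pull_gerbe h13.
Let E02 : graded_gerbe i (gE g02) := graded_pull_gerbe h02.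
Let E03 : graded_gerbe i (gE g03) := graded_pull_gerbe h03.
Let E23_12 := graded_tensor_gerbe E23 E12.
Let E12_01 := graded_tensor_gerbe E12 E01.
Let E23_12_01 := graded_tensor_gerbe E23_12 E01.
Let E13_01 := graded_tensor_gerbe E13 E01.
Let E23_02 := graded_tensor_gerbe E23 E02.
Let E23_p12_01 := graded_tensor_gerbe E23 E12_01.

Let M123 : graded_map i (tensor_grading (gE g23) (gE g12)) (gE g13) m123.
Proof. exact: (graded_pull_map gm123). Qed.
Let M012 : graded_map i (tensor_grading (gE g12) (gE g01)) (gE g02) m012.
Proof. exact: (graded_pull_map gm012). Qed.
Let M013 : graded_map i (tensor_grading (gE g13) (gE g01)) (gE g03) m013.
Proof. exact: (graded_pull_map gm013). Qed.
Let M023 : graded_map i (tensor_grading (gE g23) (gE g02)) (gE g03) m023.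
Proof. exact: (graded_pull_map gm023). Qed.

Let prod_gerbe j (k12 : graded_gerbe (e12 j) g) (k01 : graded_gerbe (e01 j) g) :
  graded_gerbe j (tensor_grading (gE e12) (gE e01)) :=
  graded_tensor_gerbe (graded_pull_gerbe k12) (graded_pull_gerbe k01).
Let target_gerbe (j : Y * Y * Y) (k02 : graded_gerbe (e02 j) g) :
  graded_gerbe j (gE e02) := graded_pull_gerbe k02.

Let p123 := graded_pull_Sigma (h := f123) (prod_gerbe (j := f123 i) h23 h12)
  (target_gerbe (j := f123 i) h13) gm123.
Let p013 := graded_pull_Sigma (h := f013) (prod_gerbe (j := f013 i) h13 h01)
  (target_gerbe (j := f013 i) h03) gm013.
Let p012 := graded_pull_Sigma (h := f012) (prod_gerbe (j := f012 i) h12 h01)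
  (target_gerbe (j := f012 i) h02) gm012.
Let p023 := graded_pull_Sigma (h := f023) (prod_gerbe (j := f023 i) h23 h02)
  (target_gerbe (j := f023 i) h03) gm023.

Let s123 : graded_stable (A := tensor_gerbe (E_ g23) (E_ g12)) (C := E_ g13) i
  (tensor_grading (gE g23) (gE g12)) (gE g13) (s := pull_stable f123 (Sigma m))
  (pull_val (h := f123) strict_mul_val).
Proof.
exact: (graded_pull_stable (graded_Sigma (prod_gerbe (j := f123 i) h23 h12)
  (target_gerbe (j := f123 i) h13) gm123)).
Qed.
Let s013 : graded_stable (A := tensor_gerbe (E_ g13) (E_ g01)) (C := E_ g03) i
  (tensor_grading (gE g13) (gE g01)) (gE g03) (s := pull_stable f013 (Sigma m))
  (pull_val (h := f013) strict_mul_val).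
Proof.
exact: (graded_pull_stable (graded_Sigma (prod_gerbe (j := f013 i) h13 h01)
  (target_gerbe (j := f013 i) h03) gm013)).
Qed.
Let s012 : graded_stable (A := tensor_gerbe (E_ g12) (E_ g01)) (C := E_ g02) i
  (tensor_grading (gE g12) (gE g01)) (gE g02) (s := pull_stable f012 (Sigma m))
  (pull_val (h := f012) strict_mul_val).
Proof.
exact: (graded_pull_stable (graded_Sigma (prod_gerbe (j := f012 i) h12 h01)
  (target_gerbe (j := f012 i) h02) gm012)).
Qed.
Let s023 : graded_stable (A := tensor_gerbe (E_ g23) (E_ g02)) (C := E_ g03) i
  (tensor_grading (gE g23) (gE g02)) (gE g03) (s := pull_stable f023 (Sigma m))
  (pull_val (h := f023) strict_mul_val).
Proof.
exact: (graded_pull_stable (graded_Sigma (prod_gerbe (j := f023 i) h23 h02)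
  (target_gerbe (j := f023 i) h03) gm023)).
Qed.

Local Notation strict_source_val := (assoc_source_val g strict_mul_val).
Local Notation strict_target_val := (assoc_target_val g strict_mul_val).

Let sid01 := graded_id E01.
Let sid23 := graded_id E23.
Let id01 := graded_id_map E01.
Let id23 := graded_id_map E23.
Let triple := tensor_grading (tensor_grading (gE g23) (gE g12)) (gE g01).

Lemma graded_strict_source : graded_stable i triple (gE g03) strict_source_val.
Proof.
exact: (graded_compose E23_12_01 E13_01 E03
  (graded_tensor_stable E23_12 E13 E01 E01 s123 sid01) s013).
Qed.

Let amap := graded_tensor_assoc E23 E12 E01.

Lemma graded_strict_target : graded_stable i triple (gE g03) strict_target_val.
Proof.
exact: (graded_compose E23_12_01 E23_02 E03
  (graded_precompose E23_12_01 E23_p12_01 amap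
    (graded_tensor_stable E23 E23 E12_01 E02 sid23 s012)) s023).
Qed.

Let t1 := graded_tensor_map E23_12 E01 E13 E01 M123 id01.
Let msource : graded_map i triple (gE g03) strict_map_source :=
  graded_comp_map E13_01 E03 t1 M013 E23_12_01.
Let t2 := graded_tensor_map E23 E12_01 E23 E02 id23 M012.
Let at2 := graded_comp_map E23_p12_01 E23_02 amap t2 E23_12_01.
Let mtarget : graded_map i triple (gE g03) strict_map_target :=
  graded_comp_map E23_02 E03 at2 M023 E23_12_01.

Lemma graded_strict_assoc_source :
  graded_arrow i strict_source_val (Sval (gE g03) strict_map_source) strict_assoc_source.
Proof.
have S123 := graded_Sigma E23_12 E13 M123; have S013 := graded_Sigma E13_01 E03 M013.
have St1 := graded_Sigma E23_12_01 E13_01 t1.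
have r1 := graded_tensor_stable E23_12 E13 E01 E01 s123 sid01.
have r2 := graded_tensor_stable E23_12 E13 E01 E01 S123 sid01.
have b1 := graded_htensor E23_12 s123 S123 sid01 sid01 p123 (graded_vid sid01).
have b2 := graded_hcomp E23_12_01 E13_01 E03 r1 r2 s013 S013 b1 p013.
have b3 := graded_Sigma_tensor E23_12 E01 E13 E01 M123 id01.
have b4 := graded_hcomp E23_12_01 E13_01 E03 r2 St1 S013 S013 b3 (graded_vid S013).
have b5 := graded_Sigma_comp E23_12_01 E13_01 E03 t1 M013.
have c := graded_vcomp graded_strict_source (graded_compose E23_12_01 E13_01 E03 r2 S013) b2
  (graded_vcomp (graded_compose E23_12_01 E13_01 E03 r2 S013)
    (graded_compose E23_12_01 E13_01 E03 St1 S013) b4 b5).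
(* the 2-arrow unfolds to this pasting *)
exact_no_check c.
Qed.

Lemma graded_strict_assoc_target :
  graded_arrow i strict_target_val (Sval (gE g03) strict_map_target) strict_assoc_target.
Proof.
have S012 := graded_Sigma E12_01 E02 M012; have S023 := graded_Sigma E23_02 E03 M023.
have St2 := graded_Sigma E23_p12_01 E23_02 t2.
have Sat2 := graded_Sigma E23_12_01 E23_02 at2.
have r1 := graded_tensor_stable E23 E23 E12_01 E02 sid23 s012.
have r2 := graded_tensor_stable E23 E23 E12_01 E02 sid23 S012.
have q1 := graded_precompose E23_12_01 E23_p12_01 amap r1.
have q2 := graded_precompose E23_12_01 E23_p12_01 amap r2.
have q3 := graded_precompose E23_12_01 E23_p12_01 amap St2.
have b1 := graded_hprecompose (f := tensor_assoc _ _ _)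
  (graded_htensor E23 sid23 sid23 s012 S012 (graded_vid sid23) p012).
have b2 := graded_hcomp E23_12_01 E23_02 E03 q1 q2 s023 S023 b1 p023.
have b3 := graded_hprecompose (f := tensor_assoc _ _ _)
  (graded_Sigma_tensor E23 E12_01 E23 E02 id23 M012).
have b4 := graded_precompose_Sigma E23_12_01 E23_p12_01 E23_02 amap t2.
have b5 := graded_hcomp E23_12_01 E23_02 E03 q2 Sat2 S023 S023
  (graded_vcomp q2 q3 b3 b4) (graded_vid S023).
have b6 := graded_Sigma_comp E23_12_01 E23_02 E03 at2 M023.
have c := graded_vcomp graded_strict_target (graded_compose E23_12_01 E23_02 E03 q2 S023) b2
  (graded_vcomp (graded_compose E23_12_01 E23_02 E03 q2 S023)
    (graded_compose E23_12_01 E23_02 E03 Sat2 S023) b5 b6).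
(* the 2-arrow unfolds to this pasting *)
exact_no_check c.
Qed.

Lemma graded_strict_assoc :
  graded_arrow i strict_source_val strict_target_val strict_assoc.
Proof.
have gs := graded_Sigma E23_12_01 E03 msource.
have gt := graded_Sigma E23_12_01 E03 mtarget.
have same (a : pts (tensor_gerbe (tensor_gerbe (E_ g23) (E_ g12)) (E_ g01))) :
    pt i a -> gm_fun strict_map_source a = gm_fun strict_map_target a.
  by move=> _; case: a => -[a b] c; exact: mulA a b c.
have gid := graded_equality E23_12_01 E03 msource same.
exact: (graded_vcomp graded_strict_source gs graded_strict_assoc_source
  (graded_vcomp gs gt gid (graded_vinv graded_strict_assoc_target))).
Qed.
End StrictMultiplication.

(** * The Chern-Simons bundle 2-gerbe *)

Section ChernSimonsSide.
Variables (R : realType) (G : lie_group R) (X : fmanifold R) (Q : principal_bundle G X).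
Variables (B : lie_alg G -> lie_alg G -> R) (L : level1_extension B).
Local Notation "p **p q" := (@path_mul R G p q) (at level 40, left associativity).
Local Notation pinv := (@path_inv R G).
Local Notation E := (C_gerbe Q L).
Local Notation to_nerve1 := (@to_nerve1 R G X Q).

Definition c_grading : grading L E :=
  @Grading R G B L _ E (fun p : R -> G => p) (fun e : (R -> G) * L => e.2).

Lemma c_ptP j (p : R -> G) :
  pt j (p : pts E) <-> is_path p /\ p (2 * pi) = to_nerve1 j.
Proof. by []. Qed.

Lemma c_elP j (e : (R -> G) * L) : el j (e : elts E) <-> pt j (e.1 : pts E).
Proof. by case: e => p c; split=> [[[pp _] ej]|[pp ej]]; split. Qed.

Lemma c_graded_gerbe j : (exists p : pts E, pt j p) -> graded_gerbe j c_grading.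
Proof.
move=> wj; split=> //; first by move=> p /c_ptP [].
- split.
  + move=> [p c] me; have /c_elP mz := me.
    have [pp jE] := (c_ptP _ _).1 mz; rewrite /= in pp jE.
    have [pc lc] := le_proj_loop c; split.
      split; first exact: mz.
      apply/c_ptP; split; first exact: is_path_mul.
      by rewrite -jE /= /path_mul lc lie_mulg1.
    by rewrite /difference /= path_mulKg.
  + move=> [p p'] [mz mz']; rewrite /= in mz mz'.
    have [pp jE] := (c_ptP _ _).1 mz; have [pp' jE'] := (c_ptP _ _).1 mz'.
    have [c cE] : exists c : L, le_proj c = pinv p **p p'.
      apply: le_proj_surj; first exact/is_path_mul/pp'/is_path_inv.
      by rewrite /path_mul /path_inv jE jE' lie_mulVg.
    exists (p, c); first by apply/c_elP.
    by rewrite /= cE path_mulVKg.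
  + by move=> [p c] [p' c'] _ _ /= [-> _] /= ->.
  + move=> [p c] z me cz; split.
    * by apply/c_elP; exact/(c_elP _ _).1/me.
    * by rewrite /= le_projM le_proj_incl // path_mulg1.
    * by [].
- move=> [p c] [p' c'] me me' pp; rewrite /tgt /src /= in pp.
  split=> //.
  by rewrite /tgt /= -pp le_projM path_mulA.
Qed.

Section Multiplication.
Variable i : Q * Q * Q.
Hypothesis iX : sp_mem (i : fibre3 (@pb_proj R G X Q : space_of Q -> X)).

Lemma to_nerve_mul :
  lie_mul (to_nerve1 (e01 i)) (to_nerve1 (e12 i)) = to_nerve1 (e02 i).
Proof.
case: i iX => -[y0 y1] y2 [[[_ /= e1] _] /= e2].
rewrite /to_nerve1 /e01 /e12 /e02 /=; apply: (@pb_act_free _ _ _ _ y0).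
by rewrite pb_actM !pb_actK // e1.
Qed.

Hypotheses (h12 : exists p : pts E, pt (e12 i) p) (h01 : exists p : pts E, pt (e01 i) p).

Let ptM (q p : R -> G) : pt (e12 i) (q : pts E) -> pt (e01 i) (p : pts E) ->
  pt (e02 i) (p **p q : pts E).
Proof.
move=> /c_ptP [qq qE] /c_ptP [pp pE]; apply/c_ptP; split; first exact: is_path_mul.
by rewrite -to_nerve_mul /path_mul pE qE.
Qed.

Lemma c_inhabited02 : exists p : pts E, pt (e02 i) p.
Proof.
by have [q mq] := h12; have [p mp] := h01; exists (p **p q); exact: ptM.
Qed.

Let E12 := graded_pull_gerbe (c_graded_gerbe h12).
Let E01 := graded_pull_gerbe (c_graded_gerbe h01).
Let E02 := graded_pull_gerbe (c_graded_gerbe c_inhabited02).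

(** The multiplication is given on U(1)-bundles by the horizontal product twist. *)
Lemma graded_C_map : graded_map i
  (tensor_grading (pull_grading e12 c_grading) (pull_grading e01 c_grading))
  (pull_grading e02 c_grading) (C_map Q L).
Proof.
apply: graded_mapP E02 _ _; first by move=> [q p] [mq mp]; split; first exact: ptM.
move=> e me; split.
  have [[[b a] eba] _] := tensor_el_memP E12 E01 me.
  by exists (a.1 **p b.1, lie_mul (le_Ad (pinv b.1) a.2) b.2), b, a.
move=> e' [[q b] [[p a] [eba ->]]].
have [[mb ma] se te ve] := tensor_elP E12 E01 me eba.
have /c_elP mq := mb; have /c_elP mp := ma.
rewrite se te ve; split=> //; first by apply/c_elP; exact: ptM.
rewrite /tgt /= le_projM le_Ad_proj; last first.
  by apply: is_path_inv; case/c_ptP: mq.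
by rewrite path_invK -!path_mulA path_mulVKg.
Qed.

Lemma graded_C_mul : graded_mul_at c_grading (strict_mul_val (m := C_map Q L) c_grading) i.
Proof. exact: (graded_Sigma (graded_tensor_gerbe E12 E01) E02 graded_C_map). Qed.
End Multiplication.

Section Associator.
Variable i : Q * Q * Q * Q.
Hypothesis iX : sp_mem (i : fibre4 (@pb_proj R G X Q : space_of Q -> X)).

Lemma fibre4_faces : [/\ sp_mem (f123 i : fibre3 (@pb_proj R G X Q : space_of Q -> X)),
  sp_mem (f012 i : fibre3 (@pb_proj R G X Q : space_of Q -> X)),
  sp_mem (f013 i : fibre3 (@pb_proj R G X Q : space_of Q -> X))
  & sp_mem (f023 i : fibre3 (@pb_proj R G X Q : space_of Q -> X))].
Proof.
case: i iX => -[[y0 y1] y2] y3 [[[[[/= _ e1] _] /= e2] _] /= e3].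
by split; repeat split; rewrite /= ?e1 ?e2 ?e3.
Qed.

Hypotheses (h23 : exists p : pts E, pt (g23 i) p) (h12 : exists p : pts E, pt (g12 i) p).
Hypothesis h01 : exists p : pts E, pt (g01 i) p.

Let h13 : exists p : pts E, pt (g13 i) p.
Proof. by have [i123 _ _ _] := fibre4_faces; exact: (@c_inhabited02 (f123 i)). Qed.
Let h02 : exists p : pts E, pt (g02 i) p.
Proof. by have [_ i012 _ _] := fibre4_faces; exact: (@c_inhabited02 (f012 i)). Qed.
Let h03 : exists p : pts E, pt (g03 i) p.
Proof. by have [_ _ i013 _] := fibre4_faces; exact: (@c_inhabited02 (f013 i)). Qed.

Lemma graded_C_edges : graded_edges c_grading i.
Proof. by split; [..|split]; exact: c_graded_gerbe. Qed.

Lemma graded_C_faces : let phi := strict_mul_val (m := C_map Q L) c_grading in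
  [/\ graded_mul_at c_grading phi (f123 i), graded_mul_at c_grading phi (f013 i),
      graded_mul_at c_grading phi (f012 i) & graded_mul_at c_grading phi (f023 i)].
Proof.
have [i123 i012 i013 i023] := fibre4_faces.
split; [exact: (graded_C_mul (i := f123 i) i123 h23 h12)
  | exact: (graded_C_mul (i := f013 i) i013 h13 h01)
  | exact: (graded_C_mul (i := f012 i) i012 h12 h01)
  | exact: (graded_C_mul (i := f023 i) i023 h23 h02)].
Qed.

Lemma graded_C_assoc :
  graded_arrow i (assoc_source_val c_grading (strict_mul_val (m := C_map Q L) c_grading))
    (assoc_target_val c_grading (strict_mul_val (m := C_map Q L) c_grading))
    (@C_assoc R G X Q B L).
Proof.
have [i123 i012 i013 i023] := fibre4_faces.
apply: (@graded_strict_assoc R G B L _ E (C_map Q L) c_grading i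
  (c_graded_gerbe h01) (c_graded_gerbe h12) (c_graded_gerbe h23) (c_graded_gerbe h02)
  (c_graded_gerbe h13) (c_graded_gerbe h03)
  (graded_C_map (i := f123 i) i123 h23 h12) (graded_C_map (i := f013 i) i013 h13 h01)
  (graded_C_map (i := f012 i) i012 h12 h01) (graded_C_map (i := f023 i) i023 h23 h02)).
by move=> a b c; exact: path_mulA.
Qed.
End Associator.
End ChernSimonsSide.

(** * The isomorphism *)

Section Comparison.
Variables (R : realType) (G : lie_group R) (X : fmanifold R) (Q : principal_bundle G X).
Variables (B : lie_alg G -> lie_alg G -> R) (L : level1_extension B).
Local Notation "p **p q" := (@path_mul R G p q) (at level 40, left associativity).
Local Notation pinv := (@path_inv R G).
Local Notation W := (CS Q L).
Local Notation E := (w_gerbe (CS Q L)).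
Local Notation C := (C_gerbe Q L).
Local Notation ev y p := (pb_act y (p (2 * pi))).
Local Notation wg := (cs_grading Q L).
Local Notation cg := (c_grading Q L).
Local Notation G1 := (w W).
Local Notation G2 := (chern_simons_2_gerbe Q L).
Local Notation idQ := (fun y : Q => y).
Local Notation fib2 := (fibre2 (@pb_proj R G X Q : space_of Q -> X)).
Local Notation fib3 := (fibre3 (@pb_proj R G X Q : space_of Q -> X)).
Local Notation fib4 := (fibre4 (@pb_proj R G X Q : space_of Q -> X)).

Lemma map2_idE : @map2 R X G1 G2 idQ = (fun j => j).
Proof. by apply: funext => -[y0 y1]. Qed.

Lemma map3_idE : @map3 R X G1 G2 idQ = (fun j => j).
Proof. by apply: funext => -[[y0 y1] y2]. Qed.

Lemma map4_idE : @map4 R X G1 G2 idQ = (fun j => j).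
Proof. by apply: funext => -[[[y0 y1] y2] y3]. Qed.

(** Over a point (y, y') of the fibre square, both submersions have as fibre the
    paths from 1 to the element of the structure group taking y to y'. *)
Lemma cs_c_ptP (j : Q * Q) (z : Q * (R -> G)) : pb_proj j.1 = pb_proj j.2 ->
  pt j (z : pts E) <-> z.1 = j.1 /\ pt j (z.2 : pts C).
Proof.
case: j z => y0 y1 [y p] /= jX; split=> [/cs_ptP [/= pp [<- <-]]|[yE /c_ptP [pp pE]]].
  by split=> //; apply/c_ptP; rewrite /to_nerve1 /= pb_div_act.
by apply/cs_ptP; split=> //=; rewrite yE pE /to_nerve1 pb_actK.
Qed.

Lemma cs_c_elP (j : Q * Q) (e : Q * (R -> G) * L) : pb_proj j.1 = pb_proj j.2 ->
  el j (e : elts E) <-> e.1.1 = j.1 /\ el j ((e.1.2, e.2) : elts C).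
Proof.
move=> jX; split=> [/cs_elP /(cs_c_ptP _ jX) [? ?]|[? /c_elP ?]].
  by split=> //; apply/c_elP.
by apply/cs_elP/(cs_c_ptP _ jX).
Qed.

(** The point of Q in an element of Z_1 is determined by the base point, so
    forgetting it is a bijection. *)
Definition rel_pt (j : Q * Q) (z : pts E) (p : pts C) : Prop :=
  (z : Q * (R -> G)).2 = p.

Definition rel_el (j : Q * Q) (e : elts E) (e' : elts C) : Prop :=
  ((e : Q * (R -> G) * L).1.2, (e : Q * (R -> G) * L).2) = e'.

Lemma identity_diffeo : @is_diffeo_over R X G1 G2 idQ.
Proof. by exists idQ; split. Qed.

Lemma iso_pt : @is_iso_graph R fib2 _ (fun j => j) (ge_fam E) (ge_fam C) rel_pt.
Proof.
have QS := manifold_sheaf Q; have PS := path_sheaf G; split.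
- move=> j z [_ jX] /(cs_c_ptP z jX) [_ mp]; exists z.2; split=> //.
  by move=> p' [].
- move=> j p [_ jX] mp; exists (j.1, p); split=> [|[y p'] [mz /= pp]].
    by split=> //; apply/(cs_c_ptP (j.1, p) jX).
  have [/= yE _] := (cs_c_ptP (y, p') jX).1 mz.
  by rewrite /rel_pt /= in pp; rewrite -yE pp.
- move=> V U i a b [[p1 p2] iX] rab.
  have key u (Uu : U u) : [/\ (a u).1 = (i u).1, (a u).2 = b u & pt (i u) (b u : pts C)].
    have [ma mb ab] := rab u Uu.
    by have [e1 _] := (cs_c_ptP (a u) (iX u Uu)).1 ma.
  split=> [[[_ pa] _]|[pb _]].
    split; last by move=> u Uu; have [_ _ []] := key u Uu.
    by apply: (plot_ext PS) pa => u Uu; have [_ <- _] := key u Uu.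
  split; last by move=> u Uu; have [[]] := rab u Uu.
  split; first by apply: (plot_ext QS) p1 => u Uu; have [aE _ _] := key u Uu; exact: esym aE.
  by apply: (plot_ext PS) pb => u Uu; have [_ aE _] := key u Uu; exact: esym aE.
Qed.

Lemma iso_el : @is_iso_graph R fib2 _ (fun j => j) (ge_bundle E) (ge_bundle C) rel_el.
Proof.
have QS := manifold_sheaf Q; have PS := path_sheaf G; have LS := manifold_sheaf L.
split.
- move=> j e [_ jX] /(cs_c_elP e jX) [_ me]; exists (e.1.2, e.2); split=> //.
  by move=> e' [].
- move=> j [p c] [_ jX] me; exists ((j.1, p), c); split=> [|[[y p'] c'] [mz pp]].
    by split=> //; apply/(cs_c_elP ((j.1, p), c) jX).
  have [/= yE _] := (cs_c_elP ((y, p'), c') jX).1 mz.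
  by move: pp; rewrite /rel_el /= => -[-> ->]; rewrite -yE.
- move=> V U i a b [[p1 p2] iX] rab.
  have key u (Uu : U u) :
      [/\ (a u).1.1 = (i u).1, (a u).1.2 = (b u).1 & (a u).2 = (b u).2].
    have [ma mb ab] := rab u Uu.
    by have [e1 _] := (cs_c_elP (a u) (iX u Uu)).1 ma; rewrite -ab.
  split=> [[[[_ pa] pc] _]|[[pb pc] _]].
    split; last by move=> u Uu; have [_ []] := rab u Uu.
    split; first by apply: (plot_ext PS) pa => u Uu; have [_ aE _] := key u Uu; exact: aE.
    by apply: (plot_ext LS) pc => u Uu; have [_ _ aE] := key u Uu; exact: aE.
  split; last by move=> u Uu; have [[]] := rab u Uu.
  split; last by apply: (plot_ext LS) pc => u Uu; have [_ _ aE] := key u Uu; exact: esym aE.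
  split; first by apply: (plot_ext QS) p1 => u Uu; have [aE _ _] := key u Uu; exact: esym aE.
  by apply: (plot_ext PS) pb => u Uu; have [_ aE _] := key u Uu; exact: esym aE.
Qed.

Lemma gerbe_iso :
  @is_gerbe_iso R fib2 _ (@map2 R X G1 G2 idQ) E C rel_pt rel_el.
Proof.
rewrite map2_idE; split; [exact: iso_pt | exact: iso_el | | |].
- by move=> j [[y p] c] e' _ [_ _ <-].
- by move=> j [[y p] c] e' z _ [_ _ <-].
- by move=> j [[y p] c] [[y' p'] c'] e1 e2 _ [_ _ <-] [_ _ <-].
Qed.

(** In both multiplications the fibre over given points is the set of elements of
    the extension over the same loop; the isomorphism is the identity in these
    coordinates. *)
Definition rel_mul : Q * Q * Q -> st_elts (w_mul W) -> st_elts (Sigma (C_map Q L)) -> Prop :=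
  same_value (w_mul_val wg) (strict_mul_val cg) rel_pt.

Lemma c_inhabited (j : Q * Q) : pb_proj j.1 = pb_proj j.2 ->
  (exists z : pts E, pt j z) -> exists p : pts C, pt j p.
Proof. by move=> jX [z /(cs_c_ptP z jX) [_ ?]]; exists z.2. Qed.

Lemma cs_inhabited (j : Q * Q) : pb_proj j.1 = pb_proj j.2 ->
  (exists p : pts C, pt j p) -> exists z : pts E, pt j z.
Proof. by move=> jX [p mp]; exists (j.1, p); apply/(cs_c_ptP (j.1, p) jX). Qed.

Section Multiplication.
Variable i : Q * Q * Q.
Hypothesis iX : sp_mem (i : fib3).

Let edges : [/\ pb_proj (e12 i).1 = pb_proj (e12 i).2,
  pb_proj (e01 i).1 = pb_proj (e01 i).2 & pb_proj (e02 i).1 = pb_proj (e02 i).2].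
Proof.
by case: i iX => -[y0 y1] y2 [[[_ /= f1] _] /= f2]; split=> //=; rewrite f1.
Qed.

Hypothesis h12 : exists z : pts E, pt (e12 i) z.
Hypothesis h01 : exists z : pts E, pt (e01 i) z.

Let c12 : exists p : pts C, pt (e12 i) p.
Proof. by have [? _ _] := edges; exact: c_inhabited. Qed.
Let c01 : exists p : pts C, pt (e01 i) p.
Proof. by have [_ ? _] := edges; exact: c_inhabited. Qed.

Let gw : graded_stable i (w_grading12_01 wg) (pull_grading e02 wg) (w_mul_val wg) :=
  graded_w_mul (cs_graded Q L) h12 h01.

Let gc : graded_stable i
  (tensor_grading (pull_grading e12 cg) (pull_grading e01 cg)) (pull_grading e02 cg)
  (strict_mul_val (m := C_map Q L) cg) := graded_C_mul iX c12 c01.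

Lemma rel_mul_total (l : st_elts (w_mul W)) : st_mem i l ->
  exists! l', st_mem i l' /\ rel_mul i l l'.
Proof.
move=> ml; have [[m12 m01] m02 lp] := st_ends gw ml; have [x12 x01 x02] := edges.
have [_ n12] := (cs_c_ptP _ x12).1 m12; have [_ n01] := (cs_c_ptP _ x01).1 m01.
have [_ n02] := (cs_c_ptP _ x02).1 m02.
have [||//|l' [ml' pl' vl']] := @st_full _ _ _ _ _ _ _ _ _ _ _ _ gc
  ((((bu_proj l).1.1 : Q * (R -> G)).2, ((bu_proj l).1.2 : Q * (R -> G)).2),
   ((bu_proj l).2 : Q * (R -> G)).2) (w_mul_val wg l) => //.
exists l'; split; first by split=> //; split; rewrite ?pl' ?vl'.
move=> l2 [ml2 [r1 r2 r3 r4]]; apply: (st_inj gc) => //; last by rewrite vl' r4.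
rewrite pl'; case: (bu_proj l2) r1 r2 r3 => -[q p] pq /=.
by rewrite /rel_pt => -> -> ->.
Qed.

Lemma rel_mul_onto (l' : st_elts (Sigma (C_map Q L))) : st_mem i l' ->
  exists! l, st_mem i l /\ rel_mul i l l'.
Proof.
move=> ml; have [[m12 m01] m02 lp] := st_ends gc ml; have [x12 x01 x02] := edges.
have n12 := (cs_c_ptP ((e12 i).1, (bu_proj l').1.1) x12).2 (conj erefl m12).
have n01 := (cs_c_ptP ((e01 i).1, (bu_proj l').1.2) x01).2 (conj erefl m01).
have n02 := (cs_c_ptP ((e02 i).1, (bu_proj l').2) x02).2 (conj erefl m02).
have [||//|l [ml' pl' vl']] := @st_full _ _ _ _ _ _ _ _ _ _ _ _ gw
  ((((e12 i).1, (bu_proj l').1.1), ((e01 i).1, (bu_proj l').1.2)),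
   ((e02 i).1, (bu_proj l').2)) (strict_mul_val cg l') => //.
exists l; split; first by split=> //; split; rewrite ?pl' ?vl'.
move=> l2 [ml2 [r1 r2 r3 r4]]; apply: (st_inj gw) => //; last by rewrite vl' r4.
have [[k12 k01] k02 _] := st_ends gw ml2; rewrite pl'.
have [j12 _] := (cs_c_ptP _ x12).1 k12; have [j01 _] := (cs_c_ptP _ x01).1 k01.
have [j02 _] := (cs_c_ptP _ x02).1 k02.
case: (bu_proj l2) r1 r2 r3 j12 j01 j02 => -[[y1 q] [y0 p]] [y02 pq] /=.
by rewrite /rel_pt /= => -> -> -> -> -> ->.
Qed.

Let triple_ext (x x' : (R -> G) * (R -> G) * (R -> G)) :
  x.1.1 = x'.1.1 -> x.1.2 = x'.1.2 -> x.2 = x'.2 -> x = x'.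
Proof. by case: x x' => -[? ?] ? [[? ?] ?] /= -> -> ->. Qed.

(** Naturality squares that correspond under the gradings are the same square of the
    crossed module. *)
Lemma rel_mul_tau (l1 l2 : st_elts (w_mul W)) (l1' l2' : st_elts (Sigma (C_map Q L)))
    (e : elts (product12_01 E)) (f : elts (pull_gerbe e02 E))
    (e' : elts (product12_01 C)) (f' : elts (pull_gerbe e02 C))
    (y : elts E * elts E) (y' : elts C * elts C) :
  st_mem i l1' -> st_mem i l2' -> rel_mul i l1 l1' -> rel_mul i l2 l2' ->
  el i e' -> el i f' ->
  e.2 y -> e'.2 y' -> rel_el (e12 i) y.1 y'.1 -> rel_el (e01 i) y.2 y'.2 ->
  rel_el (e02 i) f f' -> tau i l1 l2 e f -> tau i l1' l2' e' f'.
Proof.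
move=> m1' m2' [r1 r2 r3 r4] [t1 t2 t3 t4] me' mf'.
case: y y' => a b [a' b'] ea ea' ra rb rf te.
have {}ra : rel_el (e12 i) a a' := ra; have {}rb : rel_el (e01 i) b b' := rb.
have [[m1 m2 me mf] p1 p2 v] := (tauP gw _ _ _ _).1 te.
have [_ se tge ve] := tensor_elP (graded_w12 (cs_graded Q L) h12)
  (graded_w01 (cs_graded Q L) h01) me ea.
have [_ se' tge' ve'] := tensor_elP (graded_pull_gerbe (c_graded_gerbe c12))
  (graded_pull_gerbe (c_graded_gerbe c01)) me' ea'.
have ends : [/\ (src a : Q * (R -> G)).2 = src a', (src b : Q * (R -> G)).2 = src b',
    (tgt a : Q * (R -> G)).2 = tgt a' & (tgt b : Q * (R -> G)).2 = tgt b'].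
  rewrite -ra -rb; split; by [|case: (a) => -[? ?] ?|case: (b) => -[? ?] ?].
have endf : (src f : Q * (R -> G)).2 = src f' /\ (tgt f : Q * (R -> G)).2 = tgt f'.
  by rewrite -rf; split; case: (f) => -[? ?] ?.
have [sa sb ta tb] := ends; have [sf tf] := endf.
move: r1 r2 r3 t1 t2 t3; rewrite /rel_pt p1 p2 se tge /= sa sb ta tb sf tf.
move=> r1 r2 r3 t1 t2 t3; apply/(tauP gc); split=> //.
- by apply: triple_ext; rewrite ?se' //; apply: esym.
- by apply: triple_ext; rewrite ?tge' //; apply: esym.
rewrite -r4 -t4; move: v; rewrite [X in lie_mul X _]ve [X in _ -> lie_mul X _ = _]ve'.
have Ka : gr_path (pull_grading e12 wg) (src a) = gr_path (pull_grading e12 cg) (src a') :=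
  sa.
have Fa : gr_lift (pull_grading e12 wg) a = gr_lift (pull_grading e12 cg) a' :=
  congr1 snd ra.
have Fb : gr_lift (pull_grading e01 wg) b = gr_lift (pull_grading e01 cg) b' :=
  congr1 snd rb.
have Ff : gr_lift (pull_grading e02 wg) f = gr_lift (pull_grading e02 cg) f' :=
  congr1 snd rf.
by rewrite Ka Fa Fb Ff.
Qed.

Lemma rel_mul_act (l : st_elts (w_mul W)) (l' : st_elts (Sigma (C_map Q L))) z :
  st_mem i l -> st_mem i l' -> circle z -> rel_mul i l l' ->
  rel_mul i (bu_act l z : st_elts (w_mul W)) (bu_act l' z : st_elts (Sigma (C_map Q L))).
Proof.
move=> ml ml' cz [r1 r2 r3 r4].
have [_ p v] := gb_act (gs_bundle gw) ml cz.
have [_ p' v'] := gb_act (gs_bundle gc) ml' cz.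
by split; rewrite ?p ?p' // [LHS]v [RHS]v' r4.
Qed.
End Multiplication.
End Comparison.

(** ** Smoothness of the comparison *)

Section ComparisonPlots.
Variables (R : realType) (G : lie_group R) (X : fmanifold R) (Q : principal_bundle G X).
Variables (B : lie_alg G -> lie_alg G -> R) (L : level1_extension B).
Local Notation "p **p q" := (@path_mul R G p q) (at level 40, left associativity).
Local Notation pinv := (@path_inv R G).
Local Notation W := (CS Q L).
Local Notation E := (w_gerbe (CS Q L)).
Local Notation C := (C_gerbe Q L).
Local Notation wg := (cs_grading Q L).
Local Notation cg := (c_grading Q L).
Local Notation fib3 := (fibre3 (@pb_proj R G X Q : space_of Q -> X)).

Variables (V : tvsType R) (U : set V) (i : V -> Q * Q * Q).
Variables (a : V -> st_elts (w_mul W)).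
Variables (b : V -> ((R -> G) * (R -> G)) * ((R -> G) * L)).

(** An element of the stable isomorphism induced by the multiplication starts at the
    product of the two paths, so that component is smooth as soon as they are. *)
Lemma Sigma_C_plotP : (forall u, U u -> st_mem (i u) (b u : st_elts (Sigma (C_map Q L)))) ->
  @fa_plot R _ (st_bundle (Sigma (C_map Q L))) V U i b <->
  [/\ @sp_plot R (PG G) V U (fun u => (b u).1.1), @sp_plot R (PG G) V U (fun u => (b u).1.2)
    & @sp_plot R (space_of L) V U (fun u => (b u).2.2)].
Proof.
move=> mb; split=> [[[[[p1 _] [p2 _]] [[_ p4] _]] _]|[p1 p2 p4]]; first by split.
have ms u (Uu : U u) := (Sigma_memP (A := product12_01 C) (C := pull_gerbe e02 C) _ _).1 (mb u Uu).
split; last by move=> u Uu; have [_ _] := ms u Uu.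
split.
  split; split=> // u Uu; have [[m1 m2] _ _] := ms u Uu; last by have [] := (c_ptP L _ _).1 m2.
  by have [] := (c_ptP L _ _).1 m1.
split; last by move=> u Uu; have [_ /c_elP me _] := ms u Uu; have [] := (c_ptP L _ _).1 me.
split; last exact: p4.
apply: (plot_ext (path_sheaf G)) (plot_path_mul p2 p1) => u Uu.
by have [_ _ h] := ms u Uu; exact: esym h.
Qed.

Hypothesis pli : @sp_plot R fib3 V U i.
Hypothesis rab : forall u, U u -> [/\ st_mem (i u) (a u),
  st_mem (i u) (b u : st_elts (Sigma (C_map Q L))) & rel_mul (i u) (a u) (b u)].

Let fib u : U u -> [/\ pb_proj (e12 (i u)).1 = pb_proj (e12 (i u)).2,
  pb_proj (e01 (i u)).1 = pb_proj (e01 (i u)).2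
  & pb_proj (e02 (i u)).1 = pb_proj (e02 (i u)).2].
Proof.
move=> Uu; have [[[_ f1] _] f2] := pli; have h1 : pb_proj (i u).1.1 = pb_proj (i u).1.2 := f1 u Uu.
have h2 : pb_proj (i u).1.2 = pb_proj (i u).2 := f2 u Uu.
by split=> //=; rewrite h1.
Qed.

Let ZS : sheaf_of_plots (rb_Z2 W) :=
  prod_sheaf (prod_sheaf (manifold_sheaf Q) (path_sheaf G)) (path_sheaf G).
Let ES : sheaf_of_plots (rb_E W) :=
  prod_sheaf (prod_sheaf (manifold_sheaf Q) (path_sheaf G)) (manifold_sheaf L).

Lemma plot_le_proj N (c : V -> L) : @sp_plot R (space_of L) V N c ->
  @sp_plot R (PG G) V N (fun u => le_proj (c u)).
Proof. by move=> pc; have [_ h] := @le_proj_smooth R G B L; have [] := h V N c pc. Qed.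

Lemma plot_tgt N (x : V -> elts E) : @sp_plot R (rb_E W) V N x ->
  @sp_plot R (PG G) V N (fun u => (tgt (x u) : Q * (R -> G)).2).
Proof.
move=> [[_ px] pc]; apply: (plot_ext (path_sheaf G)) (plot_path_mul px (plot_le_proj pc)).
by move=> u _; rewrite /=; case: (x u) => -[].
Qed.

Lemma plot_twist N (x y : V -> elts E) :
  @sp_plot R (rb_E W) V N x -> @sp_plot R (rb_E W) V N y ->
  @sp_plot R (space_of L) V N (fun u => twist (gr_path wg (src (x u)))
    (gr_lift wg (x u)) (gr_lift wg (y u))).
Proof.
move=> [[_ px] pc] [_ pd]; apply: plot_mul pc.
have [_ h] := @le_Ad_smooth R G B L.
apply: (plot_ext (manifold_sheaf L)) (h V N (fun u => (pinv (x u).1.2, (y u).2)) _).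
  by move=> u _ /=; case: (x u) => -[].
by split; [exact: plot_path_inv px | exact: pd].
Qed.

(** In local lifts, the paths are targets of elements and the value is built from
    their lifts by the operations of the crossed module, all of which are smooth. *)
Lemma rel_mul_plot_lift : @fa_plot R _ (st_bundle (w_mul W)) V U i a ->
  @fa_plot R _ (st_bundle (Sigma (C_map Q L))) V U i b.
Proof.
move=> pa; apply/Sigma_C_plotP; first by move=> u /rab [].
have loc := w_mul_plot_lift (cs_graded Q L) ZS ES pa.
split.
- apply: (plot_local (path_sheaf G)) => u /loc [N [x [y [e [oN [px py pe] hN]]]]].
  exists N => //; apply: (plot_ext (path_sheaf G)) (plot_tgt px) => u' [Uu' Nu'].
  have [_ _ [r _ _ _]] := rab Uu'; have [pE _] := hN u' Uu' Nu'.
  by move: r; rewrite pE.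
- apply: (plot_local (path_sheaf G)) => u /loc [N [x [y [e [oN [px py pe] hN]]]]].
  exists N => //; apply: (plot_ext (path_sheaf G)) (plot_tgt py) => u' [Uu' Nu'].
  have [_ _ [_ r _ _]] := rab Uu'; have [pE _] := hN u' Uu' Nu'.
  by move: r; rewrite pE.
apply: (plot_local (manifold_sheaf L)) => u /loc [N [x [y [e [oN [px py pe] hN]]]]].
exists N => //; apply: (plot_ext (manifold_sheaf L))
    (plot_mul (plot_inv (plot_twist px py)) pe.2) => u' [Uu' Nu'].
have [_ _ [_ _ _ r]] := rab Uu'; have [_ vE] := hN u' Uu' Nu'.
by rewrite -[RHS]r vE.
Qed.

Let pair_ext (S T : Type) (z z' : S * T) : z.1 = z'.1 -> z.2 = z'.2 -> z = z'.
Proof. by case: z z' => ? ? [? ?] /= -> ->. Qed.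

Lemma rel_mul_plot_build : @fa_plot R _ (st_bundle (Sigma (C_map Q L))) V U i b ->
  @fa_plot R _ (st_bundle (w_mul W)) V U i a.
Proof.
move=> pb; have mbU u (Uu : U u) : st_mem (i u) (b u : st_elts (Sigma (C_map Q L))).
  by have [] := rab Uu.
have [pq pp pd] := (Sigma_C_plotP mbU).1 pb.
have [[[[py0 py1] _] _] _] := pli.
have p1 : @sp_plot R (space_of L) V U (fun=> lie_one L) := plot_cst _ (plot_domain pd).
(* the 2-simplex on the two paths, with unit elements over its two edges: the class
   then has the lift of e as its value *)
pose w u : pts (w_gerbe012 W) := (((i u).1.1, (b u).1.2), (b u).1.1).
pose x u : elts E := (((i u).1.2, (b u).1.1), lie_one L).
pose y u : elts E := (((i u).1.1, (b u).1.2), lie_one L).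
pose e u : elts E := (((i u).1.1, (b u).1.2 **p (b u).1.1), (b u).2.2).
have facts u (Uu : U u) : [/\ [/\ pt (i u) (w u), el (e12 (i u)) (x u), el (e01 (i u)) (y u)
      & el (e02 (i u)) (e u)],
    (src (x u), src (y u)) = (rb_face_2_0 (w u), rb_face_2_2 (w u))
    & src (e u) = rb_face_2_1 (w u)].
  have [x12 x01 x02] := fib Uu; have [ma mb rl] := rab Uu.
  have [[m12 m01] m02 sE] :=
    (Sigma_memP (A := product12_01 C) (C := pull_gerbe e02 C) _ _).1 mb.
  have n12 : pt (e12 (i u)) ((x u).1 : pts E).
    by apply/(cs_c_ptP L (x u).1 x12); split; [|exact: m12].
  have n01 : pt (e01 (i u)) ((y u).1 : pts E).
    by apply/(cs_c_ptP L (y u).1 x01); split; [|exact: m01].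
  have [q1 q2] := (cs_ptP _ _).1 n12; have [r1 r2] := (cs_ptP _ _).1 n01.
  have evp : pb_act (i u).1.1 ((b u).1.2 (2 * pi)) = (i u).1.2 by case: r2.
  have evq : pb_act (i u).1.2 ((b u).1.1 (2 * pi)) = (i u).2 by case: q2.
  split; first split.
  - by apply/cs_pt012P; split=> //=; rewrite evp evq; case: (i u) => -[].
  - exact/cs_elP.
  - exact/cs_elP.
  - apply/cs_elP/cs_ptP; split; first exact: is_path_mul.
    by rewrite /= ev_mul evp evq.
  - by rewrite /= evp.
  - by [].
have [px py pe] : [/\ @sp_plot R (rb_E W) V U x, @sp_plot R (rb_E W) V U y
    & @sp_plot R (rb_E W) V U e].
  by split; split=> //; split=> //; exact: plot_path_mul.
have pw : @sp_plot R (rb_Z2 W) V U w by split=> //; split.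
apply: (w_mul_plot_build (cs_graded Q L) (w := w) (x := x) (y := y) (e := e)) => //.
- by move=> u /facts [].
- by move=> u /facts [_ ? ?]; split.
move=> u Uu; have [x12 x01 x02] := fib Uu; have [ma mb [r1 r2 r3 r4]] := rab Uu.
have [h12 h01] := w_mul_inhabited (cs_graded Q L) ma.
have [[m12 m01] m02 _] := st_ends (graded_w_mul (cs_graded Q L) h12 h01) ma.
have [j12 _] := (cs_c_ptP L _ x12).1 m12; have [j01 _] := (cs_c_ptP L _ x01).1 m01.
have [j02 _] := (cs_c_ptP L _ x02).1 m02.
have [[n12 _] _ sE] :=
  (Sigma_memP (A := product12_01 C) (C := pull_gerbe e02 C) _ _).1 mb.
split=> //.
  have t12 : (bu_proj (a u)).1.1 = tgt (x u).
    by apply: pair_ext; [rewrite [LHS]j12 | rewrite [LHS]r1 /= le_proj1 path_mulg1].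
  have t01 : (bu_proj (a u)).1.2 = tgt (y u).
    by apply: pair_ext; [rewrite [LHS]j01 | rewrite [LHS]r2 /= le_proj1 path_mulg1].
  have t02 : (bu_proj (a u)).2 = tgt (e u).
    apply: pair_ext; [by rewrite [LHS]j02 | rewrite [LHS]r3 /=].
    by congr path_mul; exact: sE.
  by rewrite -t12 -t01 -t02 -!surjective_pairing.
rewrite [LHS]r4 twist1 ?lie_inv1 ?lie_mul1g //.
by have [] := (c_ptP L _ _).1 n12.
Qed.
End ComparisonPlots.

(** ** The isomorphism of bundle 2-gerbes *)

Section Rigidification.
Variables (R : realType) (G : lie_group R) (X : fmanifold R) (Q : principal_bundle G X).
Variables (B : lie_alg G -> lie_alg G -> R) (L : level1_extension B).
Local Notation W := (CS Q L).
Local Notation E := (w_gerbe (CS Q L)).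
Local Notation C := (C_gerbe Q L).
Local Notation wg := (cs_grading Q L).
Local Notation cg := (c_grading Q L).
Local Notation G1 := (w W).
Local Notation G2 := (chern_simons_2_gerbe Q L).
Local Notation idQ := (fun y : Q => y).
Local Notation fib3 := (fibre3 (@pb_proj R G X Q : space_of Q -> X)).
Local Notation fib4 := (fibre4 (@pb_proj R G X Q : space_of Q -> X)).

Lemma Sigma_C_inhabited i (l : st_elts (Sigma (C_map Q L))) : sp_mem (i : fib3) ->
  st_mem i l -> inhabited_at (W := W) (e12 i) /\ inhabited_at (W := W) (e01 i).
Proof.
move=> iX ml; have [[m12 m01] _ _] :=
  (Sigma_memP (A := product12_01 C) (C := pull_gerbe e02 C) _ _).1 ml.
have [x12 x01] : pb_proj (e12 i).1 = pb_proj (e12 i).2 /\ pb_proj (e01 i).1 = pb_proj (e01 i).2.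
  by case: iX => -[[_ f1] _] f2.
split; apply: (cs_inhabited (L := L)) => //; eexists; [exact: m12 | exact: m01].
Qed.

Lemma respects_multiplication :
  @respects_mul R X G1 G2 idQ (@rel_pt R G X Q B L) (@rel_el R G X Q B L)
    (@rel_mul R G X Q B L).
Proof.
rewrite /respects_mul map3_idE; split.
- split.
  + move=> i l iX ml; have [h12 h01] := w_mul_inhabited (cs_graded Q L) ml.
    exact: (rel_mul_total iX h12 h01 ml).
  + move=> i l iX ml; have [h12 h01] := Sigma_C_inhabited iX ml.
    exact: (rel_mul_onto iX h12 h01 ml).
  + move=> V U i a b pi rab; split.
      exact: (rel_mul_plot_lift (i := i) (a := a) (b := b) rab).
    exact: (rel_mul_plot_build (i := i) (a := a) (b := b) pi rab).
- by move=> i l l' _ [_ _ [r1 r2 r3 _]].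
- move=> i l l' z iX [ml ml' r] cz; have [h12 h01] := w_mul_inhabited (cs_graded Q L) ml.
  exact: (rel_mul_act iX h12 h01 ml ml' cz r).
- move=> i l1 l2 e f l1' l2' e' f' iX [ml1 ml1' r1] [ml2 ml2' r2] me mf.
  move=> [y [y' [ey ey' ra rb]]] rf t.
  have [h12 h01] := w_mul_inhabited (cs_graded Q L) ml1.
  exact: (rel_mul_tau iX h12 h01 ml1' ml2' r1 r2 me mf ey ey' ra rb rf t).
Qed.

(** Both associators are graded, and corresponding elements have equal values. *)
Lemma respects_associator :
  @respects_assoc R X G1 G2 idQ (@rel_pt R G X Q B L) (@rel_el R G X Q B L)
    (@rel_mul R G X Q B L).
Proof.
rewrite /respects_assoc map4_idE => i x1 x2 x1' x2' iX m1 m2 m1' m2' r1 r2.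
have [h23 h12 h01] := w_assoc_inhabited (cs_graded Q L) m1.
have [x23 x12 x01 x03] : [/\ pb_proj (g23 i).1 = pb_proj (g23 i).2,
    pb_proj (g12 i).1 = pb_proj (g12 i).2, pb_proj (g01 i).1 = pb_proj (g01 i).2
    & pb_proj (g03 i).1 = pb_proj (g03 i).2].
  case: i iX {x1 x2 x1' x2' m1 m2 m1' m2' r1 r2 h23 h12 h01} => -[[y0 y1] y2] y3.
  by move=> [[[[[/= _ e1] _] /= e2] _] /= e3]; split=> //=; rewrite e1 e2.
have c23 := c_inhabited (L := L) x23 h23; have c12 := c_inhabited (L := L) x12 h12.
have c01 := c_inhabited (L := L) x01 h01.
have [p123 p013 p012 p023] := graded_w_faces (cs_graded Q L) h23 h12 h01.
have [q123 q013 q012 q023] := graded_C_faces iX c23 c12 c01.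
have bij (j : Q * Q) (z1 z2 : pts E) (z1' z2' : pts C) : pb_proj j.1 = pb_proj j.2 ->
    pt j z1 -> pt j z2 -> rel_pt j z1 z1' -> rel_pt j z2 z2' -> z1 = z2 <-> z1' = z2'.
  move=> jX n1 n2 <- <-.
  have [y1 _] := (cs_c_ptP L z1 jX).1 n1; have [y2 _] := (cs_c_ptP L z2 jX).1 n2.
  by split=> [-> //|]; case: z1 z2 y1 y2 {n1 n2} => ? ? [? ?] /= -> -> ->.
have lift (j : Q * Q) (e : elts E) (e' : elts C) : rel_el j e e' ->
    gr_lift wg e = gr_lift cg e' by move=> <-.
have ga := graded_w_assoc (cs_graded Q L) h23 h12 h01.
have gc := graded_C_assoc iX c23 c12 c01.
have key := @graded_arrows_agree R G B L X (space_of Q) E C wg cg (w_mul W) (w_mul_val wg)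
  (Sigma (C_map Q L)) (strict_mul_val cg) (@rel_pt R G X Q B L) (@rel_el R G X Q B L)
  (@rb_proj R X W) (@pb_proj R G X Q) (@w_assoc R X W) (@C_assoc R G X Q B L)
  (@rel_mul R G X Q B L) (fun j l l' h => h) i
  (graded_w_edges (cs_graded Q L) h23 h12 h01) (graded_C_edges iX c23 c12 c01)
  p123 p013 p012 p023 q123 q013 q012 q023 (fun j z z' h => h) lift
  (fun j => pb_proj j.1 = pb_proj j.2) x23 x12 x01 x03 bij x1 x2 x1' x2' ga gc.
exact: (key m1 m2 m1' m2' r1 r2).
Qed.
End Rigidification.

Theorem theorem3p7 (R : realType) (G : lie_group R)
    (hG : compact_simple_simply_connected G)
    (X : fmanifold R) (Q : principal_bundle G X)
    (B : lie_alg G -> lie_alg G -> R) (hB : basic_inner_product B)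
    (L : level1_extension B) :
  is_rigidification (CS Q L) (chern_simons_2_gerbe Q L).
Proof.
exists (fun y => y), (@rel_pt R G X Q B L), (@rel_el R G X Q B L), (@rel_mul R G X Q B L).
split; [exact: identity_diffeo | exact: gerbe_iso | exact: respects_multiplication
  | exact: respects_associator].
Qed.
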